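(* Let $V=\mathbb{R}^{1,n+1}$ be the $(n+2)$-dimensional Minkowski vector space with standard decomposition $V=\mathbb{R}p+E+\mathbb{R}q$. Up to conjugation, connected totally reducible subgroups of the Lorentz group of $V$ are divided into the following three types: Type I: connected subgroups of the maximal compact Lie group $\mathrm{SO}(n+1)$; Type II: connected subgroups of the form $\mathrm{SO}^0(W)\cdot K$, where $W=V(H)$ is a Lorentzian subspace of $V$ with $\dim W\ge 3$, and $K$ is a connected subgroup of $\mathrm{SO}(W^{\perp})$; Type III: subgroups of the form $T\cdot K$, where $K\subset \mathrm{SO}(E)$ is a connected subgroup and $T$ is a $1$-parameter subgroup of $\mathrm{SO}(1,1)\times \mathrm{SO}(E)$ not contained in $\mathrm{SO}(E)$ and commuting with $K$.
   Context: $V=\mathbb{R}^{1,n+1}$ is equipped with the Lorentzian inner product $g(u,v)=-u_0v_0+\sum_{i=1}^{n+1}u_iv_i$. Fix a Witt basis $p,e_1,\dots,e_n,q$ of $V$: $p,q$ are isotropic with $g(p,q)=1$, and $e_1,\dots,e_n$ is an orthonormal basis of $E:=(\mathbb{R}p+\mathbb{R}q)^{\perp}$, a Euclidean space. The decomposition $V=\mathbb{R}p+E+\mathbb{R}q$ is called a standard decomposition; $\mathrm{SO}(1,1)$ denotes the Lorentz group of $\mathbb{R}p+\mathbb{R}q$. For a subspace $H\subset E$, $V(H):=\mathbb{R}p+H+\mathbb{R}q$. $\mathrm{SO}^0$ denotes the identity component. Subgroups are (connected) Lie subgroups; a subgroup is totally reducible if every invariant subspace of $V$ has an invariant complement. 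*)

(* Defs.v *)
From HB Require Import structures.
From mathcomp Require Import all_boot all_order all_algebra.
From mathcomp Require Import all_classical all_reals all_analysis.
Set Implicit Arguments.
Unset Strict Implicit.
Unset Printing Implicit Defensive.
Import Order.TTheory GRing.Theory Num.Theory.
Import numFieldNormedType.Exports.
Local Open Scope classical_set_scope.
Local Open Scope ring_scope.

(* V = R^{1,n+1} is the space 'rV[R]_n.+2 of row vectors, the coordinate u_0   *)
(* being u 0 ord0.  Linear maps are square matrices acting by v |-> v *m A,    *)
(* and subspaces of V are row spaces of matrices (scope %MS of mxalgebra).     *)

Definition lform (R : realType) (n : nat) (u v : 'rV[R]_n.+2) : R :=
  - (u 0 ord0 * v 0 ord0)
  + \sum_(i < n.+1) u 0 (lift ord0 i) * v 0 (lift ord0 i).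

Definition lgram (R : realType) (n : nat) : 'M[R]_n.+2 :=
  \matrix_(i, j) lform (delta_mx 0 i) (delta_mx 0 j).

(* The g-orthogonal complement of the row space of W; see perpP.               *)
Definition perp (R : realType) (n m : nat) (W : 'M[R]_(m, n.+2)) : 'M[R]_n.+2 :=
  kermx (lgram R n *m W^T).

Definition witt_basis (R : realType) (n : nat) (p : 'rV[R]_n.+2)
    (e : 'M[R]_(n, n.+2)) (q : 'rV[R]_n.+2) : Prop :=
  [/\ lform p p = 0, lform q q = 0, lform p q = 1,
      (e :=: perp (p + q)%MS)%MS
    & forall i j, lform (row i e) (row j e) = (i == j)%:R].

Definition lisometry (R : realType) (n : nat) (A : 'M[R]_n.+2) : Prop :=
  forall u v : 'rV[R]_n.+2, lform (u *m A) (v *m A) = lform u v.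

Definition SOV (R : realType) (n : nat) : set 'M[R]_n.+2 :=
  [set A | lisometry A /\ \det A = 1].

(* SO(W) for a nondegenerate subspace W of V, as a subgroup of SO(V): its      *)
(* elements are extended by the identity on the orthogonal complement of W, so *)
(* that \det A is the determinant of the restriction of A to W.                *)
Definition SO (R : realType) (n m : nat) (W : 'M[R]_(m, n.+2)) :
    set 'M[R]_n.+2 :=
  [set A | SOV A /\ stablemx W A /\ perp W *m A = perp W].

Definition SO0 (R : realType) (n m : nat) (W : 'M[R]_(m, n.+2)) :
    set 'M[R]_n.+2 :=
  connected_component (SO W) 1.

Definition set_mul (R : realType) (N : nat) (S T : set 'M[R]_N.+1) :
    set 'M[R]_N.+1 :=
  [set A | exists B C, [/\ S B, T C & A = B * C]].

Definition conj_set (R : realType) (N : nat) (A : 'M[R]_N.+1)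
    (G : set 'M[R]_N.+1) : set 'M[R]_N.+1 :=
  [set A * B * A^-1 | B in G].

Definition subgroup (R : realType) (N : nat) (G : set 'M[R]_N.+1) : Prop :=
  [/\ G `<=` [set A | A \is a GRing.unit], G 1,
      forall A B, G A -> G B -> G (A * B)
    & forall A, G A -> G A^-1].

Definition expmx (R : realType) (N : nat) (X : 'M[R]_N.+1) : 'M[R]_N.+1 :=
  limn (series (fun k => (k`!%:R)^-1 *: X ^+ k)).

Definition Lie_of (R : realType) (N : nat) (G : set 'M[R]_N.+1) :
    set 'M[R]_N.+1 :=
  [set X | forall t : R, G (expmx (t *: X))].

Definition Lie_subalgebra (R : realType) (N : nat) (h : set 'M[R]_N.+1) : Prop :=
  [/\ h 0, forall X Y, h X -> h Y -> h (X + Y),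
      forall (a : R) X, h X -> h (a *: X)
    & forall X Y, h X -> h Y -> h (X * Y - Y * X)].

(* Connected Lie subgroups of GL(N+1, R) as defined by B. C. Hall (Lie Groups, *)
(* Lie Algebras, and Representations, chapter 5): these are the connected      *)
(* immersed (analytic) Lie subgroups, not necessarily closed in GL(N+1, R).    *)
Definition connected_Lie_subgroup (R : realType) (N : nat)
    (G : set 'M[R]_N.+1) : Prop :=
  [/\ subgroup G, Lie_subalgebra (Lie_of G)
    & forall A, G A -> exists s : seq 'M[R]_N.+1,
        (forall X, X \in s -> Lie_of G X) /\ A = \prod_(X <- s) expmx X].

Definition one_parameter_subgroup (R : realType) (N : nat)
    (T : set 'M[R]_N.+1) : Prop :=
  exists phi : R -> 'M[R]_N.+1,
    [/\ continuous phi, phi 0 = 1,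
        forall s t, phi (s + t) = phi s * phi t & T = range phi].

Definition invariant_subspace (R : realType) (N : nat) (G : set 'M[R]_N.+1)
    (U : 'M[R]_N.+1) : Prop :=
  forall A, G A -> stablemx U A.

Definition totally_reducible (R : realType) (N : nat)
    (G : set 'M[R]_N.+1) : Prop :=
  forall U : 'M[R]_N.+1, invariant_subspace G U ->
  exists U' : 'M[R]_N.+1,
    [/\ invariant_subspace G U', (U + U' :=: 1%:M)%MS & (U :&: U')%MS = 0].

(* SO(n+1) is SO of the Euclidean hyperplane u_0 = 0.                          *)
Definition typeI (R : realType) (n : nat) (G : set 'M[R]_n.+2) : Prop :=
  connected_Lie_subgroup G /\ G `<=` SO (perp (delta_mx 0 ord0 : 'rV[R]_n.+2)).

Definition typeII (R : realType) (n : nat) (p q : 'rV[R]_n.+2)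
    (G : set 'M[R]_n.+2) : Prop :=
  exists (H : 'M[R]_n.+2) (K : set 'M[R]_n.+2),
    let W := (p + H + q)%MS in
    [/\ (H <= perp (p + q)%MS)%MS, (3 <= \rank W)%N,
        connected_Lie_subgroup K, K `<=` SO (perp W)
      & G = set_mul (SO0 W) K].

Definition typeIII (R : realType) (n : nat) (p q : 'rV[R]_n.+2)
    (G : set 'M[R]_n.+2) : Prop :=
  let E := perp (p + q)%MS in
  exists T K : set 'M[R]_n.+2,
    [/\ connected_Lie_subgroup K /\ K `<=` SO E,
        one_parameter_subgroup T /\ T `<=` set_mul (SO (p + q)%MS) (SO E),
        ~ (T `<=` SO E),
        forall A B, T A -> K B -> A * B = B * A
      & G = set_mul T K].

Definition up_to_conjugation (R : realType) (n : nat)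
    (P : set 'M[R]_n.+2 -> Prop) (G : set 'M[R]_n.+2) : Prop :=
  exists2 A : 'M[R]_n.+2, SOV A & P (conj_set A G).

Lemma lform_delta (R : realType) (n : nat) (u : 'rV[R]_n.+2) (j : 'I_n.+2) :
  lform u (delta_mx 0 j) = u 0 j * (if j == ord0 then -1 else 1).
Proof.
have l0 (k : 'I_n.+1) : (lift ord0 k == ord0) = false by [].
rewrite /lform; case: (unliftP ord0 j) => [j'|] ->.
  rewrite l0 mulr1 mxE [ord0 == lift _ _]eq_sym l0 andbF mulr0 oppr0 add0r.
  rewrite (bigD1 j') //= big1 => [|k nk]; first by rewrite mxE !eqxx mulr1 addr0.
  by rewrite mxE (inj_eq lift_inj) (negbTE nk) andbF mulr0.
rewrite mxE !eqxx mulr1 mulrN1 big1 ?addr0 // => k _.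
by rewrite mxE l0 andbF mulr0.
Qed.

Lemma lform_gram (R : realType) (n : nat) (u v : 'rV[R]_n.+2) :
  lform u v = (u *m lgram R n *m v^T) 0 0.
Proof.
have -> : u *m lgram R n = \row_j (u 0 j * (if j == ord0 then -1 else 1)).
  apply/rowP => j; rewrite !mxE (bigD1 j) //= big1 => [|k nk].
    by rewrite addr0 mxE lform_delta mxE !eqxx mul1r.
  by rewrite mxE lform_delta mxE eqxx [j == k]eq_sym (negbTE nk) mul0r mulr0.
rewrite !mxE big_ord_recl !mxE /= mulrN1 mulNr; congr (_ + _).
by apply: eq_bigr => k _; rewrite !mxE /= mulr1.
Qed.

Lemma perpP (R : realType) (n m : nat) (W : 'M[R]_(m, n.+2))
    (u : 'rV[R]_n.+2) :
  (u <= perp W)%MS <-> forall v : 'rV[R]_n.+2, (v <= W)%MS -> lform u v = 0.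
Proof.
rewrite /perp; split.
  move=> /sub_kermxP; rewrite mulmxA => uW v /submxP[D ->].
  by rewrite lform_gram trmx_mul mulmxA uW mul0mx mxE.
move=> uW; apply/sub_kermxP; rewrite mulmxA; apply/rowP => j; rewrite [RHS]mxE.
have := uW (row j W) (row_sub j W); rewrite lform_gram => <-.
by rewrite !mxE; apply: eq_bigr => k _; rewrite !mxE.
Qed.

(* Main.v *)
(* The Lie algebra h of G consists of g-skew operators.  If G fixes a timelike  *)
(* vector, it is conjugate into SO(n+1).  If G preserves an isotropic line R x, *)
(* an invariant complement of the orthogonal of x gives a second invariant      *)
(* isotropic line, so after conjugation G preserves R p and R q; unless G fixes *)
(* a timelike vector, h is the sum of the annihilator of p and of a line which  *)
(* is orthogonal to it for the trace form, hence commutes with it: this is type *)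
(* III.  Otherwise let W be a minimal invariant subspace containing a nonzero   *)
(* causal vector.  It is Lorentzian, irreducible and of dimension at least 3.   *)
(* A Casimir argument gives X in h with a nonzero real eigenvalue on W, hence a *)
(* Witt pair of eigenvectors; bracketing with the associated boost splits off   *)
(* root components, and opposite roots generate all of so(W).  So h is the sum  *)
(* of so(W) and the annihilator of W: this is type II.                          *)
(*   Conversely, in types I and II an invariant subspace U has the complement   *)
(* obtained from a positive definite form or from g; in type III a radical line *)
(* of U is R p or R q, and exchanging p and q pairs U with its dual space.  The *)
(* types are told apart by the timelike vectors that G fixes and the isotropic  *)
(* lines that it preserves.                                                     *)
Require Import Defs.
From HB Require Import structures.
From mathcomp Require Import all_boot all_order all_algebra.
From mathcomp Require Import all_classical all_reals all_analysis.
From mathcomp Require Import complex.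
From mathcomp Require Import ring lra.
Set Implicit Arguments.
Unset Strict Implicit.
Unset Printing Implicit Defensive.
Import Order.TTheory GRing.Theory Num.Theory.
Import numFieldNormedType.Exports.
Local Open Scope classical_set_scope.
Local Open Scope ring_scope.

(** * The matrix exponential *)

(** Everything passes through the Lie algebra h = [Lie_of G]. By [connected_expprod] G consists of
    products of exponentials of h, [expmx_tangent_eq0] differentiates what G satisfies, and
    [isometry_expmx_skew] makes h skew for g. So G and h have the same fixed vectors and invariant
    subspaces, and a splitting of h into commuting summands splits G.

    The Lorentzian input is [causal_orth]: the orthogonal of a timelike vector is positive definite,
    and a totally isotropic subspace is at most a line. Hence the radical of an invariant subspace
    is zero or an invariant isotropic line ([radical_line_invariant]).

    From total reducibility to the types ([totally_reducible_types]): a fixed timelike vector gives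
    type I. An invariant isotropic line x has a partner, found in an invariant complement of the
    orthogonal of x, and [typeIII_of_lines] splits off the boost direction as the orthogonal of the
    annihilator of p, on which the trace form is definite. With neither, a minimal invariant
    subspace W with a causal vector is nondegenerate, irreducible and of dimension at least 3, and
    [irreducible_wedge] puts so(W) into h: [no_real_eigenvalue_absurd] yields a Witt pair p, q of
    eigenvectors, [normal_adjoint_stable] shows that the bracket with [wedge p q] preserves h, and
    the resulting root components generate. [typeII_of_wedges] passes back to the group by
    [SO0_expprod], where isometries are products of reflections and two reflections make two null
    rotations.

    Conversely, complements all come from [complement_pairing]: the orthogonal of an invariant
    subspace that g pairs with U. The types are told apart by two conjugation invariants,
    [fixes_timelike] and [line_invariant]: type I fixes a timelike vector, type II preserves no
    causal line, type III preserves the lines of p and q and contains a proper boost. *)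

Section MatrixLimits.
Variables (R : realType) (T : Type) (F : set_system T).
Context {FF : Filter F}.

Lemma cvg_mxP (m n : nat) (f : T -> 'M[R]_(m, n)) (A : 'M[R]_(m, n)) :
  f @ F --> A <-> forall i j, (fun x => f x i j) @ F --> A i j.
Proof.
split=> [fA i j|fA].
  exact: (cvg_comp _ _ fA (@coord_continuous R m n i j A)).
apply/cvgrPdist_lt => e e0.
have : \forall x \near F, forall ij : 'I_m * 'I_n,
    `|A ij.1 ij.2 - f x ij.1 ij.2| < e.
  apply: filter_forall => -[i j] /=.
  by have /cvgrPdist_lt := fA i j; apply.
apply: filterS => x fx; rewrite [ltLHS]/Num.norm /= mx_normrE.
by apply/bigmax_ltP; split=> // ij _; rewrite !mxE.
Qed.

Lemma cvg_mulmx (m k n : nat) (f : T -> 'M[R]_(m, k)) (g : T -> 'M[R]_(k, n))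
    (A : 'M[R]_(m, k)) (B : 'M[R]_(k, n)) :
  f @ F --> A -> g @ F --> B -> (fun x => f x *m g x) @ F --> A *m B.
Proof.
move=> /cvg_mxP fA /cvg_mxP gB; apply/cvg_mxP => i j.
under eq_fun do rewrite mxE; rewrite mxE.
apply: cvg_big => [|l _]; first exact: add_continuous.
exact: cvgM.
Qed.

Lemma cvg_mulmxl (m k n : nat) (A : 'M[R]_(m, k)) (g : T -> 'M[R]_(k, n))
    (B : 'M[R]_(k, n)) :
  g @ F --> B -> (fun x => A *m g x) @ F --> A *m B.
Proof. by apply: cvg_mulmx; exact: cvg_cst. Qed.

Lemma cvg_mulmxr (m k n : nat) (B : 'M[R]_(k, n)) (f : T -> 'M[R]_(m, k))
    (A : 'M[R]_(m, k)) :
  f @ F --> A -> (fun x => f x *m B) @ F --> A *m B.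
Proof. by move=> fA; apply: cvg_mulmx fA _; exact: cvg_cst. Qed.

Lemma cvg_trmx (m n : nat) (f : T -> 'M[R]_(m, n)) (A : 'M[R]_(m, n)) :
  f @ F --> A -> (fun x => (f x)^T) @ F --> A^T.
Proof.
move=> /cvg_mxP fA; apply/cvg_mxP => i j; rewrite mxE.
by under eq_fun do rewrite mxE; exact: fA.
Qed.

End MatrixLimits.

Section PartialSums.
Variables (R : realType) (A : algType R).
Implicit Types x y : A.

(** Taken in an arbitrary algebra so that one remainder formula serves both for matrices and for
    [R^o], where it bounds the matrix remainder. *)
Definition expsum x n : A := \sum_(0 <= k < n) (k`!%:R : R)^-1 *: x ^+ k.

Lemma sum_triangle (V : zmodType) (f : nat -> nat -> V) n :
  \sum_(0 <= k < n) \sum_(0 <= i < k.+1) f (k - i)%N i =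
  \sum_(0 <= i < n) \sum_(0 <= j < n - i) f j i.
Proof.
elim: n => [|n IHn]; first by rewrite !big_geq.
rewrite big_nat_recr //= {}IHn [RHS]big_nat_recr //= subSnn.
rewrite big_nat1 [\sum_(0 <= i < n.+1) f (n - i)%N i]big_nat_recr //= subnn.
rewrite addrA -big_split /=; congr (_ + _).
apply: eq_big_nat => i /andP[_ ltin].
by rewrite subSn ?(ltnW ltin) // [RHS]big_nat_recr.
Qed.

(** Cauchy product: by the binomial theorem the terms of total degree less than n make up the
    partial sum at x + y, and the remainder is the part of the square i, j < n with i + j >= n. *)
Lemma expsumD x y n : GRing.comm x y -> expsum x n * expsum y n =
  expsum (x + y) n + \sum_(0 <= i < n) \sum_(n - i <= j < n)
    ((j`!%:R : R)^-1 *: x ^+ j) * ((i`!%:R : R)^-1 *: y ^+ i).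
Proof.
move=> cxy; pose f j i := ((j`!%:R : R)^-1 *: x ^+ j) * ((i`!%:R : R)^-1 *: y ^+ i).
have -> : expsum (x + y) n = \sum_(0 <= i < n) \sum_(0 <= j < n - i) f j i.
  rewrite -sum_triangle; apply: eq_bigr => k _.
  rewrite exprDn_comm // scaler_sumr -(big_mkord xpredT
    (fun i => k`!%:R^-1 *: (x ^+ (k - i) * y ^+ i *+ 'C(k, i)))).
  apply: eq_big_nat => i /= ltik; rewrite /f -scalerAl -scalerAr scalerA.
  rewrite -(@scaler_nat R A) scalerA; congr (_ *: _).
  have f0 m : (m`!%:R : R) != 0 by rewrite pnatr_eq0 -lt0n fact_gt0.
  have : ('C(k, i) * (i`! * (k - i)`!))%N%:R = k`!%:R :> R by rewrite bin_fact.
  rewrite !natrM => <-; have := f0 k; rewrite -(bin_fact (ltik : (i <= k)%N)).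
  rewrite !natrM => /[dup]; rewrite !mulf_eq0 !negb_or => /and3P[c1 c2 c3] _.
  by field; rewrite ?c1 ?c2 ?c3.
rewrite -big_split /= /expsum mulr_sumr; apply: eq_big_nat => i /andP[_ ltin].
by rewrite mulr_suml (big_cat_nat _ (leq_subr i n)).
Qed.
End PartialSums.

Section MatrixExponential.
Variables (R : realType) (N : nat).
Local Notation M := 'M[R]_N.+1.
Implicit Types X Y : M.

(** The norm on matrices is the largest entry, which is not submultiplicative; the factor N + 1
    compensates for it in [entry_exp_le]. *)
Definition mxbound X : R := N.+1%:R * `|X|.

Lemma mxbound_ge0 X : 0 <= mxbound X.
Proof. by rewrite mulr_ge0. Qed.

Lemma entry_le_norm X i j : `|X i j| <= `|X|.
Proof.
rewrite [leRHS]/Num.norm /= mx_normrE.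
exact: (le_bigmax _ (fun ij : 'I_N.+1 * 'I_N.+1 => `|X ij.1 ij.2|) (i, j)).
Qed.

Lemma entry_mul_le X Y a b : (forall i j, `|X i j| <= a) ->
  (forall i j, `|Y i j| <= b) -> forall i j, `|(X * Y) i j| <= N.+1%:R * (a * b).
Proof.
move=> Xa Yb i j; rewrite mxE; apply: le_trans (ler_norm_sum _ _ _) _.
have -> : N.+1%:R * (a * b) = \sum_(k < N.+1) a * b.
  by rewrite sumr_const card_ord mulr_natl.
by apply: ler_sum => k _; rewrite normrM ler_pM.
Qed.

Lemma entry_exp_le X k i j : `|(X ^+ k) i j| <= mxbound X ^+ k.
Proof.
elim: k i j => [|k IHk] i j.
  by rewrite !expr0 mxE; case: (i == j); rewrite ?normr1 ?normr0.
rewrite !exprS /mxbound -mulrA; apply: entry_mul_le => //.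
exact: entry_le_norm.
Qed.


Lemma series_expsum X :
  series (fun k => (k`!%:R)^-1 *: X ^+ k) = @expsum R M X.
Proof. by []. Qed.

Lemma expsum_scalar (x : R) : series (exp_coeff x) = @expsum R R^o x.
Proof.
apply/funext => n; apply: eq_big_nat => k _.
by rewrite /exp_coeff /= [LHS]mulrC.
Qed.

Lemma cvg_expsum_scalar (x : R) : @expsum R R^o x @ \oo --> expR x.
Proof. by rewrite -expsum_scalar; exact: is_cvg_series_exp_coeff. Qed.

Lemma expsum_entry X n i j :
  (@expsum R M X n) i j = series (fun k => (k`!%:R)^-1 * (X ^+ k) i j) n.
Proof.
by rewrite /expsum summxE; apply: eq_big_nat => k _; rewrite mxE.
Qed.

Lemma cvg_expmx X : @expsum R M X @ \oo --> expmx X.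
Proof.
have cv i j : cvgn (series (fun k => (k`!%:R : R)^-1 * (X ^+ k) i j)).
  apply: normed_cvg.
  apply: (@series_le_cvg _ _ (exp_coeff (mxbound X))) => //= [k|k|].
  - by rewrite exp_coeff_ge0 ?mxbound_ge0.
  - rewrite normrM normfV normr_nat mulrC ler_wpM2r ?invr_ge0 //.
    exact: entry_exp_le.
  - exact: is_cvg_series_exp_coeff.
suff cX : @expsum R M X @ \oo -->
    \matrix_(i, j) limn (series (fun k => (k`!%:R)^-1 * (X ^+ k) i j)).
  by rewrite /expmx series_expsum (cvg_lim (@norm_hausdorff _ _) cX).
apply/cvg_mxP => i j; rewrite mxE.
by under eq_fun do rewrite expsum_entry; exact: cv.
Qed.

Lemma expmx_unique X L : @expsum R M X @ \oo --> L -> expmx X = L.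
Proof. by move=> XL; exact: (cvg_lim (@norm_hausdorff _ _) XL). Qed.

(** The relation passes to powers and to the limit. It is used for conjugation (P invertible),
    commutation (X = Y), fixed vectors (X = 0) and stability of the row space of P. *)
Lemma expmx_intertwine X Y P : X * P = P * Y -> expmx X * P = P * expmx Y.
Proof.
move=> XPY.
have ePS n : @expsum R M X n * P = P * @expsum R M Y n.
  rewrite /expsum mulr_suml mulr_sumr; apply: eq_bigr => k _.
  rewrite -scalerAl -scalerAr; congr (_ *: _).
  elim: k => [|k IHk]; first by rewrite !expr0 mulr1 mul1r.
  by rewrite !exprS -mulrA IHk !mulrA XPY.
have hX : (fun n => @expsum R M X n * P) @ \oo --> expmx X * P.
  by apply: cvg_mulmxr; exact: cvg_expmx.
have hY : (fun n => @expsum R M X n * P) @ \oo --> P * expmx Y.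
  under eq_fun do rewrite ePS.
  by apply: cvg_mulmxl; exact: cvg_expmx.
exact: (cvg_unique (@norm_hausdorff _ _) hX hY).
Qed.

Lemma expmx_nilp3 X : X ^+ 3 = 0 -> expmx X = 1 + X + 2%:R^-1 *: X ^+ 2.
Proof.
move=> X3; apply: expmx_unique; apply: cvg_near_cst; exists 3%N => // n /= n3.
rewrite /expsum (big_cat_nat (leq0n 3) n3) /=.
have -> : \sum_(3 <= k < n) (k`!%:R : R)^-1 *: X ^+ k = 0.
  rewrite big_nat big1 // => k /andP[k3 _].
  by rewrite -(subnK k3) exprD X3 mulr0 scaler0.
rewrite addr0 3?big_nat_recr ?big_geq //= add0r !fact0 factS invr1 scale1r.
by rewrite expr0 expr1 !scale1r.
Qed.

Lemma expmx0 : expmx 0 = 1 :> M.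
Proof. by rewrite expmx_nilp3 ?expr0n // scaler0 !addr0. Qed.

(** The remainder of [expsumD] is bounded entrywise by N + 1 times the scalar remainder at
    [mxbound X] and [mxbound Y], which tends to 0 because the real exponential is already known to
    be multiplicative. *)
Lemma expmxD X Y : GRing.comm X Y -> expmx (X + Y) = expmx X * expmx Y.
Proof.
move=> cXY; have eXY : (fun n => @expsum R M X n * @expsum R M Y n) @ \oo -->
    expmx X * expmx Y.
  exact: (cvg_mulmx (@cvg_expmx X) (@cvg_expmx Y)).
suff rem0 : (fun n => @expsum R M X n * @expsum R M Y n -
    @expsum R M (X + Y) n) @ \oo --> (0 : M).
  apply: expmx_unique; rewrite -[expmx X * _]subr0.
  suff -> : @expsum R M (X + Y) =
      (fun n => @expsum R M X n * @expsum R M Y n) \-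
      (fun n => @expsum R M X n * @expsum R M Y n - @expsum R M (X + Y) n).
    exact: cvgB.
  by apply/funext => n /=; rewrite subKr.
pose c := mxbound X; pose d := mxbound Y.
have scal0 : (fun n => N.+1%:R * (@expsum R R^o c n * @expsum R R^o d n -
    @expsum R R^o (c + d) n)) @ \oo --> (0 : R).
  have -> : 0 = N.+1%:R * (expR c * expR d - expR (c + d)) :> R.
    by rewrite expRD subrr mulr0.
  apply: cvgM; first exact: cvg_cst.
  by apply: cvgB; [apply: cvgM|]; exact: cvg_expsum_scalar.
apply/cvg_mxP => i j; rewrite mxE; apply/cvgr0Pnorm_le => e e0.
have /cvgr0Pnorm_le /(_ e e0) := scal0; apply: filterS => n.
apply: le_trans; apply: le_trans (ler_norm _).
rewrite expsumD // [_ - _]addrAC subrr add0r.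
rewrite (@expsumD R R^o) ?[_ - _]addrAC ?subrr ?add0r; last exact: mulrC.
rewrite summxE; apply: le_trans (ler_norm_sum _ _ _) _.
rewrite mulr_sumr; apply: ler_sum => k _.
rewrite summxE; apply: le_trans (ler_norm_sum _ _ _) _.
rewrite mulr_sumr; apply: ler_sum => l _.
have pw (Z : M) m a b : `|(((m`!%:R : R)^-1 *: Z ^+ m) : M) a b| <=
    (m`!%:R : R)^-1 * mxbound Z ^+ m.
  rewrite mxE normrM ger0_norm ?invr_ge0 // ler_wpM2l ?invr_ge0 //.
  exact: entry_exp_le.
by apply: entry_mul_le.
Qed.

(** For k >= 2 and |t| <= 1 the power |t|^k is at most t^2, so the tail is bounded by t^2 times the
    scalar exponential series. *)
Lemma expmx_taylor X (t : R) i j : `|t| <= 1 ->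
  `|(expmx (t *: X) - 1 - t *: X) i j| <= t ^+ 2 * expR (mxbound X).
Proof.
move=> t1; pose c := mxbound X.
have cl : (fun n => `|(@expsum R M (t *: X) n - 1 - t *: X) i j|) @ \oo -->
    `|(expmx (t *: X) - 1 - t *: X) i j|.
  apply: cvg_norm; move: i j; apply/cvg_mxP.
  by apply: cvgB; [apply: cvgB; [exact: cvg_expmx|]|]; exact: cvg_cst.
have cr : (fun n => t ^+ 2 * @expsum R R^o c n) @ \oo --> t ^+ 2 * expR c.
  by apply: cvgM; [exact: cvg_cst|exact: cvg_expsum_scalar].
apply: (ler_cvg_to cl cr); exists 2%N => // n /= n2.
rewrite /expsum (big_cat_nat (leq0n 2) n2) /= [Z in Z + _ - _ - _]big_nat_recr //=.
rewrite big_nat1 !fact0 !invr1 !scale1r expr0 expr1.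
rewrite [_ + _ - 1]addrAC [1 + _]addrC addrK [_ - _]addrAC subrr add0r summxE.
apply: le_trans (ler_norm_sum _ _ _) _.
rewrite mulr_sumr [leRHS](big_cat_nat (leq0n 2) n2) /=.
apply: ler_wpDl.
  apply: sumr_ge0 => k _; apply: mulr_ge0; first exact: sqr_ge0.
  by apply: mulr_ge0; rewrite ?invr_ge0 // exprn_ge0 // mxbound_ge0.
rewrite big_nat [leRHS]big_nat; apply: ler_sum => k /andP[k2 _].
rewrite exprZn scalerA mxE normrM normrM normfV normr_nat normrX.
rewrite -[_ *: c ^+ k]/(_ * c ^+ k) [leRHS]mulrCA -mulrA ler_wpM2l ?invr_ge0 //.
apply: ler_pM => //; last exact: entry_exp_le.
rewrite -(subnK k2) exprD -[leRHS]mul1r -[leRHS](_ : 1 * `|t| ^+ 2 = _).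
  by rewrite ler_wpM2r ?exprn_ge0 // exprn_ile1.
by rewrite -normrX ger0_norm ?sqr_ge0.
Qed.

(** The derivative of the exponential at 0 along the sequence 1/(n+1), which is all the
    differentiation that the passage from group to Lie algebra needs. *)
Lemma cvg_expmx_diff X :
  (fun n => n.+1%:R *: (expmx ((n.+1%:R : R)^-1 *: X) - 1)) @ \oo --> X.
Proof.
apply/cvg_mxP => i j; apply/subr_cvg0; apply/cvgr0Pnorm_le => e e0.
have h0 : (fun n => harmonic n * expR (mxbound X)) @ \oo --> (0 : R).
  rewrite -(mul0r (expR (mxbound X))); apply: cvgM; last exact: cvg_cst.
  exact: cvg_harmonic.
have /cvgr0Pnorm_le /(_ e e0) := h0; apply: filterS => n.
apply: le_trans; apply: le_trans (ler_norm _).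
have n1 : `|(n.+1%:R : R)^-1| <= 1.
  by rewrite ger0_norm ?invr_ge0 // invf_le1 // ler1n.
have n0 : (n.+1%:R : R) != 0 by rewrite pnatr_eq0.
have -> : (n.+1%:R *: (expmx (n.+1%:R^-1 *: X) - 1)) i j - X i j =
    n.+1%:R * (expmx (n.+1%:R^-1 *: X) - 1 - n.+1%:R^-1 *: X) i j.
  by rewrite !mxE; field.
have -> : harmonic n * expR (mxbound X) =
    n.+1%:R * ((n.+1%:R : R)^-1 ^+ 2 * expR (mxbound X)).
  by rewrite /harmonic /=; field.
by rewrite normrM normr_nat ler_wpM2l // expmx_taylor.
Qed.

Lemma continuous_expmx X : continuous (fun t : R => expmx (t *: X)).
Proof.
have at0 : (fun u : R => expmx (u *: X)) @ (0 : R) --> (1 : M).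
  apply/cvg_mxP => i j; apply/subr_cvg0; apply/cvgr0Pnorm_le => e e0.
  pose b := `|X i j| + expR (mxbound X).
  have h0 : (fun u : R => u * b) @ (0 : R) --> (0 : R).
    rewrite -[X in _ --> X](mul0r b); apply: cvgM; last exact: cvg_cst.
    exact: cvg_id.
  have /cvgr0Pnorm_le /(_ e e0) := h0.
  have u1 : \forall u \near (0 : R), `|u| <= 1.
    have /cvgr0Pnorm_le := @cvg_id _ (nbhs (0 : R)).
    by apply.
  apply: filterS2 u1 => u u1; apply: le_trans.
  have := expmx_taylor X i j u1; rewrite !mxE => tay.
  have -> : expmx (u *: X) i j - (i == j)%:R = (expmx (u *: X) i j - (i == j)%:R
    - u * X i j) + u * X i j by rewrite subrK.
  have b0 : 0 <= b by rewrite addr_ge0 // expR_ge0.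
  apply: le_trans (ler_normD _ _) _; rewrite [leRHS]normrM (ger0_norm b0).
  rewrite normrM mulrDr addrC lerD2l; apply: le_trans tay _.
  rewrite ler_wpM2r ?expR_ge0 // -[leLHS]ger0_norm ?sqr_ge0 // normrX.
  by rewrite expr2 ler_piMr.
move=> t; rewrite /continuous_at -[expmx (t *: X)]mulr1.
have -> : (fun s : R => expmx (s *: X)) =
    (fun s => expmx (t *: X) *m expmx ((s - t) *: X)).
  apply/funext => s; rewrite mulmxE -expmxD -?scalerDl ?subrKC //.
  by rewrite /GRing.comm -!scalerAl -!scalerAr !scalerA mulrC.
apply: cvg_mulmxl.
have st : (fun s : R => s - t) @ t --> (0 : R).
  have -> : 0 = t - t :> R by rewrite subrr.
  by apply: cvgB; [exact: cvg_id|exact: cvg_cst].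
exact: (cvg_comp _ _ st at0).
Qed.

(** Differentiation at t = 0. The two factors cover stability of a subspace (Q its cokernel) and
    fixed vectors (Q = 1). *)
Lemma expmx_tangent_eq0 X (m k : nat) (P : 'M[R]_(m, N.+1)) (Q : 'M[R]_(N.+1, k)) :
  (forall t : R, P *m expmx (t *: X) *m Q = P *m Q) -> P *m X *m Q = 0.
Proof.
move=> PQ; apply: (@cvg_unique _ (@norm_hausdorff _ _)
  ((fun n => P *m (n.+1%:R *: (expmx ((n.+1%:R : R)^-1 *: X) - 1)) *m Q) @ \oo)).
  by apply: cvg_mulmxr; apply: cvg_mulmxl; exact: cvg_expmx_diff.
apply: cvg_near_cst; apply: nearW => n.
by rewrite -scalemxAr -scalemxAl mulmxBr mulmxBl PQ mulmx1 subrr scaler0.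
Qed.

End MatrixExponential.

(** * Lorentzian linear algebra *)

(** The adjoint for g; no inverse appears because the Gram matrix is its own inverse. *)
HB.lock Definition gadj (R : realType) (n : nat) (A : 'M[R]_n.+2) : 'M[R]_n.+2 :=
  lgram R n *m A^T *m lgram R n.

(** The operator u |-> g(u,x) y - g(u,y) x, the usual identification of bivectors with so(V); see
    [mul_wedge]. *)
HB.lock Definition wedge (R : realType) (n : nat) (x y : 'rV[R]_n.+2) :
  'M[R]_n.+2 := lgram R n *m (x^T *m y - y^T *m x).

(** The reflection in the hyperplane orthogonal to w; for isotropic w the division by 0 makes it the
    identity. *)
HB.lock Definition refl (R : realType) (n : nat) (w : 'rV[R]_n.+2) :
    'M[R]_n.+2 :=
  1%:M - (2%:R / lform w w) *: (lgram R n *m w^T *m w).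

Section LorentzForm.
Variables (R : realType) (n : nat).
Local Notation V := 'rV[R]_n.+2.
Local Notation M := 'M[R]_n.+2.
Local Notation g := (@lform R n).
Local Notation J := (lgram R n).
Implicit Types (u v w x y : V) (A B X Y : M) (a b c : R).

Lemma lformC u v : g u v = g v u.
Proof.
by rewrite /lform mulrC; congr (_ + _); apply: eq_bigr => i _; rewrite mulrC.
Qed.

Lemma lformDl u v w : g (u + v) w = g u w + g v w.
Proof. by rewrite !lform_gram !mulmxDl mxE. Qed.

Lemma lformZl a u v : g (a *: u) v = a * g u v.
Proof. by rewrite !lform_gram -!scalemxAl mxE. Qed.

Lemma lformNl u v : g (- u) v = - g u v.
Proof. by rewrite -scaleN1r lformZl mulN1r. Qed.

Lemma lform0l v : g 0 v = 0.
Proof. by rewrite -(scale0r v) lformZl mul0r. Qed.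

Lemma lformDr u v w : g w (u + v) = g w u + g w v.
Proof. by rewrite !(lformC w) lformDl. Qed.

Lemma lformZr a u v : g v (a *: u) = a * g v u.
Proof. by rewrite !(lformC v) lformZl. Qed.

Lemma lformNr u v : g v (- u) = - g v u.
Proof. by rewrite !(lformC v) lformNl. Qed.

Lemma lform0r v : g v 0 = 0.
Proof. by rewrite lformC lform0l. Qed.

Definition lformE := (lformDl, lformDr, lformZl, lformZr, lformNl, lformNr,
  lform0l, lform0r).

Lemma lform_suml (I : Type) (r : seq I) (P : pred I) (F : I -> V) v :
  g (\sum_(i <- r | P i) F i) v = \sum_(i <- r | P i) g (F i) v.
Proof. by elim/big_rec2: _ => [|i y1 y2 _ <-]; rewrite !lformE. Qed.

Definition e0 : V := delta_mx 0 ord0.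

Lemma lform_e0 u : g u e0 = - u 0 ord0.
Proof. by rewrite lform_delta eqxx mulrN1. Qed.

Lemma lform_e0_e0 : g e0 e0 = -1.
Proof. by rewrite lform_e0 mxE !eqxx. Qed.

Lemma lform_orth_e0 u : g u e0 = 0 -> 0 <= g u u ?= iff (u == 0).
Proof.
rewrite lform_e0 => /eqP; rewrite oppr_eq0 => /eqP u0.
have uu : g u u = \sum_(i < n.+1) u 0 (lift ord0 i) ^+ 2.
  by rewrite /lform u0 mul0r oppr0 add0r; apply: eq_bigr => i _; rewrite expr2.
apply/leifP; case: eqP => [->|/eqP un0]; first by rewrite lform0l.
rewrite lt_neqAle uu sumr_ge0 ?andbT => [|i _]; last exact: sqr_ge0.
rewrite eq_sym psumr_eq0 => [|i _]; last exact: sqr_ge0.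
apply: contra un0 => /allP s0; apply/eqP/rowP => j; rewrite mxE.
case: (unliftP ord0 j) => [i|] -> //.
by apply/eqP; rewrite -sqrf_eq0; apply: s0; rewrite mem_index_enum.
Qed.

Local Opaque lform.

(** With c chosen so that z = y - c x is orthogonal to [e0], z lies in a Euclidean space, and g(z,z)
    = g(y,y) + c^2 g(x,x) because g(x,y) = 0. *)
Lemma causal_orth x y : g x x <= 0 -> x != 0 -> g x y = 0 ->
  0 <= g y y /\ (g y y = 0 -> exists c, y = c *: x).
Proof.
move=> xx x0 xy.
have x00 : g x e0 != 0.
  apply: contraNneq x0 => /lform_orth_e0 xge.
  by have := le_anti (introT andP (conj xx xge.1)) => /esym/eqP; rewrite xge.2.
pose c := g y e0 / g x e0; pose z := y - c *: x.
have ze : g z e0 = 0 by rewrite /z !lformE /c divfK // subrr.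
have zz : g z z = g y y + c ^+ 2 * g x x.
  by rewrite /z !lformE (lformC y x) xy; ring.
have [z0 ze0] := lform_orth_e0 ze.
have cc := sqr_ge0 c.
split; first by rewrite zz in z0; nra.
move=> yy; exists c; apply/eqP; rewrite -subr_eq0 -/z -ze0 eq_sym eq_le z0 andbT.
by rewrite zz yy; nra.
Qed.

Lemma timelike_orth x y : g x x < 0 -> g x y = 0 -> g y y <= 0 -> y = 0.
Proof.
move=> xx xy yy.
have x0 : x != 0 by apply: contraTneq xx => ->; rewrite lform0l ltxx.
have [y0 ] := causal_orth (ltW xx) x0 xy; case.
  by apply/le_anti; rewrite yy.
move=> c yc; move: xy; rewrite yc lformZr => /eqP; rewrite mulf_eq0.
by rewrite (lt_eqF xx) orbF => /eqP ->; rewrite scale0r.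
Qed.

Lemma lform_eq0 u : (forall v, g u v = 0) -> u = 0.
Proof.
move=> u0; apply/rowP => j; have /eqP := u0 (delta_mx 0 j).
by rewrite lform_delta mxE mulf_eq0; case: ifP; rewrite ?oppr_eq0 oner_eq0 orbF
  => _ /eqP.
Qed.

Lemma trmx_gram : J^T = J.
Proof. by apply/matrixP => i j; rewrite !mxE lformC. Qed.

Lemma gramE : J = 1%:M - 2%:R *: (e0^T *m e0).
Proof.
apply/matrixP => i j; rewrite !mxE big_ord1 !mxE lform_delta mxE /= ?eqxx /=.
rewrite [j == i]eq_sym; case: (eqVneq j ord0) => [->|j0] /=; last by ring.
by case: (eqVneq i ord0) => i0 /=; ring.
Qed.

Lemma gram_gram : J *m J = 1%:M.
Proof.
have ee : e0 *m e0^T = 1%:M.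
  by rewrite trmx_delta mul_delta_mx; apply/matrixP => i j; rewrite !mxE !ord1.
rewrite gramE mulmxBl mul1mx mulmxBr mulmx1 -!scalemxAl -!scalemxAr scalerA.
rewrite mulmxA -[_ *m e0^T]mulmxA ee mulmx1.
by apply/matrixP => i j; rewrite !mxE; ring.
Qed.

Lemma lform_ext A B : (forall u v, g (u *m A) v = g (u *m B) v) -> A = B.
Proof.
move=> AB; apply/row_matrixP => i; rewrite !rowE; apply/eqP; rewrite -subr_eq0.
by apply/eqP/lform_eq0 => v; rewrite !lformE AB subrr.
Qed.

Lemma mulmx_row_ext (m : nat) (A B : 'M[R]_(n.+2, m)) :
  (forall u, u *m A = u *m B) -> A = B.
Proof. by move=> AB; apply/row_matrixP => i; rewrite !rowE. Qed.

Lemma gadjP A u v : g (u *m A) v = g u (v *m gadj A).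
Proof.
rewrite !lform_gram gadj.unlock !trmx_mul trmx_gram trmxK -!mulmxA; congr ((_ *m _) 0 0).
by rewrite !mulmxA gram_gram mul1mx.
Qed.

Lemma lisometryP A : lisometry A <-> A *m gadj A = 1%:M.
Proof.
split=> [iA|AA u v].
  by apply: lform_ext => u v; rewrite mulmxA mulmx1 lformC -gadjP iA lformC.
by rewrite gadjP -mulmxA AA mulmx1.
Qed.

Lemma lisometry_unit A : lisometry A -> A \in unitmx.
Proof. by move=> /lisometryP/mulmx1_unit[]. Qed.

Lemma lisometry_inv A : lisometry A -> lisometry (invmx A).
Proof. by move=> iA u v; rewrite -iA !mulmxKV // lisometry_unit. Qed.

Lemma lisometryM A B : lisometry A -> lisometry B -> lisometry (A *m B).
Proof. by move=> iA iB u v; rewrite !mulmxA iB iA. Qed.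

Lemma lisometry1 : lisometry (1%:M : M).
Proof. by move=> u v; rewrite !mulmx1. Qed.

Lemma lisometry_det A : lisometry A -> \det A = 1 \/ \det A = -1.
Proof.
move=> /lisometryP/(congr1 determinant); rewrite gadj.unlock !det_mulmx det_tr det1.
rewrite mulrCA -mulrA mulrCA => dA.
have /eqP : \det A ^+ 2 = 1.
  have := congr1 determinant gram_gram; rewrite det_mulmx det1 => dJ.
  by rewrite -[RHS]dA [RHS](_ : _ = \det J * \det J * \det A ^+ 2); [rewrite dJ mul1r|ring].
by rewrite sqrf_eq1 => /orP[] /eqP; [left|right].
Qed.

Definition skew X := forall u v, g (u *m X) v = - g u (v *m X).

Lemma skewP X : skew X <-> gadj X = - X.
Proof.
split=> [sX|Xa u v]; last by rewrite gadjP Xa mulmxN lformNr.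
by apply: lform_ext => u v; rewrite [LHS]lformC -gadjP sX mulmxN lformNl lformC.
Qed.

Lemma skew_diag X u : skew X -> g (u *m X) u = 0.
Proof. by move=> sX; have := sX u u; rewrite (lformC u); lra. Qed.

Lemma skewD X Y : skew X -> skew Y -> skew (X + Y).
Proof. by move=> sX sY u v; rewrite !mulmxDr !lformE sX sY; ring. Qed.

Lemma skewZ a X : skew X -> skew (a *: X).
Proof. by move=> sX u v; rewrite -!scalemxAr !lformE sX mulrN. Qed.

Lemma skewN X : skew X -> skew (- X).
Proof. by move=> sX; rewrite -scaleN1r; exact: skewZ. Qed.

Lemma skew_lie X Y : skew X -> skew Y -> skew (X * Y - Y * X).
Proof.
move=> sX sY u v; rewrite -!mulmxE !mulmxBr !mulmxA !lformE.
by rewrite sY sX sX sY; ring.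
Qed.

Lemma mul_rank1 u x y : u *m (J *m x^T *m y) = g u x *: y.
Proof. by rewrite !mulmxA [_ *m x^T]mx11_scalar -lform_gram mul_scalar_mx. Qed.

Lemma mul_wedge u x y : u *m wedge x y = g u x *: y - g u y *: x.
Proof. by rewrite wedge.unlock mulmxBr mulmxBr !(mulmxA J) !mul_rank1. Qed.

Lemma wedge_skew x y : skew (wedge x y).
Proof. by move=> u v; rewrite !mul_wedge !lformE (lformC y v) (lformC x v); ring. Qed.

Lemma wedgeDl x y z : wedge (x + y) z = wedge x z + wedge y z.
Proof.
apply: mulmx_row_ext => u; rewrite mulmxDr !mul_wedge !lformE.
by rewrite scalerDl scalerDr; apply/rowP => j; rewrite !mxE; ring.
Qed.

Lemma wedgeZl a x y : wedge (a *: x) y = a *: wedge x y.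
Proof.
apply: mulmx_row_ext => u; rewrite -scalemxAr !mul_wedge !lformE.
by apply/rowP => j; rewrite !mxE; ring.
Qed.

Lemma wedgeC x y : wedge x y = - wedge y x.
Proof. by apply: mulmx_row_ext => u; rewrite mulmxN !mul_wedge opprB. Qed.

Lemma wedgeDr x y z : wedge z (x + y) = wedge z x + wedge z y.
Proof. by rewrite !(wedgeC z) wedgeDl opprD. Qed.

Lemma wedgeZr a x y : wedge x (a *: y) = a *: wedge x y.
Proof. by rewrite !(wedgeC x) wedgeZl scalerN. Qed.

Lemma wedge0l x : wedge 0 x = 0.
Proof. by rewrite -(scale0r (0 : V)) wedgeZl scale0r. Qed.

Lemma wedge0r x : wedge x 0 = 0.
Proof. by rewrite wedgeC wedge0l oppr0. Qed.

Lemma wedge_xx x : wedge x x = 0.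
Proof. by apply: mulmx_row_ext => u; rewrite mul_wedge subrr mulmx0. Qed.

(** Bracketing with a skew operator is a derivation on bivectors; this reduces every later bracket
    computation to vectors. *)
Lemma wedge_lie x y X : skew X ->
  wedge x y * X - X * wedge x y = wedge (x *m X) y + wedge x (y *m X).
Proof.
move=> sX; apply: mulmx_row_ext => u; rewrite -!mulmxE mulmxBr mulmxDr !mulmxA.
rewrite !mul_wedge mulmxBl -!scalemxAl !sX.
by apply/rowP => j; rewrite !mxE; ring.
Qed.

Lemma mul_refl u w : u *m refl w = u - (2%:R * g u w / g w w) *: w.
Proof.
rewrite refl.unlock mulmxBr mulmx1 -scalemxAr mul_rank1 scalerA.
by congr (_ - _ *: _); rewrite mulrAC.
Qed.

Lemma refl_isometry w : g w w != 0 -> lisometry (refl w).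
Proof.
move=> ww u v; rewrite !mul_refl !lformE (lformC w v).
by field.
Qed.

Lemma refl_orth u w : g u w = 0 -> u *m refl w = u.
Proof. by move=> uw; rewrite mul_refl uw mulr0 mul0r scale0r subr0. Qed.

Lemma det_refl w : g w w != 0 -> \det (refl w) = -1.
Proof.
move=> ww.
(* The identity det (1 - a b) = 1 - b a, from two triangular factorisations of one block matrix. *)
have rank1 (a : 'cV[R]_n.+2) (b : V) : \det (1%:M - a *m b) = 1 - (b *m a) 0 0.
  have e1 : block_mx 1%:M b a 1%:M =
      block_mx 1%:M 0 a 1%:M *m block_mx 1%:M b 0 (1%:M - a *m b).
    by rewrite mulmx_block !mul1mx !mul0mx !mulmx1 ?mulmx0 !addr0 [a *m b + _]addrC subrK.
  have e2 : block_mx 1%:M b a 1%:M =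
      block_mx (1%:M - b *m a) b 0 1%:M *m block_mx 1%:M 0 a 1%:M.
    by rewrite mulmx_block !mul1mx !mul0mx !mulmx1 ?mulmx0 ?addr0 ?add0r subrK.
  have := congr1 determinant e2; rewrite e1 !det_mulmx !det_lblock !det_ublock.
  by rewrite !det1 !mul1r !mulr1 => ->; rewrite det_mx11 !mxE eqxx.
rewrite refl.unlock scalemxAl rank1 -scalemxAr mxE mulmxA -lform_gram.
by rewrite divfK //; ring.
Qed.

Lemma refl_swap x y : g x x = g y y -> g (x - y) (x - y) != 0 ->
  x *m refl (x - y) = y.
Proof.
move=> xy; have -> : g (x - y) (x - y) = 2%:R * g x (x - y).
  by rewrite !lformE (lformC y x) -xy; ring.
move=> ww; rewrite mul_refl.
have -> : g (x - y) (x - y) = 2%:R * g x (x - y).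
  by rewrite !lformE (lformC y x) -xy; ring.
by rewrite divff // scale1r opprB addrC subrK.
Qed.

End LorentzForm.

Local Opaque lform.

(** A subspace contained in S of maximal rank must contain every u in S, since adding u keeps it
    inside S. *)
Lemma linset_mx (R : realType) (m : nat) (S : set 'rV[R]_m) :
  S 0 -> (forall a u v, S u -> S v -> S (a *: u + v)) ->
  exists W : 'M[R]_m, forall u : 'rV_m, (u <= W)%MS <-> S u.
Proof.
move=> S0 Slin.
pose P k := `[< exists W : 'M[R]_m, (forall u : 'rV_m, (u <= W)%MS -> S u)
  /\ \rank W = k >].
have P0 : exists k, P k.
  exists 0%N; apply/asboolP; exists 0; split=> [u|]; last exact: mxrank0.
  by rewrite submx0 => /eqP ->.
have Pm k : P k -> (k <= m)%N.
  by move=> /asboolP[W [_ <-]]; exact: rank_leq_row.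
case: (ex_maxnP P0 Pm) => k /asboolP[W [WS rW]] kmax.
exists W => u; split; first exact: WS.
move=> Su; have uW : (u <= W + u)%MS by exact: addsmxSr.
suff : (W + u <= W)%MS by move=> /(submx_trans uW).
rewrite -(geq_leqif (mxrank_leqif_sup (addsmxSl W u))) rW.
apply: kmax; apply/asboolP; exists (W + u)%MS; split=> // v.
move=> /sub_addsmxP[[a b] ->] /=; rewrite addrC.
have /submxP[c ->] : (b *m u <= u)%MS by exact: submxMl.
rewrite [c]mx11_scalar mul_scalar_mx; apply: Slin => //.
by apply: WS; exact: submxMl.
Qed.

(** A maximal orthonormal family in S spans S: a nonzero remainder could be normalised and added.
    Positivity is required on S only, because the form is a trace form on matrices, definite on a
    Lie algebra but not on the whole matrix space. *)
Lemma orthonormal_basis (R : realType) (U : vectType R) (S : set U)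
    (b : U -> U -> R) :
  S 0 -> (forall a u v, S u -> S v -> S (a *: u + v)) ->
  (forall a u v w, b (a *: u + v) w = a * b u w + b v w) ->
  (forall u v, b u v = b v u) ->
  (forall u, S u -> u != 0 -> 0 < b u u) ->
  exists k (f : 'I_k -> U), [/\ forall i, S (f i),
    forall i j, b (f i) (f j) = (i == j)%:R
    & forall u, S u -> u = \sum_i b u (f i) *: f i].
Proof.
move=> S0 Slin blin bC bpos.
have b0 w : b 0 w = 0.
  by have := blin 1 0 0 w; rewrite scale1r addr0 mul1r; lra.
have bZ a u w : b (a *: u) w = a * b u w by rewrite -[a *: u]addr0 blin b0 addr0.
have bsum k (c : 'I_k -> R) (f : 'I_k -> U) w :
    b (\sum_i c i *: f i) w = \sum_i c i * b (f i) w.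
  by elim/big_rec2: _ => [|i y1 y2 _ <-]; rewrite ?b0 ?blin.
have Ssum k (c : 'I_k -> R) (f : 'I_k -> U) : (forall i, S (f i)) ->
    S (\sum_i c i *: f i).
  by move=> Sf; elim/big_rec: _ => [//|i y _ Sy]; exact: Slin.
pose P k := `[< exists f : 'I_k -> U, (forall i, S (f i)) /\
  forall i j, b (f i) (f j) = (i == j)%:R >].
have P0 : exists k, P k.
  by exists 0%N; apply/asboolP; exists (fun=> 0); split=> // -[].
have sumd k (c : 'I_k -> R) j : \sum_i c i * (i == j)%:R = c j.
  rewrite (bigD1 j) //= eqxx mulr1 big1 ?addr0 // => i /negbTE ->.
  by rewrite mulr0.
have Pm k : P k -> (k <= \dim (fullv : {vspace U}))%N.
  move=> /asboolP[f [Sf fo]].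
  have fr : free [tuple f i | i < k].
    apply/freeP => c c0 j.
    have c0' : \sum_i c i *: f i = 0.
      rewrite -[RHS]c0; apply: eq_bigr => i _.
      by rewrite -tnth_nth tnth_mktuple.
    rewrite -(sumd _ c j) -[RHS](b0 (f j)) -c0' bsum.
    by apply: eq_bigr => i _; rewrite fo.
  rewrite -[X in (X <= _)%N](size_tuple [tuple f i | i < k]) -(eqP fr).
  by apply: dimvS; exact: subvf.
case: (ex_maxnP P0 Pm) => k /asboolP[f [Sf fo]] kmax.
exists k, f; split=> // u Su; apply/eqP; rewrite -subr_eq0; apply/negPn/negP => y0.
set y := u - _ in y0.
have Sy : S y by rewrite /y addrC -scaleN1r; apply: Slin => //; exact: Ssum.
have yf j : b y (f j) = 0.
  rewrite /y addrC -scaleN1r blin bsum; under eq_bigr do rewrite fo.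
  by rewrite sumd mulN1r addNr.
have yy := bpos _ Sy y0.
pose z := (Num.sqrt (b y y))^-1 *: y.
have zz : b z z = 1.
  rewrite /z bZ bC bZ -{3}(sqr_sqrtr (ltW yy)) expr2.
  by have := yy; rewrite -sqrtr_gt0 => /lt0r_neq0 s0; field.
have Sz : S z by rewrite /z -[_ *: y]addr0; exact: Slin.
suff : P k.+1 by move/kmax; rewrite ltnn.
apply/asboolP; exists (fun i => if unlift ord_max i is Some j then f j else z).
split=> [i|i j]; first by case: unliftP => [j _|_].
have zf l : b z (f l) = 0 by rewrite /z bZ yf mulr0.
case: unliftP => [i' ->|->]; case: unliftP => [j' ->|->].
- by rewrite fo (inj_eq lift_inj).
- by rewrite bC zf eq_sym; case: eqP (neq_lift ord_max i').
- by rewrite zf; case: eqP (neq_lift ord_max j').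
- by rewrite zz eqxx.
Qed.

(** * Transitivity of SO(V), traces of skew operators, orthogonal complements *)

Section LorentzSubspaces.
Variables (R : realType) (n : nat).
Local Notation V := 'rV[R]_n.+2.
Local Notation M := 'M[R]_n.+2.
Local Notation g := (@lform R n).
Implicit Types (u v w x y : V) (A B X Y W : M) (a b c : R).

(** The vector x + y is timelike, since g(x,y) <= 0, and is orthogonal to x - y. So either x = y or
    the reflection in x - y moves x to y. *)
Lemma timelike_sub x y : g x x = g y y -> g x x < 0 -> g x y <= 0 ->
  x = y \/ 0 < g (x - y) (x - y).
Proof.
move=> xy xx0 xy0; case: (ltP 0 (g (x - y) (x - y))) => [|w0]; first by right.
left; apply/eqP; rewrite -subr_eq0; apply/eqP.
apply: (@timelike_orth R n (x + y)) => //.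
  by rewrite !lformE (lformC y x) -xy; lra.
by rewrite !lformE (lformC y x) xy; ring.
Qed.

Lemma SOV_mul A B : SOV A -> SOV B -> SOV (A *m B).
Proof.
by move=> [iA dA] [iB dB]; split; [exact: lisometryM|rewrite det_mulmx dA dB mulr1].
Qed.

Lemma SOV1 : SOV (1%:M : M).
Proof. by split; [exact: lisometry1|rewrite det1]. Qed.

Lemma SOV_refl_refl u v : g u u != 0 -> g v v != 0 -> SOV (refl u *m refl v).
Proof.
move=> uu vv; split; first by apply: lisometryM; exact: refl_isometry.
by rewrite det_mulmx !det_refl // mulrNN mulr1.
Qed.

Lemma SOV_inv A : SOV A -> SOV (invmx A).
Proof.
move=> [iA dA]; split; first exact: lisometry_inv.
by rewrite det_inv dA invr1.
Qed.

Lemma SOV_unit A : SOV A -> A \in unitmx.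
Proof. by case=> iA _; exact: lisometry_unit. Qed.

(** Scale t to norm -1 with the sign that puts it in the cone of [e0], and reflect it to [e0]. A
    second reflection, in a spacelike coordinate vector orthogonal to [e0], restores determinant
    1. *)
Lemma SOV_timelike_e0 (t : V) : g t t < 0 ->
  exists B, SOV B /\ exists2 c, c != 0 & t *m B = c *: e0 R n.
Proof.
move=> tt.
have [s [s0 [ss se]]] : exists s : R, s != 0 /\ g (s *: t) (s *: t) = -1 /\
    g (s *: t) (e0 R n) <= 0.
  have r0 : 0 < Num.sqrt (- g t t) by rewrite sqrtr_gt0 oppr_gt0.
  pose r := (Num.sqrt (- g t t))^-1.
  have rr : r ^+ 2 * g t t = -1.
    rewrite /r exprVn sqr_sqrtr; last by rewrite oppr_ge0 ltW.
    by field; rewrite (lt_eqF tt).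
  have rn0 : r != 0 by rewrite invr_eq0 gt_eqF.
  case: (lerP (g (r *: t) (e0 R n)) 0) => re.
    by exists r; split=> //; split=> //; rewrite !lformE mulrA -expr2.
  exists (- r); rewrite oppr_eq0 scaleNr !lformE oppr_le0; split=> //.
  by split; [rewrite mulrN opprK mulrA -expr2|rewrite -lformZl ltW].
have e1e1 : g (delta_mx 0 (lift ord0 ord0)) (delta_mx 0 (lift ord0 ord0)) != 0.
  by rewrite lform_delta mxE !eqxx mulr1 oner_neq0.
have e0e1 : g (e0 R n) (delta_mx 0 (lift ord0 ord0)) = 0.
  by rewrite lform_delta mxE mul0r.
have ss0 : g (s *: t) (s *: t) < 0 by rewrite ss ltrN10.
have see : g (s *: t) (s *: t) = g (e0 R n) (e0 R n) by rewrite ss lform_e0_e0.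
have scale B : (s *: t) *m B = e0 R n -> t *m B = s^-1 *: e0 R n.
  by move=> <-; rewrite -scalemxAl scalerA mulVf // scale1r.
case: (timelike_sub see ss0 se) => [te|w0].
  exists 1%:M; split; [exact: SOV1|exists s^-1; rewrite ?invr_eq0 //].
  by apply: scale; rewrite mulmx1.
exists (refl (s *: t - e0 R n) *m refl (delta_mx 0 (lift ord0 ord0))); split.
  by apply: SOV_refl_refl => //; rewrite gt_eqF.
exists s^-1; rewrite ?invr_eq0 //; apply: scale.
by rewrite mulmxA refl_swap ?gt_eqF // refl_orth.
Qed.

(** One reflection moves p' - q' to p - q, another one fixing p - q adjusts the sum to p + q. A
    determinant -1 is corrected by the reflection in p - q, which exchanges p and q; hence the
    disjunction, which cannot be avoided when E = 0. *)
Lemma SOV_witt_pair (p q p' q' : V) :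
  g p p = 0 -> g q q = 0 -> g p q = 1 -> g p' p' = 0 -> g q' q' = 0 ->
  g p' q' = 1 ->
  exists2 B, SOV B & (p' *m B = p /\ q' *m B = q) \/ (p' *m B = q /\ q' *m B = p).
Proof.
move=> pp qq pq.
have half x y (B : M) : (x - y) *m B = p - q -> (x + y) *m B = p + q ->
    x *m B = p /\ y *m B = q.
  rewrite mulmxBl mulmxDl; move: (x *m B) (y *m B) => a b /rowP e1 /rowP e2.
  by split; apply/rowP => j; have := e1 j; have := e2 j; rewrite !mxE; lra.
have main x y : g x x = 0 -> g y y = 0 -> g x y = 1 -> g (x - y) (p - q) <= 0 ->
    exists2 B, SOV B & (x *m B = p /\ y *m B = q) \/ (x *m B = q /\ y *m B = p).
  move=> xx yy xy neg.
  have tt : g (p - q) (p - q) = -2%:R by rewrite !lformE (lformC q p) pp qq pq; ring.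
  have t't : g (x - y) (x - y) = g (p - q) (p - q).
    by rewrite tt !lformE (lformC y x) xx yy xy; ring.
  have t'0 : g (x - y) (x - y) < 0 by rewrite t't tt; lra.
  have [A iA At] : exists2 A, lisometry A & (x - y) *m A = p - q.
    case: (timelike_sub t't t'0 neg) => [->|w0].
      by exists 1%:M; [exact: lisometry1|rewrite mulmx1].
    by exists (refl (x - y - (p - q))); [apply: refl_isometry|apply: refl_swap];
      rewrite ?gt_eqF.
  pose s := (x + y) *m A.
  have st : g s (p - q) = 0 by rewrite -At iA !lformE (lformC y x) xx yy; ring.
  have sp : g (p - q) (s - (p + q)) = 0.
    by rewrite lformDr (lformC _ s) st !lformE (lformC q p) pp qq; ring.
  have ss : g s s = g (p + q) (p + q).
    by rewrite iA !lformE (lformC y x) (lformC q p) xx yy xy pp qq pq.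
  have [B [iB Bt Bs]] : exists B, [/\ lisometry B, (p - q) *m B = p - q &
      s *m B = p + q].
    case: (eqVneq s (p + q)) => [e|sn].
      by exists 1%:M; rewrite !mulmx1; split=> //; exact: lisometry1.
    have w0 : g (s - (p + q)) (s - (p + q)) != 0.
      apply: contra_neq sn => w0; apply/eqP; rewrite -subr_eq0; apply/eqP.
      by apply: (@timelike_orth R n (p - q)); rewrite ?w0 // tt; lra.
    exists (refl (s - (p + q))); split; first exact: refl_isometry.
      by rewrite refl_orth.
    exact: refl_swap.
  have [xp yq] : x *m (A *m B) = p /\ y *m (A *m B) = q.
    by apply: half; rewrite mulmxA ?At.
  have iAB := lisometryM iA iB.
  case: (lisometry_det iAB) => dAB; first by exists (A *m B); [split|left].
  have w0 : g (p - q) (p - q) != 0 by rewrite tt; lra.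
  have pqr : p *m refl (p - q) = q.
    by apply: refl_swap => //; rewrite pp qq.
  have qpr : q *m refl (p - q) = p.
    rewrite mul_refl tt !lformE (lformC q p) pq qq.
    by apply/rowP => j; rewrite !mxE; field.
  exists (A *m B *m refl (p - q)); last by right; rewrite !(mulmxA _ (A *m B)) xp yq.
  split; first by apply: lisometryM => //; exact: refl_isometry.
  by rewrite det_mulmx dAB det_refl // mulrNN mulr1.
move=> pp' qq' pq'; case: (lerP (g (p' - q') (p - q)) 0) => neg; first exact: main.
have [|||| B sB H] := main q' p'; rewrite ?qq' ?pp' ?(lformC q') //.
  have -> : g (q' - p') (p - q) = - g (p' - q') (p - q) by rewrite !lformE; ring.
  by rewrite oppr_le0 ltW.
by exists B => //; case: H => -[? ?]; [right|left].
Qed.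

Lemma trace_mul_tr A : \tr (A *m A^T) = \sum_i \sum_j A i j ^+ 2.
Proof.
rewrite /mxtrace; apply: eq_bigr => i _; rewrite mxE; apply: eq_bigr => j _.
by rewrite mxE expr2.
Qed.

Lemma trace_mul_tr_ge0 A : 0 <= \tr (A *m A^T).
Proof.
by rewrite trace_mul_tr; do 2!apply: sumr_ge0 => ? _; exact: sqr_ge0.
Qed.

Lemma trace_mul_tr_eq0 A : \tr (A *m A^T) = 0 -> A = 0.
Proof.
rewrite trace_mul_tr => /eqP; rewrite psumr_eq0 => [/allP A0|i _]; last first.
  by apply: sumr_ge0 => ? _; exact: sqr_ge0.
apply/matrixP => i j; rewrite mxE; apply/eqP; rewrite -sqrf_eq0.
have := A0 i (mem_index_enum _); rewrite psumr_eq0 => [/allP Ai|? _]; last exact: sqr_ge0.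
exact: Ai (mem_index_enum _).
Qed.

Lemma mxtrace_conj A B : B \in unitmx -> \tr (invmx B *m A *m B) = \tr A.
Proof. by move=> uB; rewrite mxtrace_mulC mulmxA mulmxV // mul1mx. Qed.

Lemma skew_conj X B : lisometry B -> skew X -> skew (invmx B *m X *m B).
Proof.
move=> iB sX u v; have uB := lisometry_unit iB.
have e x y : g (x *m B) y = g x (y *m invmx B).
  by rewrite -{1}[y](mulmxKV uB) iB.
by rewrite !mulmxA e sX (lformC u) e lformC.
Qed.

(** Moving t to a multiple of [e0], X becomes a skew operator killing [e0], that is an antisymmetric
    matrix, and the trace of its square is minus the sum of the squares of its entries. *)
Lemma skew_timelike_trace X (t : V) : skew X -> g t t < 0 -> t *m X = 0 ->
  \tr (X *m X) <= 0 ?= iff (X == 0).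
Proof.
move=> sX tt tX; have [B [[iB _] [c c0 tB]]] := SOV_timelike_e0 tt.
have uB := lisometry_unit iB.
pose Y := invmx B *m X *m B.
have sY : skew Y by exact: skew_conj.
have eY : e0 R n *m Y = 0.
  have -> : e0 R n = c^-1 *: (t *m B) by rewrite tB scalerA mulVf // scale1r.
  by rewrite -scalemxAl /Y !mulmxA mulmxK // tX mul0mx scaler0.
have JY : lgram R n *m Y = Y.
  by rewrite gramE mulmxBl mul1mx -scalemxAl -mulmxA eY mulmx0 scaler0 subr0.
have YT : Y^T = - Y.
  have /skewP := sY; rewrite gadj.unlock => YJ.
  have := congr1 trmx JY; rewrite trmx_mul trmx_gram => <-.
  have -> : Y^T *m lgram R n = lgram R n *m (- Y).
    by rewrite -YJ !mulmxA gram_gram mul1mx.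
  by rewrite mulmxN JY.
have trY : \tr (X *m X) = - \tr (Y *m Y^T).
  rewrite YT mulmxN linearN opprK -(mxtrace_conj _ uB); congr (\tr _).
  by rewrite /Y !mulmxA mulmxK.
apply/leifP; case: eqP => [->|/eqP X0]; first by rewrite mul0mx mxtrace0.
rewrite trY oppr_lt0 lt_neqAle trace_mul_tr_ge0 andbT eq_sym.
apply: contra X0 => /eqP/trace_mul_tr_eq0 Y0.
have -> : X = B *m Y *m invmx B by rewrite /Y !mulmxA mulmxV // mul1mx mulmxK.
by rewrite Y0 mulmx0 mul0mx.
Qed.

Lemma rank_perp (m : nat) (W : 'M[R]_(m, n.+2)) :
  \rank (perp W) = (n.+2 - \rank W)%N.
Proof.
have [uJ _] := mulmx1_unit (gram_gram R n).
by rewrite /perp mxrank_ker eqmxMfull ?mxrank_tr // row_full_unit.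
Qed.

Lemma perp_perp (m : nat) (W : 'M[R]_(m, n.+2)) : (perp (perp W) :=: W)%MS.
Proof.
apply: eqmx_sym; apply/eqmxP; rewrite -mxrank_leqif_eq.
  by rewrite !rank_perp subKn // rank_leq_col.
apply/row_subP => i; apply/perpP => v /perpP/(_ _ (row_sub i W)).
by rewrite lformC.
Qed.

Lemma perp_sum W : (W :&: perp W)%MS = 0 -> (1%:M <= W + perp W)%MS.
Proof.
move=> Wd; rewrite sub1mx /row_full (mxrank_disjoint_sum Wd) rank_perp.
by rewrite subnKC // rank_leq_row.
Qed.

Lemma perp_stable_skew (m : nat) X (W : 'M[R]_(m, n.+2)) :
  skew X -> stablemx W X -> stablemx (perp W) X.
Proof.
move=> sX sW; apply/row_subP => i; apply/perpP => v vW; rewrite row_mul sX.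
have /perpP -> := row_sub i (perp W); first by rewrite oppr0.
exact: submx_trans (submxMr X vW) sW.
Qed.

Lemma stablemx_unit A W : A \in unitmx -> stablemx W A -> (W *m A :=: W)%MS.
Proof.
move=> uA sW; apply/eqmxP; rewrite -(geq_leqif (mxrank_leqif_eq sW)).
by rewrite mxrankMfree ?row_free_unit.
Qed.

Lemma stablemx_inv A W : A \in unitmx -> stablemx W A -> stablemx W (invmx A).
Proof.
move=> uA sW; rewrite -[X in (_ <= X)%MS](mulmxK uA).
by apply: submxMr; rewrite (stablemx_unit uA sW).
Qed.

Lemma perp_stable_isometry A W : lisometry A -> stablemx W A ->
  stablemx (perp W) A.
Proof.
move=> iA sW; have uA := lisometry_unit iA.
apply/row_subP => i; apply/perpP => v vW; rewrite row_mul.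
rewrite -[v](mulmxKV uA) iA.
have /perpP -> // := row_sub i (perp W).
exact: submx_trans (submxMr _ vW) (stablemx_inv uA sW).
Qed.

Lemma orth_vector_exists (m : nat) W (B : 'M[R]_(m, n.+2)) :
  (\rank B < \rank W)%N ->
  exists2 u : V, u != 0 & (u <= W)%MS /\ forall v, (v <= B)%MS -> g u v = 0.
Proof.
move=> rBW; have : (W :&: perp B)%MS != 0.
  rewrite -mxrank_eq0; apply/eqP => cap0.
  have := mxrank_sum_cap W (perp B); rewrite cap0 addn0 rank_perp => e.
  have := rank_leq_col (W + perp B)%MS; rewrite e.
  by rewrite -[X in (_ <= X)%N](subnKC (rank_leq_col B)) leq_add2r leqNgt rBW.
by move=> /rowV0Pn[u]; rewrite sub_capmx => /andP[uW /perpP uB] u0; exists u.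
Qed.

End LorentzSubspaces.

(** * Spectrum of skew operators *)

Section ComplexEigenvectors.
Variable R : realType.
Local Notation toC := (real_complex R).

Lemma complex_eigen_pair (m : nat) (A : 'M[R]_m) (v : 'rV[R[i]]_m) (mu : R[i]) :
  v *m map_mx toC A = mu *: v ->
  map_mx (@complex.Re R) v *m A = complex.Re mu *: map_mx (@complex.Re R) v -
    complex.Im mu *: map_mx (@complex.Im R) v /\
  map_mx (@complex.Im R) v *m A = complex.Im mu *: map_mx (@complex.Re R) v +
    complex.Re mu *: map_mx (@complex.Im R) v.
Proof.
move=> vA.
have sumRe (F : 'I_m -> R[i]) : complex.Re (\sum_i F i) = \sum_i complex.Re (F i).
  by elim/big_rec2: _ => [|i a b _ <-] //; case: (F i) b => [? ?] [? ?].
have sumIm (F : 'I_m -> R[i]) : complex.Im (\sum_i F i) = \sum_i complex.Im (F i).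
  by elim/big_rec2: _ => [|i a b _ <-] //; case: (F i) b => [? ?] [? ?].
split; apply/rowP => j; move/rowP/(_ j): vA; rewrite !mxE.
  move/(congr1 (@complex.Re R)); rewrite sumRe => e.
  transitivity (complex.Re (mu * v 0 j)).
    rewrite -e; apply: eq_bigr => k _; rewrite !mxE.
    by case: (v 0 k) => a b /=; ring.
  by case: mu (v 0 j) {e} => a b [c d].
move/(congr1 (@complex.Im R)); rewrite sumIm => e.
transitivity (complex.Im (mu * v 0 j)).
  rewrite -e; apply: eq_bigr => k _; rewrite !mxE.
  by case: (v 0 k) => a b /=; ring.
by case: mu (v 0 j) {e} => a b [c d] /=; ring.
Qed.

Lemma Re_Im_neq0 (m : nat) (v : 'rV[R[i]]_m) : v != 0 ->
  (map_mx (@complex.Re R) v != 0) || (map_mx (@complex.Im R) v != 0).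
Proof.
apply: contraNT; rewrite negb_or !negbK => /andP[/eqP/rowP v1 /eqP/rowP v2].
apply/eqP/rowP => j; have := v1 j; have := v2 j; rewrite !mxE.
by case: (v 0 j) => a b /= -> ->.
Qed.

(** In the basis [row_base W] the restriction of X is a matrix C; x and y are the real and imaginary
    parts of a complex eigenvector of C, with eigenvalue a + i b. *)
Lemma stable_eigen_pair (m : nat) (X W : 'M[R]_m) : W != 0 -> stablemx W X ->
  exists (x y : 'rV_m) (a b : R), [/\ (x <= W)%MS, (y <= W)%MS, (x != 0) || (y != 0),
    x *m X = a *: x - b *: y & y *m X = b *: x + a *: y].
Proof.
move=> W0 sW; pose B := row_base W.
have BW : (B :=: W)%MS by exact: eq_row_base.
have /submxP[C BC] : (B *m X <= B)%MS.
  by rewrite BW; apply: submx_trans sW; apply: submxMr; rewrite BW.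
have r0 : (0 < \rank W)%N by rewrite lt0n mxrank_eq0.
have /closed_rootP[mu] : size (char_poly (map_mx toC C)) != 1%N.
  by rewrite size_char_poly eqSS -lt0n.
rewrite -eigenvalue_root_char => /eigenvalueP[v vC v0].
have [eRe eIm] := complex_eigen_pair vC.
exists (map_mx (@complex.Re R) v *m B), (map_mx (@complex.Im R) v *m B).
exists (complex.Re mu), (complex.Im mu).
split; rewrite -?BW ?submxMl //.
- have nz (u : 'rV_(\rank W)) : (u *m B == 0) = (u == 0).
    by rewrite mulmx_free_eq0 // row_base_free.
  by rewrite !nz Re_Im_neq0.
- by rewrite -mulmxA BC mulmxA eRe mulmxBl -!scalemxAl.
- by rewrite -mulmxA BC mulmxA eIm mulmxDl -!scalemxAl.
Qed.

End ComplexEigenvectors.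

Section SkewSpectrum.
Variables (R : realType) (n : nat).
Local Notation V := 'rV[R]_n.+2.
Local Notation M := 'M[R]_n.+2.
Local Notation g := (@lform R n).
Local Notation toC := (real_complex R).
Implicit Types (u v w x y : V) (A B X Y W : M) (a b c : R).

Lemma isotropic_orth x y : x != 0 -> g x x = 0 -> g x y = 0 -> g y y = 0 ->
  exists c, y = c *: x.
Proof. by move=> x0 xx xy; apply: (causal_orth _ x0 xy).2; rewrite xx. Qed.

(* A complex eigenvector z of a skew operator whose eigenvalue is not purely   *)
(* imaginary satisfies g(z, z) = g(z, conj z) = 0, so that Re z and Im z span  *)
(* a totally isotropic subspace, which is at most a line.                      *)
Lemma skew_eigen_pair_real Y x y a b : skew Y -> (x != 0) || (y != 0) ->
  a != 0 -> x *m Y = a *: x - b *: y -> y *m Y = b *: x + a *: y ->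
  exists2 p : V, p != 0 & p *m Y = a *: p.
Proof.
move=> sY nz a0 ex ey.
have := skew_diag x sY; rewrite ex !lformE (lformC y x) => e1.
have := skew_diag y sY; rewrite ey !lformE => e2.
have := sY x y; rewrite ex ey !lformE => e3.
have [xx [yy xy]] : g x x = 0 /\ g y y = 0 /\ g x y = 0.
  have ab0 : a ^+ 2 + b ^+ 2 != 0.
    by rewrite gt_eqF // ltr_wpDr ?sqr_ge0 // lt_neqAle sqr_ge0 eq_sym sqrf_eq0 a0.
  have yx : g y y = - g x x by apply: (mulfI a0); rewrite mulrN; lra.
  have am : a * g x y = - (b * g x x) by rewrite yx in e3; lra.
  have xx : g x x = 0.
    apply: (mulfI ab0); rewrite mulr0 mulrDl.
    have -> : a ^+ 2 * g x x = a * (a * g x x) by ring.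
    have -> : a * g x x = b * g x y by lra.
    by rewrite mulrCA am; ring.
  by split=> //; split; [rewrite yx xx oppr0|apply: (mulfI a0); rewrite am xx !mulr0 oppr0].
case: (eqVneq x 0) nz ex ey => [-> /= y0|x0 _].
  rewrite mul0mx scaler0 add0r => /esym/eqP; rewrite oppr_eq0 scaler_eq0.
  by rewrite (negbTE y0) orbF => _ ey; exists y; rewrite ?ey ?scaler0 ?add0r.
have [c ->] := isotropic_orth x0 xx xy yy.
rewrite -scalemxAl => ex; rewrite ex => /eqP.
rewrite -subr_eq0 scalerBr !scalerA -scalerBl -!scalerDl -scalerBl scaler_eq0.
rewrite (negbTE x0) orbF => /eqP e.
have : b * (1 + c ^+ 2) = 0 by move: e; nra.
move=> /eqP; rewrite mulf_eq0 [_ + _ == 0]gt_eqF; last by have := sqr_ge0 c; lra.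
by rewrite orbF => /eqP b0; exists x; rewrite ?ex ?b0 ?mul0r ?scale0r ?subr0.
Qed.

(** Without nonzero real eigenvalues, [skew_eigen_pair_real] makes every complex eigenvalue of Y
    purely imaginary, so those of Y^2 are at most 0 and add up to its trace. If the sum vanishes
    they are all 0, and Cayley-Hamilton makes Y nilpotent. *)
Lemma skew_trace_nilpotent Y : skew Y ->
  (forall (p : V) a, p != 0 -> p *m Y = a *: p -> a = 0) ->
  \tr (Y *m Y) <= 0 /\ (\tr (Y *m Y) = 0 -> exists k, Y ^+ k = 0).
Proof.
move=> sY noreal; pose Yc := map_mx toC Y.
have [s ps] := closed_field_poly_normal (char_poly (Yc *m Yc)).
rewrite (monicP (char_poly_monic _)) scale1r in ps.
have ss : size s = n.+2.
  by have := size_char_poly (Yc *m Yc); rewrite ps size_prod_XsubC => -[].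
have s_le0 z : z \in s -> z <= 0.
  move=> zs; have : root (char_poly (Yc *m Yc)) z by rewrite ps root_prod_XsubC.
  rewrite -eigenvalue_root_char => /eigenvalueP[v vz v0].
  have : \det ((Yc - (sqrtC z)%:M) *m (Yc + (sqrtC z)%:M)) == 0.
    apply/det0P; exists v => //.
    have -> : (Yc - (sqrtC z)%:M) *m (Yc + (sqrtC z)%:M) = Yc *m Yc - z%:M.
      rewrite mulmxDr !mulmxBl -scalar_mxM -expr2 sqrtCK scalar_mxC.
      by rewrite addrA subrK.
    by rewrite mulmxBr vz mul_mx_scalar subrr.
  have imag mu (u : 'rV[R[i]]_n.+2) : u != 0 -> u *m Yc = mu *: u ->
      mu ^+ 2 <= 0.
    move=> u0 umu; have [e1 e2] := complex_eigen_pair umu.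
    case: (eqVneq (complex.Re mu) 0) => [re0|re0].
      case: mu re0 {umu e1 e2} => a b /= ->.
      rewrite expr2 lecE /=; apply/andP; split; first by apply/eqP; ring.
      by have := sqr_ge0 b; rewrite expr2; lra.
    have [p p0 pY] := skew_eigen_pair_real sY (Re_Im_neq0 u0) re0 e1 e2.
    by rewrite (noreal _ _ p0 pY) eqxx in re0.
  rewrite det_mulmx mulf_eq0 => /orP[] /det0P[u u0]; rewrite -{2}(sqrtCK z).
    rewrite mulmxBr mul_mx_scalar => /eqP; rewrite subr_eq0 => /eqP.
    exact: imag.
  rewrite mulmxDr mul_mx_scalar => /eqP; rewrite addr_eq0 -scaleNr => /eqP.
  by move=> /(imag _ _ u0); rewrite sqrrN.
have trs : toC (\tr (Y *m Y)) = \sum_(z <- s) z.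
  have := char_poly_trace (Yc *m Yc) isT; rewrite ps -[in LHS]ss.
  rewrite coefPn_prod_XsubC ?ss // => /oppr_inj ->.
  by rewrite /Yc -map_mxM trace_map_mx.
have toC_le0 c : (toC c <= 0) = (c <= 0) by rewrite lecE /= eqxx.
split=> [|tr0].
  rewrite -toC_le0 trs big_seq; apply: sumr_le0 => z; exact: s_le0.
have s0 z : z \in s -> z = 0.
  move=> zs; apply/eqP; rewrite -oppr_eq0.
  have /eqP : \sum_(z <- s) - z = 0 by rewrite sumrN -trs tr0 oppr0.
  rewrite big_seq psumr_eq0 => [/allP /(_ _ zs)|t ts]; first by rewrite zs.
  by rewrite oppr_ge0; exact: s_le0.
have pX : char_poly (Yc *m Yc) = 'X^(n.+2).
  rewrite ps -ss (eq_big_seq (fun=> 'X)) ?big_const_seq ?count_predT.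
    by rewrite iter_mulr_1.
  by move=> z /s0 ->; rewrite subr0.
exists (2 * n.+2)%N; have := Cayley_Hamilton (Yc *m Yc); rewrite pX.
rewrite rmorphXn /= horner_mx_X mulmxE -expr2 -exprM => Yn.
by apply/eqP; rewrite -(map_mx_eq0 toC) rmorphXn /= Yn.
Qed.

End SkewSpectrum.

(** * Orthogonal projection onto a nondegenerate subspace *)

HB.lock Definition perp_proj (R : realType) (n : nat) (W : 'M[R]_n.+2) :
  'M[R]_n.+2 := proj_mx W (perp W).

Section SplitSubspace.
Variables (R : realType) (n : nat) (W : 'M[R]_n.+2).
Hypothesis Wd : (W :&: perp W)%MS = 0.
Local Notation V := 'rV[R]_n.+2.
Local Notation M := 'M[R]_n.+2.
Local Notation g := (@lform R n).
Local Notation P := (perp_proj W).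
Implicit Types (u v w x y : V) (A B X Y : M) (a b c : R).

Lemma perp_proj_sub (m : nat) (A : 'M[R]_(m, n.+2)) : (A *m P <= W)%MS.
Proof. by rewrite perp_proj.unlock proj_mx_sub. Qed.

Lemma perp_proj_id (m : nat) (A : 'M[R]_(m, n.+2)) : (A <= W)%MS -> A *m P = A.
Proof. by rewrite perp_proj.unlock; exact: proj_mx_id. Qed.

Lemma perp_proj_0 (m : nat) (A : 'M[R]_(m, n.+2)) :
  (A <= perp W)%MS -> A *m P = 0.
Proof. by rewrite perp_proj.unlock; exact: proj_mx_0. Qed.

Lemma proj_perp_compl u : (u - u *m P <= perp W)%MS.
Proof.
rewrite perp_proj.unlock; apply: proj_mx_compl_sub.
by apply: submx_trans (submx1 u) _; exact: perp_sum.
Qed.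

Lemma lform_proj u v : g (u *m P) v = g u (v *m P).
Proof.
have h x y : g (x *m P) y = g (x *m P) (y *m P).
  have /perpP/(_ _ (perp_proj_sub x)) := proj_perp_compl y.
  by rewrite lformC !lformE; lra.
by rewrite h lformC -h lformC.
Qed.

Lemma proj_comm X : skew X -> stablemx W X -> P *m X = X *m P.
Proof.
move=> sX WX; apply: mulmx_row_ext => u; rewrite !mulmxA.
have uPX : (u *m P *m X <= W)%MS.
  by apply: submx_trans WX; apply: submxMr; exact: perp_proj_sub.
have uCX : ((u - u *m P) *m X <= perp W)%MS.
  apply: submx_trans (perp_stable_skew sX WX); apply: submxMr.
  exact: proj_perp_compl.
have -> : u *m X = (u - u *m P) *m X + u *m P *m X by rewrite -mulmxDl subrK.
by rewrite (mulmxDl ((u - u *m P) *m X)) (perp_proj_0 uCX) add0r (perp_proj_id uPX).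
Qed.

Lemma proj_skew X : skew X -> stablemx W X -> skew (P *m X).
Proof.
move=> sX WX u v; rewrite mulmxA sX lform_proj -mulmxA -(proj_comm sX WX).
by rewrite mulmxA.
Qed.

Lemma proj_idem : P *m P = P.
Proof.
by apply: mulmx_row_ext => u; rewrite mulmxA perp_proj_id //; exact: perp_proj_sub.
Qed.

Lemma proj_trace_ge0 : 0 <= \tr P.
Proof.
pose B := row_base W.
have BW : (B :=: W)%MS by exact: eq_row_base.
have /submxP[C PC] : (P <= B)%MS by rewrite BW -[P]mul1mx; exact: perp_proj_sub.
have BP : B *m P = B by apply: perp_proj_id; rewrite BW.
have BC : B *m C = 1%:M.
  apply: (row_free_inj (row_base_free W)).
  by rewrite mul1mx -mulmxA -PC BP.
by rewrite PC mxtrace_mulC BC mxtrace1.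
Qed.

Lemma proj_mulmx X Y : skew X -> stablemx W X ->
  P *m (X *m Y) = P *m X *m (P *m Y).
Proof.
move=> sX WX; rewrite mulmxA !(proj_comm sX WX).
by rewrite -!mulmxA (mulmxA P P) proj_idem.
Qed.

Lemma trace_wedge A x y : \tr (A *m wedge x y) = g (y *m A) x - g (x *m A) y.
Proof.
have h (v w : V) : \tr (A *m (lgram R n *m v^T *m w)) = g (w *m A) v.
  by rewrite mulmxA mxtrace_mulC !mulmxA trace_mx11 lform_gram.
by rewrite wedge.unlock !mulmxBr linearB /= !(mulmxA (lgram R n)) !h.
Qed.

Lemma witt_partner p : p != 0 -> (p <= W)%MS -> g p p = 0 ->
  exists q, [/\ (q <= W)%MS, g q q = 0 & g p q = 1].
Proof.
move=> p0 pW pp.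
have [w [wW pw]] : exists w, (w <= W)%MS /\ g p w != 0.
  apply: contrapT => no; move/eqP: p0; apply.
  suff : (p <= W :&: perp W)%MS by rewrite Wd submx0 => /eqP.
  rewrite sub_capmx pW; apply/perpP => v vW; apply: contrapT => /eqP pv.
  by apply: no; exists v.
have [z [zW pz]] : exists z, (z <= W)%MS /\ g p z = 1.
  by exists ((g p w)^-1 *: w); rewrite lformZr mulVf // scalemx_sub.
exists (z - (g z z / 2%:R) *: p); split.
- by rewrite addmx_sub // eqmx_opp scalemx_sub.
- by rewrite !lformE (lformC z p) pz pp; field.
- by rewrite !lformE pz pp; ring.
Qed.

Lemma skew_expr X k u v : skew X -> g (u *m X ^+ k) v = (-1) ^+ k * g u (v *m X ^+ k).
Proof.
move=> sX; elim: k u v => [|k IHk] u v; first by rewrite !expr0 !mulmx1 mul1r.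
have -> : u *m X ^+ k.+1 = u *m X *m X ^+ k by rewrite exprS -mulmxE mulmxA.
have -> : v *m X ^+ k.+1 = v *m X ^+ k *m X by rewrite exprSr -mulmxE mulmxA.
by rewrite IHk sX exprS; ring.
Qed.

(** A nonzero vector p in the image of the last nonzero power of Y is isotropic and killed by Y.
    With a Witt partner q of p and u = q Y, the operator Y - [wedge p u] kills p and q, hence the
    timelike p - q, and its square has the trace of Y^2, namely 0; so it vanishes by
    [skew_timelike_trace]. *)
Lemma nilpotent_skew_wedge Y k : skew Y -> (Y <= W)%MS -> Y ^+ k = 0 ->
  \tr (Y *m Y) = 0 -> Y != 0 ->
  exists p u, [/\ (p <= W)%MS, (u <= W)%MS & p != 0] /\
    [/\ g p p = 0, g p u = 0, 0 < g u u & Y = wedge p u].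
Proof.
move=> sY YW Yk trY Y0.
have ex : exists k, Y ^+ k == 0 by exists k; rewrite Yk.
case: (ex_minnP ex) => -[/eqP|[/eqP|m /eqP Ym min]].
  by rewrite expr0 => /eqP; rewrite oner_eq0.
  by rewrite expr1 => Y00; rewrite Y00 eqxx in Y0.
have : Y ^+ m.+1 != 0 by apply/negP => /min; rewrite ltnn.
move=> /rowV0Pn[p /submxP[v pv] p0].
have pp : g p p = 0.
  rewrite pv skew_expr // -mulmxA mulmxE -exprD addnS -addSn exprD Ym.
  by rewrite mul0r mulmx0 lform0r mulr0.
have pW : (p <= W)%MS.
  rewrite pv exprSr -mulmxE mulmxA; apply: submx_trans YW; exact: submxMl.
have pY : p *m Y = 0 by rewrite pv -mulmxA mulmxE -exprSr Ym mulmx0.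
have [q [qW qq pq]] := witt_partner p0 pW pp.
pose u := q *m Y.
have uW : (u <= W)%MS by apply: submx_trans YW; exact: submxMl.
have uq : g u q = 0 by exact: skew_diag.
have pu : g p u = 0 by rewrite lformC /u sY pY lform0r oppr0.
pose Z := Y - wedge p u.
have sZ : skew Z by apply: skewD => //; apply: skewN; exact: wedge_skew.
have pZ : p *m Z = 0 by rewrite mulmxBr pY mul_wedge pp pu !scale0r !subr0.
have qZ : q *m Z = 0.
  by rewrite mulmxBr mul_wedge (lformC q p) pq (lformC q u) uq scale0r scale1r subr0 subrr.
have tt : g (p - q) (p - q) < 0.
  by rewrite !lformE (lformC q p) pp qq pq; lra.
have Zt : (p - q) *m Z = 0 by rewrite mulmxBl pZ qZ subrr.
have YZ : Y = Z + wedge p u by rewrite subrK.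
clearbody Z u.
have trZ : \tr (Z *m Z) = 0.
  rewrite -trY YZ mulmxDr !mulmxDl !mxtraceD [\tr (wedge p u *m Z)]mxtrace_mulC.
  rewrite !trace_wedge !mul_wedge pZ sZ pZ !lformE pp (lformC u p) pu.
  by ring.
have Z0 : Z = 0.
  by apply/eqP; rewrite -(skew_timelike_trace sZ tt Zt).2 trZ.
have Yw : Y = wedge p u by rewrite YZ Z0 add0r.
have tu : g (p - q) u = 0 by rewrite !lformE pu (lformC q u) uq subr0.
exists p, u; split=> //; split=> //; rewrite ltNge; apply/negP => uu.
move: Y0; rewrite Yw (timelike_orth tt tu uu).
by rewrite -(scale0r (0 : V)) wedgeZr scale0r eqxx.
Qed.

End SplitSubspace.

(** * Irreducible Lie algebras of skew operators *)

(** An invariant subspace of a normal operator is invariant under the adjoint. For an orthonormal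
    basis f of S, the parts of the L' f_i orthogonal to S have total squared norm sum |L' f_i|^2 -
    sum b(L' f_i, f_j)^2; by normality the first sum equals sum |L f_i|^2, which is the second one
    because L f_i lies in S. The set T is an ambient space on which b is positive, later that of all
    skew operators. *)
Lemma normal_adjoint_stable (R : realType) (U : vectType R) (S T : set U)
    (b : U -> U -> R) (L L' : U -> U) :
  S `<=` T -> S 0 -> (forall a u v, S u -> S v -> S (a *: u + v)) ->
  (forall a u v, T u -> T v -> T (a *: u + v)) ->
  (forall a u v w, b (a *: u + v) w = a * b u w + b v w) ->
  (forall u v, b u v = b v u) ->
  (forall u, T u -> u != 0 -> 0 < b u u) ->
  (forall a u v, L' (a *: u + v) = a *: L' u + L' v) ->
  (forall u v, b (L u) v = b u (L' v)) -> (forall u, L (L' u) = L' (L u)) ->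
  (forall u, S u -> S (L u)) -> (forall u, T u -> T (L' u)) ->
  forall u, S u -> S (L' u).
Proof.
move=> ST S0 Slin Tlin blin bC bpos L'lin adj comm SL TL'.
have [k [f [Sf fo fspan]]] :=
  orthonormal_basis S0 Slin blin bC (fun u Su => bpos u (ST u Su)).
have b0 w : b 0 w = 0.
  by have := blin 1 0 0 w; rewrite scale1r addr0 mul1r; lra.
have bsum (c : 'I_k -> R) w : b (\sum_i c i *: f i) w = \sum_i c i * b (f i) w.
  by elim/big_rec2: _ => [|i y1 y2 _ <-]; rewrite ?b0 ?blin.
have Ssum (c : 'I_k -> R) (F : 'I_k -> U) : (forall i, S (F i)) ->
    S (\sum_i c i *: F i).
  by move=> SF; elim/big_rec: _ => [//|i y _ Sy]; exact: Slin.
pose d u := u - \sum_j b u (f j) *: f j.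
have dE u : d u = -1 *: (\sum_j b u (f j) *: f j) + u by rewrite scaleN1r addrC.
have df u j : b (d u) (f j) = 0.
  rewrite dE blin bsum (bigD1 j) //= fo eqxx mulr1 big1 => [|i ij].
    by rewrite addr0 mulN1r addNr.
  by rewrite fo (negbTE ij) mulr0.
have bessel u : b (d u) (d u) = b u u - \sum_j b u (f j) ^+ 2.
  transitivity (b (d u) u).
    rewrite {2}dE bC blin bsum big1 => [|j _]; last by rewrite (bC (f j)) df mulr0.
    by rewrite mulr0 add0r bC.
  rewrite dE blin bsum addrC mulN1r; congr (_ - _); apply: eq_bigr => j _.
  by rewrite (bC (f j)) expr2.
have parseval u : S u -> b u u = \sum_j b u (f j) ^+ 2.
  move=> Su; have du0 : d u = 0 by rewrite /d -fspan // subrr.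
  by have := bessel u; rewrite du0 b0; lra.
have sum0 : \sum_i b (d (L' (f i))) (d (L' (f i))) = 0.
  under eq_bigr do rewrite bessel.
  rewrite sumrB; apply/eqP; rewrite subr_eq0; apply/eqP.
  rewrite [RHS]exchange_big /=; apply: eq_bigr => i _.
  rewrite -adj comm bC -adj parseval; last exact: SL.
  by apply: eq_bigr => j _; rewrite adj bC.
have Td i : T (d (L' (f i))).
  by rewrite dE; apply: Tlin; [apply: ST; exact: Ssum|apply/TL'/ST].
have d0 i : d (L' (f i)) = 0.
  apply: contrapT => /eqP dn; have := bpos _ (Td i) dn.
  suff -> : b (d (L' (f i))) (d (L' (f i))) = 0 by rewrite ltxx.
  apply: (psumr_eq0P _ sum0) => // j _.
  case: (eqVneq (d (L' (f j))) 0) => [->|]; first by rewrite b0.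
  by move/(bpos _ (Td j))/ltW.
have L'0 : L' 0 = 0.
  by have := L'lin 1 0 0; rewrite !scale1r addr0 => /eqP; rewrite -subr_eq0 opprD
    addNKr oppr_eq0 => /eqP.
have SL'f i : S (L' (f i)).
  by have := d0 i => /eqP; rewrite subr_eq0 => /eqP ->; exact: Ssum.
move=> u Su; rewrite (fspan u Su).
suff -> : L' (\sum_i b u (f i) *: f i) = \sum_i b u (f i) *: L' (f i) by exact: Ssum.
by elim/big_rec2: _ => [//|i y1 y2 _ <-]; exact: L'lin.
Qed.

(** * The Cartan form of so(V) *)

Section CartanForm.
Variables (R : realType) (n : nat).
Local Notation V := 'rV[R]_n.+2.
Local Notation M := 'M[R]_n.+2.
Local Notation g := (@lform R n).
Local Notation J := (lgram R n).
Implicit Types (u v w x y : V) (A B X Y : M) (a b c : R).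

Lemma refl_conj B w : lisometry B -> refl w *m B = B *m refl (w *m B).
Proof.
move=> iB; apply: mulmx_row_ext => u; rewrite !mulmxA !mul_refl !iB.
by rewrite mulmxBl -scalemxAl.
Qed.

Lemma wedge_conj B x y : lisometry B ->
  wedge x y *m B = B *m wedge (x *m B) (y *m B).
Proof.
move=> iB; apply: mulmx_row_ext => u; rewrite !mulmxA !mul_wedge !iB.
by rewrite mulmxBl -!scalemxAl.
Qed.

Lemma refl_e0 c : c != 0 -> refl (c *: e0 R n) = J.
Proof.
move=> c0; apply: mulmx_row_ext => u; rewrite mul_refl gramE mulmxBr mulmx1.
rewrite -scalemxAr mulmxA [u *m _]mx11_scalar mul_scalar_mx scalerA !lformE.
rewrite lform_e0_e0 lform_e0 scalerA; congr (_ - _ *: _).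
rewrite mxE (bigD1 ord0) //= big1 => [|i i0]; last first.
  by rewrite !mxE (negbTE i0) andbF mulr0.
by rewrite !mxE !eqxx /= addr0 mulr1; field.
Qed.

Lemma refl_refl w : g w w != 0 -> refl w *m refl w = 1%:M.
Proof.
move=> ww; apply: mulmx_row_ext => u; rewrite mulmxA mulmx1 !mul_refl !lformE.
by apply/rowP => j; rewrite !mxE; field.
Qed.

(** Conjugation by the reflection in a timelike w is a Cartan involution: once w is moved to a
    multiple of [e0] the reflection is the Gram matrix, and the form is the sum of the squares of
    the entries of Y. *)
Lemma cartan_form_gt0 w A : g w w < 0 -> skew A -> A != 0 ->
  0 < - \tr (A *m refl w *m (A *m refl w)).
Proof.
move=> ww sA A0; have [B [[iB _] [c c0 wB]]] := SOV_timelike_e0 ww.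
have uB := lisometry_unit iB.
pose Y := invmx B *m A *m B.
have sY : skew Y by exact: skew_conj.
have AY : A = B *m Y *m invmx B by rewrite /Y !mulmxA mulmxV // mul1mx mulmxK.
clearbody Y.
have rJ : refl w = B *m J *m invmx B.
  by rewrite -(refl_e0 c0) -wB -refl_conj // mulmxK.
have -> : \tr (A *m refl w *m (A *m refl w)) = \tr (Y *m J *m Y *m J).
  rewrite -(mxtrace_conj (Y *m J *m Y *m J) (_ : invmx B \in unitmx)) ?unitmx_inv //.
  by rewrite invmxK AY rJ !mulmxA !mulmxKV.
have /skewP := sY; rewrite gadj.unlock => YJ.
have -> : Y *m J *m Y *m J = - (Y *m Y^T).
  have JYJ : J *m Y *m J = - Y^T.
    have -> : J *m Y *m J = - (J *m (- Y) *m J) by rewrite mulmxN mulNmx opprK.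
    by rewrite -YJ !mulmxA gram_gram mul1mx -mulmxA gram_gram mulmx1.
  by rewrite -!mulmxA (mulmxA J Y J) JYJ mulmxN.
rewrite linearN opprK lt_neqAle trace_mul_tr_ge0 andbT eq_sym.
apply: contra A0 => /eqP/trace_mul_tr_eq0 Y0.
by rewrite AY Y0 mulmx0 mul0mx.
Qed.

End CartanForm.

(** * An irreducible Lie algebra on a Lorentzian subspace contains so(W) *)

Section IrreducibleLieAlgebra.
Variables (R : realType) (n : nat) (h : set 'M[R]_n.+2) (W : 'M[R]_n.+2).
Local Notation V := 'rV[R]_n.+2.
Local Notation M := 'M[R]_n.+2.
Local Notation g := (@lform R n).
Local Notation P := (perp_proj W).
Implicit Types (p q t u v w x y : V) (A B C X Y S : M) (a b c : R).
Hypothesis hL : Lie_subalgebra h.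
Hypothesis h_skew : forall X, h X -> skew X.
Hypothesis h_stable : forall X, h X -> stablemx W X.
Hypothesis Wd : (W :&: perp W)%MS = 0.
Hypothesis irr : forall S, (S <= W)%MS -> (forall X, h X -> stablemx S X) ->
  S = 0 \/ (W <= S)%MS.
Hypothesis rW : (3 <= \rank W)%N.
Variable t : V.
Hypothesis tW : (t <= W)%MS.
Hypothesis tt : g t t < 0.

Lemma Lie_memD X Y : h X -> h Y -> h (X + Y).
Proof. by case: hL => _ H _ _; exact: H. Qed.

Lemma Lie_memZ a X : h X -> h (a *: X).
Proof. by case: hL => _ _ H _; exact: H. Qed.

Lemma Lie_memN X : h X -> h (- X).
Proof. by rewrite -scaleN1r; exact: Lie_memZ. Qed.

Lemma Lie_memB X Y : h X -> h Y -> h (X - Y).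
Proof. by move=> hX hY; apply: Lie_memD => //; exact: Lie_memN. Qed.

Lemma Lie_mem_bracket X Y : h X -> h Y -> h (X * Y - Y * X).
Proof. by case: hL => _ _ _ H; exact: H. Qed.

Lemma Lie_mem_lin a X Y : h X -> h Y -> h (a *: X + Y).
Proof. by move=> hX hY; apply: Lie_memD => //; exact: Lie_memZ. Qed.

Lemma Lie_mem0 : h 0.
Proof. by case: hL. Qed.

Lemma stable_sub X u : h X -> (u <= W)%MS -> (u *m X <= W)%MS.
Proof. by move=> hX uW; apply: submx_trans (h_stable hX); apply: submxMr. Qed.

Lemma no_invariant_line p : p != 0 -> (p <= W)%MS ->
  exists2 X, h X & forall c, p *m X != c *: p.
Proof.
move=> p0 pW; apply: contrapT => no.
have inv X : h X -> stablemx <<p>>%MS X.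
  move=> hX; have [c pc] : exists c, p *m X = c *: p.
    apply: contrapT => noc; apply: no; exists X => // c; apply/eqP => pc.
    by apply: noc; exists c.
  have pp : (<<p>> :=: p)%MS by exact: genmxE.
  have : (p *m X <= <<p>>)%MS by rewrite pp pc scalemx_sub.
  by apply: submx_trans; apply: submxMr; rewrite pp.
have [||p00|Wp] := @irr <<p>>%MS; rewrite ?genmxE //.
  have : (p <= <<p>>)%MS by rewrite genmxE.
  by rewrite p00 submx0 (negbTE p0).
have := leq_trans rW (mxrankS Wp); rewrite genmxE => r3.
by have := leq_trans r3 (rank_leq_row p).
Qed.

Section NoRealEigenvalue.
Hypothesis noreal : forall X p a, h X -> (p <= W)%MS -> p != 0 ->
  p *m X = a *: p -> a = 0.

Lemma proj_trace_spec X : h X -> \tr (P *m X *m (P *m X)) <= 0 /\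
  (\tr (P *m X *m (P *m X)) = 0 -> exists k, (P *m X) ^+ k = 0).
Proof.
move=> hX; apply: skew_trace_nilpotent.
  by apply: proj_skew => //; [exact: h_skew|exact: h_stable].
move=> p a p0 pX; apply: contrapT => /eqP a0.
have pW : (p <= W)%MS.
  have -> : p = a^-1 *: (p *m (P *m X)) by rewrite pX scalerA mulVf // scale1r.
  by apply: scalemx_sub; rewrite mulmxA; apply: stable_sub => //; exact: perp_proj_sub.
move/eqP: a0; apply; apply: (noreal hX pW p0).
by rewrite -pX mulmxA perp_proj_id.
Qed.

Lemma proj_trace_polar X Y a : h X -> h Y ->
  \tr (P *m (Y + a *: X) *m (P *m (Y + a *: X))) =
  \tr (P *m Y *m (P *m Y)) + 2%:R * a * \tr (P *m X *m (P *m Y)) +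
  a ^+ 2 * \tr (P *m X *m (P *m X)).
Proof.
move=> hX hY; rewrite mulmxDr -scalemxAr mulmxDr !mulmxDl -!scalemxAl -!scalemxAr.
rewrite !mxtraceD !mxtraceZ [\tr (P *m Y *m (P *m X))]mxtrace_mulC.
by ring.
Qed.

(** Otherwise P X is nilpotent, hence [wedge p u] with p isotropic. Since the trace form is
    semidefinite on h, P X is orthogonal to all of h, so g(p Y, u) = 0 for every Y. Taking Y with p
    Y outside the line of p, the double bracket B = [[X,Y],X] restricts to a multiple of
    [wedge p (p *m Y)]; the same argument for B gives g(p Y, p Y) = 0, which forces p Y into the
    line of p. *)
Lemma proj_trace_lt0 X : h X -> P *m X != 0 -> \tr (P *m X *m (P *m X)) < 0.
Proof.
move=> hX X0; have [X_le0 Xnil] := proj_trace_spec hX.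
rewrite lt_neqAle X_le0 andbT; apply/negP => /eqP X00.
have [k Xk] := Xnil X00.
have sPX Y : h Y -> skew (P *m Y).
  by move=> hY; apply: proj_skew => //; [exact: h_skew|exact: h_stable].
have PXW Y : h Y -> (P *m Y <= W)%MS.
  move=> hY; apply: submx_trans (h_stable hY); apply: submxMr.
  by rewrite -[P]mul1mx; exact: perp_proj_sub.
have [p [u [[pW uW p0] [pp pu uu Xw]]]] :=
  nilpotent_skew_wedge Wd (sPX _ hX) (PXW _ hX) Xk X00 X0.
have trw v Y : (p <= W)%MS -> (v <= W)%MS -> h Y ->
    \tr (wedge p v *m (P *m Y)) = - 2%:R * g (p *m Y) v.
  move=> _ vW hY; rewrite mxtrace_mulC trace_wedge !mulmxA !perp_proj_id //.
  by rewrite (h_skew hY) lformC; ring.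
have no_pair Z v Y : h Z -> P *m Z = wedge p v -> (v <= W)%MS -> g p v = 0 ->
    h Y -> g (p *m Y) v = 0.
  move=> hZ' Zw vW pv hY; apply: contrapT => /eqP m0.
  pose m := \tr (P *m Z *m (P *m Y)).
  have mn0 : m != 0 by rewrite /m Zw trw // mulf_neq0 // oppr_eq0 pnatr_eq0.
  (* With this s the square of P (Y + s Z) has trace 1, because the square of P Z has trace 0; this
     contradicts [proj_trace_spec]. *)
  pose s := (1 - \tr (P *m Y *m (P *m Y))) / (2%:R * m).
  have [+ _] := proj_trace_spec (Lie_memD hY (Lie_memZ s hZ')).
  rewrite proj_trace_polar // -/m Zw mxtrace_mulC trace_wedge !mul_wedge.
  rewrite -[m in X in X -> _]/m !lformE (lformC v p) pv pp.
  have -> : 2%:R * s * m = 1 - \tr (P *m Y *m (P *m Y)) by rewrite /s; field.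
  by rewrite !(mulr0, mul0r, subr0, addr0) addrC subrK; lra.
have [Y hY pY] := no_invariant_line p0 pW.
have pYu := no_pair X u Y hX Xw uW pu hY.
have pYp : g (p *m Y) p = 0 by exact: skew_diag (h_skew hY).
pose A := X * Y - Y * X; pose B := A * X - X * A.
have hA : h A by exact: Lie_mem_bracket.
have hB' : h B by exact: Lie_mem_bracket.
have PY Z Z' : h Z -> h Z' -> P *m (Z * Z' - Z' * Z) =
    (P *m Z) * (P *m Z') - (P *m Z') * (P *m Z).
  move=> h1 h2; rewrite mulmxBr -!mulmxE.
  by rewrite !(proj_mulmx Wd) //; by [exact: h_skew|exact: h_stable].
have pPY : p *m (P *m Y) = p *m Y by rewrite mulmxA perp_proj_id.
have uPY : u *m (P *m Y) = u *m Y by rewrite mulmxA perp_proj_id.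
have PA : P *m A = wedge (p *m Y) u + wedge p (u *m Y).
  by rewrite PY // Xw wedge_lie ?pPY ?uPY //; exact: sPX.
have PB : P *m B = wedge p (g u u *: (p *m Y)).
  have pw : p *m wedge p u = 0 by rewrite mul_wedge pp pu !scale0r subrr.
  have uw : u *m wedge p u = - g u u *: p.
    by rewrite mul_wedge (lformC u p) pu scale0r sub0r scaleNr.
  have pYw : p *m Y *m wedge p u = 0 by rewrite mul_wedge pYp pYu !scale0r subrr.
  have uYw : u *m Y *m wedge p u = 0.
    rewrite mul_wedge (skew_diag _ (h_skew hY)) (h_skew hY) lformC pYu.
    by rewrite oppr0 !scale0r subrr.
  rewrite PY // PA Xw mulrDl mulrDr opprD addrACA !wedge_lie; try exact: wedge_skew.
  rewrite pYw pw uYw uw !(wedge0l, wedge0r) add0r !addr0 wedgeZr wedgeZr wedgeC.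
  by rewrite scaleNr scalerN opprK.
have vW : (g u u *: (p *m Y) <= W)%MS by apply: scalemx_sub; exact: stable_sub.
have pv : g p (g u u *: (p *m Y)) = 0 by rewrite lformZr lformC pYp mulr0.
have /eqP := no_pair B _ Y hB' PB vW pv hY.
rewrite lformZr mulf_eq0 (gt_eqF uu) /= => /eqP yy.
rewrite lformC in pYp.
by have [c pYc] := isotropic_orth p0 pp pYp yy; have := pY c; rewrite pYc eqxx.
Qed.

(* With no real eigenvalue, - tr (X Y) would be an invariant scalar product on *)
(* h.  Its Casimir operator C = \sum_i f_i ^+ 2 acts on W as a scalar a; the    *)
(* trace gives a < 0, whereas g (t C) t = - \sum_i g (t f_i) (t f_i) <= 0 with  *)
(* t timelike gives a >= 0.                                                     *)
Lemma no_real_eigenvalue_absurd : False.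
Proof.
(* X is the sum of P X and of Z, which kills W. The trace of the square splits accordingly, and
   [skew_timelike_trace] handles Z because t is in W. *)
have trXX X : h X -> X != 0 -> \tr (X *m X) < 0.
  move=> hX X0; pose Z := X - P *m X.
  have sX := h_skew hX; have WX := h_stable hX.
  have sP := proj_skew Wd sX WX.
  have sZ : skew Z by apply: skewD => //; exact: skewN.
  have tZ : t *m Z = 0 by rewrite mulmxBr mulmxA perp_proj_id // subrr.
  have [Z_le0 Z_eq0] := skew_timelike_trace sZ tt tZ.
  have trX : \tr (X *m X) = \tr (P *m X *m (P *m X)) + \tr (Z *m Z).
    have PZ : P *m X *m Z = 0 by rewrite mulmxBr -!(proj_mulmx Wd) // -mulmxA subrr.
    have : X = Z + P *m X by rewrite subrK.
    move: (P *m X) Z PZ {sP sZ tZ Z_le0 Z_eq0} => A B AB ->.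
    rewrite mulmxDr !mulmxDl !mxtraceD [\tr (B *m A)]mxtrace_mulC AB mxtrace0.
    by rewrite !(add0r, addr0) addrC.
  rewrite trX; case: (eqVneq (P *m X) 0) => [PX0|PX0].
    rewrite PX0 mul0mx mxtrace0 add0r lt_neqAle Z_le0 Z_eq0 andbT.
    by rewrite /Z PX0 subr0.
  by have := proj_trace_lt0 hX PX0; lra.
have [k [f [hf fo fspan]]] :
    exists k (f : 'I_k -> M), [/\ forall i, h (f i),
      forall i j, - \tr (f i *m f j) = (i == j)%:R
      & forall X, h X -> X = \sum_i (- \tr (X *m f i)) *: f i].
  apply: (@orthonormal_basis _ _ h (fun X Y => - \tr (X *m Y))).
  - exact: Lie_mem0.
  - by move=> a X Y; exact: Lie_mem_lin.
  - by move=> a X Y Z; rewrite mulmxDl -scalemxAl mxtraceD mxtraceZ; ring.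
  - by move=> X Y; rewrite mxtrace_mulC.
  - by move=> X hX X0; rewrite oppr_gt0; exact: trXX.
pose C := \sum_i f i *m f i.
(* The coefficients c of the bracket with Y in the basis f are antisymmetric, by invariance of the
   trace form, so the commutator of C and Y is an antisymmetric combination of symmetric
   products. *)
have C_comm Y : h Y -> C *m Y = Y *m C.
  move=> hY; pose c i j := - \tr ((f i *m Y - Y *m f i) *m f j).
  have trB A B : \tr (A - B) = \tr A - \tr B by exact: linearB.
  have c_anti i j : c i j = - c j i.
    rewrite /c !mulmxBl !trB -!mulmxA [\tr (f i *m _)]mxtrace_mulC.
    by rewrite [\tr (f j *m _)]mxtrace_mulC -!mulmxA; ring.
  have lieE i : f i *m Y - Y *m f i = \sum_j c i j *: f j.
    by apply: fspan; exact: Lie_mem_bracket.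
  apply/eqP; rewrite -subr_eq0; apply/eqP.
  pose T := \sum_i \sum_j c i j *: (f i *m f j + f j *m f i).
  have -> : C *m Y - Y *m C = T.
    rewrite mulmx_suml mulmx_sumr -sumrB; apply: eq_bigr => i _.
    transitivity (f i *m (f i *m Y - Y *m f i) + (f i *m Y - Y *m f i) *m f i).
      by rewrite mulmxBr mulmxBl !mulmxA addrA subrK.
    rewrite lieE mulmx_sumr mulmx_suml -big_split /=; apply: eq_bigr => j _.
    by rewrite -scalemxAr -scalemxAl -scalerDr.
  have TN : T = - T.
    rewrite {1}/T exchange_big /= -sumrN; apply: eq_bigr => i _.
    rewrite -sumrN; apply: eq_bigr => j _.
    by rewrite c_anti scaleNr [f j *m _ + _]addrC.
  have : 2%:R *: T = 0 by rewrite scaler_nat mulr2n {1}TN addNr.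
  by move/eqP; rewrite scaler_eq0 pnatr_eq0 /= => /eqP.
have gC u v : g (u *m C) v = - \sum_i g (u *m f i) (v *m f i).
  rewrite mulmx_sumr lform_suml -sumrN; apply: eq_bigr => i _.
  by rewrite mulmxA (h_skew (hf i)).
have C_adj u v : g (u *m C) v = g u (v *m C).
  rewrite gC lformC gC; congr (- _); apply: eq_bigr => i _; exact: lformC.
have WC : stablemx W C.
  rewrite mulmx_sumr; apply: summx_sub => i _; rewrite mulmxA.
  by apply: submx_trans (h_stable (hf i)); apply: submxMr; exact: h_stable.
have schur D x u : (forall X, h X -> D *m X = X *m D) -> x != 0 ->
    (x <= W)%MS -> x *m D = 0 -> (u <= W)%MS -> u *m D = 0.
  move=> D_comm x0 xW xD uW.
  have xS : (x <= W :&: kermx D)%MS by rewrite sub_capmx xW; apply/sub_kermxP.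
  have [X hX|S0|WS] := @irr (W :&: kermx D)%MS (capmxSl _ _).
  - rewrite sub_capmx; apply/andP; split.
      by apply: submx_trans (h_stable hX); apply: submxMr; exact: capmxSl.
    apply/sub_kermxP; rewrite -mulmxA -D_comm // mulmxA.
    have /sub_kermxP -> : (W :&: kermx D <= kermx D)%MS by exact: capmxSr.
    by rewrite mul0mx.
  - by rewrite S0 submx0 (negbTE x0) in xS.
  - by apply/sub_kermxP/(submx_trans uW)/(submx_trans WS); exact: capmxSr.
have scal_comm (a : R) X : h X -> (C - a%:M) *m X = X *m (C - a%:M).
  by move=> hX; rewrite mulmxBl mulmxBr C_comm // scalar_mxC.
have t0 : t != 0 by apply: contraTneq tt => ->; rewrite lform0l ltxx.
(* Schur's lemma: for a complex eigenvalue a + i b of C on W, the square of C - a plus b^2 has a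
   nonzero kernel in W, which is stable under h and so is W. *)
have [a aC] : exists a, forall u, (u <= W)%MS -> u *m C = a *: u.
  have W0 : W != 0 by rewrite -mxrank_eq0 -lt0n; exact: leq_trans rW.
  have [x [y [a [b [xW yW nz xC yC]]]]] := stable_eigen_pair W0 WC.
  pose D : M := C - a%:M.
  have xD : x *m D = - b *: y.
    by rewrite mulmxBr mul_mx_scalar xC addrAC subrr add0r scaleNr.
  have yD : y *m D = b *: x by rewrite mulmxBr mul_mx_scalar yC addrK.
  have [z z0 [zW zD]] : exists2 z : V, z != 0 &
      (z <= W)%MS /\ z *m (D *m D + (b ^+ 2)%:M) = 0.
    have zD (z : V) : z *m D *m D = - b ^+ 2 *: z -> z *m (D *m D + (b ^+ 2)%:M) = 0.
      by rewrite mulmxDr mulmxA => ->; rewrite mul_mx_scalar scaleNr addNr.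
    case/orP: nz => [x0|y0]; [exists x|exists y] => //; split=> //; apply: zD.
      by rewrite xD -scalemxAl yD scalerA mulNr expr2.
    by rewrite yD -scalemxAl xD scalerA mulrN expr2.
  have DD u : (u <= W)%MS -> u *m D *m D = - b ^+ 2 *: u.
    move=> uW; have comm X : h X -> (D *m D + (b ^+ 2)%:M) *m X =
        X *m (D *m D + (b ^+ 2)%:M).
      move=> hX; have DX : D *m X = X *m D by exact: scal_comm.
      by rewrite mulmxDl mulmxDr scalar_mxC -(mulmxA D D) DX !mulmxA DX.
    have := schur _ _ u comm z0 zW zD uW.
    rewrite mulmxDr mulmxA mul_mx_scalar => /eqP; rewrite addr_eq0 => /eqP ->.
    by rewrite scaleNr.
  have D_adj u v : g (u *m D) v = g u (v *m D).
    by rewrite !mulmxBr !mul_mx_scalar !lformE C_adj.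
  case: (eqVneq b 0) => [b0|b0].
    exists a => u uW; have [v [v0 vW vD]] : exists v, [/\ v != 0, (v <= W)%MS &
        v *m D = 0].
      by case/orP: nz => ?; [exists x|exists y]; split=> //;
        rewrite ?xD ?yD b0 ?oppr0 scale0r.
    have := schur D v u (@scal_comm a) v0 vW vD uW.
    by rewrite mulmxBr mul_mx_scalar => /eqP; rewrite subr_eq0 => /eqP.
  (* When b is nonzero: as W has dimension at least 3, it has a nonzero u orthogonal to t and t D.
     Since D is symmetric for g, both u and u D are orthogonal to t, so neither is timelike, yet g(u
     D, u D) = - b^2 g(u,u). *)
  pose Q := (t + t *m D)%MS.
  have rQ : (\rank Q < \rank W)%N.
    apply: leq_trans rW; apply: leq_ltn_trans (mxrank_adds_leqif _ _) _.
    by apply: (@leq_add _ _ 1 1); exact: rank_leq_row.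
  have [u u0 [uW uQ]] := orth_vector_exists rQ.
  have ut : g t u = 0 by rewrite lformC uQ // addsmxSl.
  have uDt : g t (u *m D) = 0 by rewrite -D_adj lformC uQ // addsmxSr.
  have uu : 0 < g u u.
    by rewrite ltNge; apply: contra u0 => uu; apply/eqP/(timelike_orth tt ut uu).
  have uDuD : g (u *m D) (u *m D) = - b ^+ 2 * g u u.
    by rewrite D_adj DD // lformZr.
  have b2 : 0 < b ^+ 2 by rewrite lt_neqAle sqr_ge0 eq_sym sqrf_eq0 b0.
  have uD0 : u *m D = 0 by apply: (timelike_orth tt uDt); rewrite uDuD; nra.
  by move: uDuD; rewrite uD0 lform0l; nra.
have a_ge0 : 0 <= a.
  have : a * g t t <= 0.
    rewrite -lformZl -aC // gC oppr_le0; apply: sumr_ge0 => i _.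
    apply: (causal_orth (ltW tt) t0 _).1.
    by rewrite lformC; apply: skew_diag; exact: h_skew.
  by rewrite nmulr_lle0.
have [X hX tX] := no_invariant_line t0 tW.
have [i0 Pf0] : exists i, P *m f i != 0.
  apply: contrapT => no; have := tX 0; rewrite scale0r => /eqP; apply.
  rewrite -[t](perp_proj_id Wd) // (fspan _ hX) -mulmxA mulmx_sumr.
  rewrite big1 ?mulmx0 // => i _; rewrite -scalemxAr.
  suff -> : P *m f i = 0 by rewrite scaler0.
  by apply: contrapT => /eqP ?; apply: no; exists i.
have PC : P *m C = a *: P.
  apply: mulmx_row_ext => u; rewrite mulmxA aC ?scalemxAr //.
  exact: perp_proj_sub.
have : \tr (P *m C) < 0.
  rewrite mulmx_sumr linear_sum /= (bigD1 i0) //= ltr_wnDr //.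
    apply: sumr_le0 => i _; rewrite (proj_mulmx Wd) //; last exact: h_stable.
      exact: (proj_trace_spec (hf i)).1.
    exact: h_skew.
  rewrite (proj_mulmx Wd) ?proj_trace_lt0 //; last exact: h_stable.
  exact: h_skew.
by rewrite PC mxtraceZ ltNge mulr_ge0 // proj_trace_ge0.
Qed.

End NoRealEigenvalue.

Lemma real_eigenvalue_exists : exists X p a,
  [/\ h X, (p <= W)%MS, p != 0, a != 0 & p *m X = a *: p].
Proof.
apply: contrapT => no; apply: no_real_eigenvalue_absurd => X p a hX pW p0 pX.
by apply: contrapT => /eqP a0; apply: no; exists X, p, a.
Qed.

(** Eigenvectors for nonzero eigenvalues of a skew operator are isotropic, and the spectrum is
    symmetric under a |-> - a because the adjoint of Y - a is - (Y + a). Eigenvectors for a and - a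
    are not proportional, so they pair nontrivially. *)
Lemma witt_eigen_pair_exists : exists X p q a,
  [/\ h X, (p <= W)%MS & (q <= W)%MS] /\
  [/\ g p p = 0, g q q = 0 & g p q = 1] /\
  [/\ a != 0, p *m X = a *: p & q *m X = - a *: q].
Proof.
have [X [p [a [hX pW p0 a0 pX]]]] := real_eigenvalue_exists.
have sX := h_skew hX.
have iso (x : V) c : c != 0 -> x *m X = c *: x -> g x x = 0.
  move=> c0 xX; have /eqP := skew_diag x sX.
  by rewrite xX lformZl mulf_eq0 (negbTE c0) => /eqP.
have pp := iso _ _ a0 pX.
(* P X agrees with X on W, and its eigenvectors for nonzero eigenvalues lie in W. *)
pose Y := P *m X; have sY : skew Y by apply: proj_skew => //; exact: h_stable.
have pY : p *m Y = a *: p by rewrite mulmxA perp_proj_id.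
have det0 : \det (Y + a%:M) == 0.
  have -> : Y + a%:M = - gadj (Y - a%:M).
    apply: (@lform_ext R n) => u v; rewrite mulmxN lformNl [g (u *m gadj _) v]lformC.
    rewrite -gadjP !mulmxBr mulmxDr !mul_mx_scalar !lformE.
    by rewrite (sY v u) (lformC v u) (lformC v (u *m Y)); ring.
  rewrite -scaleN1r detZ gadj.unlock !det_mulmx det_tr.
  have -> : \det (Y - a%:M) = 0.
    apply/eqP/det0P; exists p => //.
    by rewrite mulmxBr pY mul_mx_scalar subrr.
  by rewrite mulr0 mul0r mulr0.
have /det0P[z z0 zY] := det0.
have {}zY : z *m Y = - a *: z.
  by move: zY; rewrite mulmxDr mul_mx_scalar => /eqP; rewrite addr_eq0 scaleNr => /eqP.
have na0 : - a != 0 by rewrite oppr_eq0.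
have zW : (z <= W)%MS.
  have -> : z = (- a)^-1 *: (z *m Y) by rewrite zY scalerA mulVf // scale1r.
  by apply: scalemx_sub; rewrite mulmxA; apply: stable_sub => //; exact: perp_proj_sub.
have zX : z *m X = - a *: z by rewrite -zY mulmxA perp_proj_id.
have zz := iso _ _ na0 zX.
have pz : g p z != 0.
  apply/eqP => pz; have [c zc] := isotropic_orth p0 pp pz zz.
  move: zX; rewrite zc -scalemxAl pX => /eqP; rewrite -subr_eq0 !scalerA -scalerBl.
  rewrite scaler_eq0 (negbTE p0) orbF mulNr opprK mulrC -mulr2n mulrn_eq0 /=.
  by rewrite mulf_eq0 (negbTE a0) /= => /eqP c0; rewrite zc c0 scale0r eqxx in z0.
exists X, p, ((g p z)^-1 *: z), a; split; first by split=> //; exact: scalemx_sub.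
split; first by split=> //; rewrite !lformE ?zz ?mulr0 // mulVf.
by split=> //; rewrite -scalemxAl zX !scalerA mulrC.
Qed.

(* Let th be the reflection in p - q and X' = - th X th.  For the positive form *)
(* - tr (A th B th) the adjoint of ad X is ad X', and X, X' commute, so that    *)
(* ad X is normal and h is stable under ad X'.  Finally X + X' is a multiple of *)
(* wedge p q.                                                                   *)
Lemma boost_normalizes X p q a : h X -> g p p = 0 -> g q q = 0 -> g p q = 1 ->
  a != 0 -> p *m X = a *: p -> q *m X = - a *: q ->
  forall A, h A -> h (wedge p q * A - A * wedge p q).
Proof.
move=> hX pp qq pq a0 pX qX; have sX := h_skew hX.
pose w := p - q; set th := refl w.
have ww : g w w < 0 by rewrite /w !lformE (lformC q p) pp qq pq; lra.
have wn0 : g w w != 0 by rewrite lt_eqF.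
have ith : lisometry th by exact: refl_isometry.
have thth : th *m th = 1%:M by exact: refl_refl.
have pth : p *m th = q by apply: refl_swap => //; rewrite pp qq.
have qth : q *m th = p by rewrite -pth -mulmxA thth mulmx1.
pose D := - a *: wedge p q.
pose Z := X - D.
have sD : skew D by apply: skewZ; exact: wedge_skew.
have sZ : skew Z by apply: skewD => //; exact: skewN.
have pw : p *m wedge p q = - p by rewrite mul_wedge pp pq scale0r scale1r sub0r.
have qw : q *m wedge p q = q.
  by rewrite mul_wedge (lformC q p) qq pq scale0r scale1r subr0.
have pZ : p *m Z = 0.
  by rewrite mulmxBr pX -scalemxAr pw scalerN scaleNr opprK subrr.
have qZ : q *m Z = 0 by rewrite mulmxBr qX -scalemxAr qw subrr.
have wZ : w *m Z = 0 by rewrite mulmxBl pZ qZ subrr.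
have Zth : Z *m th = Z.
  by apply: mulmx_row_ext => u; rewrite mulmxA refl_orth // sZ wZ lform0r oppr0.
have thZ : th *m Z = Z.
  apply: mulmx_row_ext => u; rewrite mulmxA mul_refl mulmxBl -scalemxAl wZ.
  by rewrite scaler0 subr0.
have Dth : th *m D *m th = - D.
  have wth : th *m wedge p q *m th = - wedge p q.
    by rewrite -mulmxA wedge_conj // pth qth mulmxA thth mul1mx wedgeC.
  by rewrite /D -scalemxAr -scalemxAl wth scalerN.
have XDZ : X = D + Z by rewrite addrC subrK.
have DZ : D *m Z = Z *m D.
  rewrite -scalemxAl -scalemxAr; congr (_ *: _); apply/eqP; rewrite -subr_eq0.
  by rewrite !mulmxE wedge_lie // pZ qZ wedge0l wedge0r addr0.
pose X' := D - Z.
have X'E : X' = - (th *m X *m th).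
  by rewrite XDZ mulmxDr mulmxDl Dth thZ Zth opprD opprK.
have XX' : X *m X' = X' *m X.
  have comm A B : A *m B = B *m A -> (A + B) *m (A - B) = (A - B) *m (A + B).
    move=> AB; rewrite !(mulmxDl, mulmxDr, mulNmx, mulmxN) AB.
    move: (A *m A) (B *m A) (B *m B) => a1 a2 a3.
    by apply/matrixP => i j; rewrite !mxE; ring.
  by have := comm _ _ DZ; rewrite -XDZ.
have sX' : skew X' by apply: skewD => //; exact: skewN.
have trB A B : \tr (A - B) = \tr A - \tr B by exact: linearB.
have sub4 (a1 a2 a3 a4 : M) : a1 - a2 - (a3 - a4) = a1 - a3 - (a2 - a4).
  by apply/matrixP => i j; rewrite !mxE; ring.
have thX' : th *m X' = - (X *m th).
  by rewrite X'E mulmxN !mulmxA thth mul1mx.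
have X'th : X' *m th = - (th *m X).
  by rewrite X'E mulNmx -!mulmxA thth mulmx1.
have XpX' : X + X' = (- (2%:R * a)) *: wedge p q.
  by rewrite /X' XDZ addrACA subrr addr0 /D -scalerDl; congr (_ *: _); ring.
clearbody X'.
have hX' : forall A, h A -> h (X' *m A - A *m X').
  apply: (@normal_adjoint_stable R _ h [set A | skew A]
    (fun A B => - \tr (A *m th *m (B *m th))) (fun A => X *m A - A *m X)
    (fun A => X' *m A - A *m X')) => //=.
  - exact: Lie_mem0.
  - by move=> c A B; exact: Lie_mem_lin.
  - by move=> c A B sA sB; apply: skewD => //; exact: skewZ.
  - move=> c A B C; rewrite !mulmxDl -!scalemxAl mxtraceD mxtraceZ; ring.
  - by move=> A B; rewrite mxtrace_mulC.
  - by move=> A sA A0; exact: cartan_form_gt0.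
  - move=> c A B.
    by rewrite mulmxDr mulmxDl -scalemxAr -scalemxAl opprD addrACA -scalerBr.
  - move=> A B; congr (- _); rewrite mulmxBl mulmxBl trB.
    have -> : A *m th *m ((X' *m B - B *m X') *m th) =
        A *m th *m B *m th *m X - A *m X *m (th *m B *m th).
      rewrite mulmxBl mulmxBr !mulmxA -[A *m th *m X']mulmxA thX'.
      rewrite -[_ *m X' *m th]mulmxA X'th !(mulmxN, mulNmx) opprK !mulmxA addrC.
      by [].
    by rewrite trB !mulmxA -!mulmxA mxtrace_mulC -!mulmxA.
  - move=> A; rewrite !mulmxBr !mulmxBl sub4 !mulmxA XX'.
    by rewrite -[A *m X' *m X]mulmxA -XX' mulmxA.
  - by move=> A hA; exact: Lie_mem_bracket.
  - by move=> A sA; exact: skew_lie.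
move=> A hA; have h1 := hX' A hA; have h2 := Lie_mem_bracket hX hA.
have -> : wedge p q * A - A * wedge p q =
    (- (2%:R * a))^-1 *: ((X *m A - A *m X) + (X' *m A - A *m X')).
  have -> : (X *m A - A *m X) + (X' *m A - A *m X') =
      (X + X') *m A - A *m (X + X').
    rewrite mulmxDl mulmxDr; apply/matrixP => i j.
    by rewrite ![in LHS]mxE ![in RHS]mxE; ring.
  rewrite XpX' -scalemxAl -scalemxAr -scalerBr scalerA mulVf ?scale1r //.
  by rewrite oppr_eq0 mulf_neq0 // pnatr_eq0.
by apply: Lie_memZ; exact: Lie_memD.
Qed.

(** The bracket with [wedge p q] has eigenvalues -1, 0, 1 on so(V). One bracket with A gives the sum
    of its two nonzero root components, a second one their difference up to sign, and both are in
    h. *)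
Lemma root_components p q A : g p p = 0 -> g q q = 0 -> g p q = 1 ->
  (forall B, h B -> h (wedge p q * B - B * wedge p q)) -> h A ->
  h (wedge (p *m A - g (p *m A) q *: p) q) /\
  h (wedge p (q *m A - g (q *m A) p *: q)).
Proof.
move=> pp qq pq hb hA; have sA := h_skew hA.
have hB1 := hb _ hA; have := Lie_memN (hb _ hB1); rewrite opprB.
move: hB1; rewrite (wedge_lie _ _ sA) => hB1.
have pb : p *m wedge p q = - p by rewrite mul_wedge pp pq scale0r scale1r sub0r.
have qb : q *m wedge p q = q.
  by rewrite mul_wedge (lformC q p) qq pq scale0r scale1r subr0.
pose al := g (p *m A) q.
have beE : g (q *m A) p = - al by rewrite sA lformC.
have pAb : p *m A *m wedge p q = - al *: p.
  by rewrite mul_wedge (skew_diag _ sA) scale0r sub0r scaleNr.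
have qAb : q *m A *m wedge p q = - al *: q.
  by rewrite mul_wedge (skew_diag _ sA) scale0r subr0 beE.
rewrite mulrDl mulrDr opprD addrACA !wedge_lie; try exact: wedge_skew.
rewrite pAb qAb pb qb wedgeZl wedgeZr -/al beE.
rewrite -[- p]scaleN1r wedgeZl !(scaleNr, scale1r) => hC1.
have two0 : 2%:R != 0 :> R by rewrite pnatr_eq0.
rewrite wedgeDl wedgeDr -!scaleNr wedgeZl wedgeZr opprK.
move: hB1 hC1; move: (wedge (p *m A) q) (wedge p (q *m A)) (wedge p q) => x y z.
move=> hB1 hC1; split.
  have -> : x + - al *: z = 2%:R^-1 *: (x + y + (- (al *: z) + x + (- y - al *: z))).
    by apply/matrixP => i j; rewrite !mxE; field.
  by apply: Lie_memZ; exact: Lie_memD.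
have -> : y + al *: z = 2%:R^-1 *: (x + y - (- (al *: z) + x + (- y - al *: z))).
  by apply/matrixP => i j; rewrite !mxE; field.
by apply: Lie_memZ; exact: Lie_memB.
Qed.

Lemma wedge_bracket p q x y : g p p = 0 -> g q q = 0 -> g p q = 1 ->
  wedge p x * wedge q y - wedge q y * wedge p x =
  wedge y x - g p y *: wedge q x + g x q *: wedge p y - g x y *: wedge p q.
Proof.
move=> pp qq pq; rewrite wedge_lie; last exact: wedge_skew.
rewrite !mul_wedge pq scale1r wedgeDl wedgeDr -!scaleNr !wedgeZl !wedgeZr.
by rewrite !scaleNr !addrA.
Qed.

(** The bracket of [[wedge p x], [wedge q y]] with [wedge p x] is g(x,x) [wedge p y] plus a multiple
    of [wedge p x], and g(x,x) is invertible. *)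
Lemma opposite_root_swap p q x y : g p p = 0 -> g q q = 0 -> g p q = 1 ->
  g p x = 0 -> g q x = 0 -> g p y = 0 -> g q y = 0 -> 0 < g x x ->
  h (wedge p x) -> h (wedge q y) -> h (wedge p y).
Proof.
move=> pp qq pq px qx py qy xx hpx hqy.
have := Lie_mem_bracket hpx hqy; rewrite wedge_bracket // py (lformC x q) qx.
rewrite !scale0r subr0 addr0 => hS.
have := Lie_mem_bracket hS hpx.
have bil (A B C : M) c : (A - c *: B) * C - C * (A - c *: B) =
    (A * C - C * A) - c *: (B * C - C * B).
  rewrite mulrBl mulrBr -scalerAl -scalerAr.
  move: (A * C) (C * A) (B * C) (C * B) => a1 a2 a3 a4.
  by apply/matrixP => i j; rewrite !mxE; ring.
rewrite bil.
have -> : wedge y x * wedge p x - wedge p x * wedge y x =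
    - g x y *: wedge p x + g x x *: wedge p y.
  rewrite wedge_lie; last exact: wedge_skew.
  rewrite !mul_wedge !(lformC _ p) !(lformC y) px py !scale0r !sub0r.
  by rewrite -!scaleNr wedgeZl wedgeZr [wedge y p]wedgeC scalerN !scaleNr opprK.
have -> : wedge p q * wedge p x - wedge p x * wedge p q = wedge p x.
  rewrite wedge_lie; last exact: wedge_skew.
  rewrite !mul_wedge pp px (lformC q p) pq qx !scale0r !scale1r !subr0.
  by rewrite wedge0l add0r.
move=> hT.
have -> : wedge p y = (g x x)^-1 *: ((2%:R * g x y) *: wedge p x +
    (- g x y *: wedge p x + g x x *: wedge p y + - (g x y *: wedge p x))).
  move: (wedge p x) (wedge p y) => a1 a2; apply/matrixP => i j.
  by rewrite !mxE; field; rewrite gt_eqF.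
by apply: Lie_memZ; apply: Lie_mem_lin.
Qed.

(** The vectors z of W with both [wedge p z] and [wedge q z] in h form a subspace T containing p and
    q. Opposite roots can be exchanged, so the root components of any element of h lie in T; this
    makes T stable, hence equal to W. Brackets of [wedge p z] and [wedge q z'] then give all
    wedges. *)
Theorem irreducible_wedge x y : (x <= W)%MS -> (y <= W)%MS -> h (wedge x y).
Proof.
have [X [p [q [a [[hX pW qW] [[pp qq pq] [a0 pX qX]]]]]]] := witt_eigen_pair_exists.
have hb := boost_normalizes hX pp qq pq a0 pX qX.
have qp : g q p = 1 by rewrite lformC.
have p0 : p != 0.
  by apply/eqP => p0; have := pq; rewrite p0 lform0l => /esym/eqP; rewrite oner_eq0.
have q0 : q != 0.
  by apply/eqP => q0; have := pq; rewrite q0 lform0r => /esym/eqP; rewrite oner_eq0.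
have ww : g (p - q) (p - q) < 0 by rewrite !lformE qp pp qq pq; lra.
have pos z : g p z = 0 -> g q z = 0 -> z != 0 -> 0 < g z z.
  move=> pz qz z0; rewrite ltNge; apply: contra z0 => zz; apply/eqP.
  by apply: (timelike_orth ww _ zz); rewrite !lformE pz qz subrr.
pose v A := p *m A - g (p *m A) q *: p.
pose u A := q *m A - g (q *m A) p *: q.
have vE A : h A -> [/\ (v A <= W)%MS, g p (v A) = 0, g q (v A) = 0 &
    h (wedge q (v A))].
  move=> hA; split.
  - by rewrite addmx_sub ?eqmx_opp ?scalemx_sub // stable_sub.
  - by rewrite !lformE pp (lformC p) (skew_diag _ (h_skew hA)); ring.
  - by rewrite !lformE qp (lformC q); ring.
  - by rewrite wedgeC; apply: Lie_memN; exact: (root_components pp qq pq hb hA).1.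
have uE A : h A -> [/\ (u A <= W)%MS, g p (u A) = 0, g q (u A) = 0 &
    h (wedge p (u A))].
  move=> hA; split.
  - by rewrite addmx_sub ?eqmx_opp ?scalemx_sub // stable_sub.
  - by rewrite !lformE pq (lformC p); ring.
  - by rewrite !lformE qq (lformC q) (skew_diag _ (h_skew hA)); ring.
  - exact: (root_components pp qq pq hb hA).2.
have [A hA vA0] : exists2 A, h A & v A != 0.
  have [A hA pA] := no_invariant_line p0 pW; exists A => //.
  by rewrite subr_eq0 pA.
have [B hB' uB0] : exists2 B, h B & u B != 0.
  have [B hB' qB] := no_invariant_line q0 qW; exists B => //.
  by rewrite subr_eq0 qB.
have [vW pv qv hqv] := vE A hA; have [uW pu qu hpu] := uE B hB'.
have q_to_p z : g p z = 0 -> g q z = 0 -> h (wedge q z) -> h (wedge p z).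
  move=> pz qz hqz.
  by apply: (opposite_root_swap pp qq pq pu qu pz qz (pos _ pu qu uB0) hpu hqz).
have p_to_q z : g p z = 0 -> g q z = 0 -> h (wedge p z) -> h (wedge q z).
  move=> pz qz hpz.
  by apply: (opposite_root_swap qq pp qp qv pv qz pz (pos _ pv qv vA0) hqv hpz).
(* The bracket of [wedge p u] and [wedge q u] is - g(u,u) [wedge p q]. *)
have hpq : h (wedge p q).
  have := Lie_mem_bracket hpu (p_to_q _ pu qu hpu); rewrite wedge_bracket // wedge_xx pu.
  rewrite (lformC _ q) qu !scale0r subrr add0r sub0r => /Lie_memN; rewrite opprK.
  have uu := pos _ pu qu uB0.
  by move=> /(Lie_memZ (g (u B) (u B))^-1); rewrite scalerA mulVf ?scale1r // gt_eqF.
pose T := [set z : V | [/\ (z <= W)%MS, h (wedge p z) & h (wedge q z)]].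
have T_wedge z z' : T z -> T z' -> h (wedge z z').
  move=> [_ hpz' hqz'] [_ hpz hqz]; have := Lie_mem_bracket hpz hqz'.
  rewrite wedge_bracket // => hS.
  have -> : wedge z z' = (wedge z z' - g p z *: wedge q z' + g z' q *: wedge p z -
      g z' z *: wedge p q) + g p z *: wedge q z' - g z' q *: wedge p z +
      g z' z *: wedge p q.
    move: (wedge _ _) (wedge _ _) (wedge _ _) (wedge _ _) => a1 a2 a3 a4.
    by apply/matrixP => i j; rewrite !mxE; ring.
  by apply: Lie_memD; [apply: Lie_memB; [apply: Lie_memD => //|]|]; exact: Lie_memZ.
have T0 : T 0 by split; rewrite ?sub0mx ?wedge0r //; exact: Lie_mem0.
have Tlin c z z' : T z -> T z' -> T (c *: z + z').
  move=> [zW hpz hqz] [zW' hpz' hqz']; split.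
  - by rewrite addmx_sub // scalemx_sub.
  - by rewrite wedgeDr wedgeZr; exact: Lie_mem_lin.
  - by rewrite wedgeDr wedgeZr; exact: Lie_mem_lin.
have [S ST] := linset_mx T0 Tlin.
have Tp : T p by split; rewrite ?wedge_xx ?[wedge q p]wedgeC //; [exact: Lie_mem0|exact: Lie_memN].
have Tq : T q by split; rewrite ?wedge_xx //; exact: Lie_mem0.
have SW : (S <= W)%MS.
  by apply/row_subP => i; have /ST[] := row_sub i S.
have S_inv C : h C -> stablemx S C.
  move=> hC; apply/row_subP => i; rewrite row_mul; apply/ST.
  have /ST Tz := row_sub i S; move: (row i S) Tz => z Tz.
  have [zW hpz hqz] := Tz.
  have Tv : T (v C).
    by have [? ? ? ?] := vE C hC; split=> //; exact: q_to_p.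
  have Tu : T (u C).
    by have [? ? ? ?] := uE C hC; split=> //; exact: p_to_q.
  have sC := h_skew hC; split; first exact: stable_sub.
    have := Lie_mem_bracket hpz hC; rewrite wedge_lie // => hS.
    have -> : wedge p (z *m C) = wedge (p *m C) z + wedge p (z *m C) -
        wedge (g (p *m C) q *: p + v C) z by rewrite subrKC addrC addKr.
    by apply: Lie_memB => //; apply: T_wedge => //; exact: Tlin.
  have := Lie_mem_bracket hqz hC; rewrite wedge_lie // => hS.
  have -> : wedge q (z *m C) = wedge (q *m C) z + wedge q (z *m C) -
      wedge (g (q *m C) p *: q + u C) z by rewrite subrKC addrC addKr.
  by apply: Lie_memB => //; apply: T_wedge => //; exact: Tlin.
case: (irr SW S_inv) => [S00|WS].
  by have /ST := Tp; rewrite S00 submx0 (negbTE p0).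
by move=> xW yW; apply: T_wedge; apply/ST; exact: submx_trans WS.
Qed.

End IrreducibleLieAlgebra.

(** * Generation of SO0 by exponentials *)

Section ExpProducts.
Variables (R : realType) (N : nat).
Local Notation M := 'M[R]_N.+1.
Implicit Types (A B X Y : M) (k : set M).

Definition expprod k : set M :=
  [set A | exists s : seq M, (forall X, X \in s -> k X) /\
    A = \prod_(X <- s) expmx X].

Lemma expprod1 k : expprod k 1.
Proof. by exists [::]; split=> //; rewrite big_nil. Qed.

Lemma expprodM k A B : expprod k A -> expprod k B -> expprod k (A * B).
Proof.
move=> [s [sk ->]] [s' [sk' ->]]; exists (s ++ s'); split; last by rewrite big_cat.
by move=> X; rewrite mem_cat => /orP[/sk|/sk'].
Qed.

Lemma expprod_exp k X : k X -> expprod k (expmx X).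
Proof.
by move=> kX; exists [:: X]; split; [move=> Y; rewrite inE => /eqP ->|rewrite big_seq1].
Qed.

Lemma expmxNl X : expmx (- X) * expmx X = 1.
Proof.
rewrite -expmxD ?addNr ?expmx0 //.
by rewrite /GRing.comm mulrN mulNr.
Qed.

Lemma expmx_unit X : expmx X \is a GRing.unit.
Proof.
apply/unitrP; exists (expmx (- X)); rewrite expmxNl; split=> //.
by rewrite -{1}[X]opprK expmxNl.
Qed.

Lemma expmx_inv X : (expmx X)^-1 = expmx (- X).
Proof. by apply: (mulIr (expmx_unit X)); rewrite expmxNl mulVr // expmx_unit. Qed.

Lemma expprod_ind k (P : set M) : P 1 ->
  (forall X A, k X -> P A -> P (expmx X * A)) -> expprod k `<=` P.
Proof.
move=> P1 PM A [s [sk ->]]; elim: s sk => [|X s IHs] sk; first by rewrite big_nil.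
rewrite big_cons; apply: PM; first by apply: sk; rewrite mem_head.
by apply: IHs => Y Ys; apply: sk; rewrite inE Ys orbT.
Qed.

Lemma subgroup_expprod k : (forall X, k X -> k (- X)) -> subgroup (expprod k).
Proof.
move=> kN; have unit A : expprod k A -> A \is a GRing.unit.
  by move: A; apply: expprod_ind => [|X A _ uA] /=; rewrite ?unitr1 ?unitrMl ?expmx_unit.
split=> //; [exact: expprod1|exact: expprodM|].
move=> A kA; suff [] : (expprod k `&` [set A | expprod k A^-1]) A by [].
move: A kA; apply: expprod_ind => [|X A kX [kA kA']] /=.
  by split; rewrite /= ?invr1; exact: expprod1.
split; first by apply: expprodM => //; exact: expprod_exp.
rewrite /= invrM ?expmx_unit //; last exact: unit.
by apply: expprodM => //; rewrite expmx_inv; apply/expprod_exp/kN.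
Qed.

End ExpProducts.

(** * Products of reflections and null rotations *)

Section ReflectionProducts.
Variables (R : realType) (n : nat).
Local Notation V := 'rV[R]_n.+2.
Local Notation M := 'M[R]_n.+2.
Local Notation g := (@lform R n).
Implicit Types (t u v w x y z : V) (A B X Y S W : M) (a b c : R) (s : seq V).

Lemma mul_wedge_sqr v z u : g z z = 0 -> g u z = 0 ->
  v *m wedge z u *m wedge z u = - (g u u * g v z) *: z.
Proof.
move=> zz uz; rewrite !mul_wedge !lformE uz zz (lformC z u) uz.
by apply/rowP => j; rewrite !mxE; ring.
Qed.

(** The cube of [wedge z u] is 0, so the exponential is quadratic: this is a null rotation. *)
Lemma mul_expmx_wedge v z u : g z z = 0 -> g u z = 0 ->
  v *m expmx (wedge z u) =
  v + g v z *: u - g v u *: z - (g u u * g v z / 2%:R) *: z.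
Proof.
move=> zz uz; have X3 : wedge z u ^+ 3 = 0.
  apply: mulmx_row_ext => w; rewrite mulmx0 !exprS expr0 mulr1 -!mulmxE !mulmxA.
  by rewrite mul_wedge_sqr // mul_wedge !lformE zz uz !mulr0 subrr mulr0 oppr0 scale0r.
rewrite expmx_nilp3 // !mulmxDr mulmx1 -scalemxAr expr2 -mulmxE mulmxA.
rewrite mul_wedge_sqr // mul_wedge.
by apply/rowP => j; rewrite !mxE; field.
Qed.

Lemma refl_scale a w : a != 0 -> refl (a *: w) = refl w.
Proof.
move=> a0; apply: mulmx_row_ext => v; rewrite !mul_refl !lformE scalerA.
case: (eqVneq (g w w) 0) => [->|ww]; first by rewrite !mulr0 invr0 !mulr0 mul0r.
by congr (_ - _ *: _); field; rewrite ww a0.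
Qed.

(** Here v - u is isotropic and orthogonal to u, so the two reflections compose to a null rotation.
    This writes products of reflections as exponentials without angles or rapidities. *)
Lemma refl_refl_parabolic u v : g u u = 1 -> g v v = 1 -> g u v = 1 ->
  refl u *m refl v = expmx (wedge (v - u) (- 2%:R *: u)).
Proof.
move=> uu vv uv; apply: mulmx_row_ext => w; rewrite mulmxA mul_expmx_wedge.
- rewrite !mul_refl !lformE uu vv uv.
  by apply/rowP => j; rewrite !mxE; field.
- by rewrite !lformE uu vv (lformC v u) uv; ring.
- by rewrite !lformE uu uv; ring.
Qed.

(** For unit x, y a unit vector w with g(x,w) = g(w,y) = 1 is inserted, so that refl x refl y =
    (refl x refl w)(refl w refl y) is a product of two null rotations. It is sought as w = (x +
    y)/(1 + g(x,y)) + la s with s orthogonal to x and y. Scaling and a change of sign, harmless for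
    reflections, reduce to unit vectors with g(x,y) >= 0. *)
Lemma refl_refl_expprod W t (k : set M) u v : (t <= W)%MS -> g t t < 0 ->
  (3 <= \rank W)%N ->
  (forall x y, (x <= W)%MS -> (y <= W)%MS -> k (wedge x y)) ->
  (u <= W)%MS -> (v <= W)%MS -> 0 < g u u -> 0 < g v v ->
  expprod k (refl u *m refl v).
Proof.
move=> tW tt rW kW.
have par x y : (x <= W)%MS -> (y <= W)%MS -> g x x = 1 -> g y y = 1 -> g x y = 1 ->
    expprod k (refl x *m refl y).
  move=> xW yW xx yy xy; rewrite refl_refl_parabolic //; apply/expprod_exp/kW.
    by rewrite addmx_sub // eqmx_opp.
  exact: scalemx_sub.
have unit x y : (x <= W)%MS -> (y <= W)%MS -> g x x = 1 -> g y y = 1 ->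
    0 <= g x y -> expprod k (refl x *m refl y).
  move=> xW yW xx yy c0; case: (eqVneq (g x y) 1) => [xy|c1]; first exact: par.
  (* The norm of w is 1 for some real la only if g(s,s) has the sign of g(x,y) - 1. Below 1, x and y
     span a positive definite plane and s is the component of t orthogonal to it, which is timelike;
     above 1, x - y is timelike and any s orthogonal to it is spacelike. *)
  have [s [sW sx sy ss]] : exists s : V, [/\ (s <= W)%MS, g s x = 0, g s y = 0 &
      0 < (g x y - 1) * g s s].
    case: (ltrP (g x y) 1) => [cl|cg].
      have d0 : 0 < 1 - g x y ^+ 2 by nra.
      pose al := (g t x - g x y * g t y) / (1 - g x y ^+ 2).
      pose be := (g t y - g x y * g t x) / (1 - g x y ^+ 2).
      have sx : g (t - al *: x - be *: y) x = 0.
        by rewrite !lformE xx (lformC y x) /al /be; field; rewrite gt_eqF.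
      have sy : g (t - al *: x - be *: y) y = 0.
        by rewrite !lformE yy /al /be; field; rewrite gt_eqF.
      exists (t - al *: x - be *: y); split=> //.
        by rewrite !addmx_sub ?eqmx_opp ?scalemx_sub.
      have -> : g (t - al *: x - be *: y) (t - al *: x - be *: y) =
          g (t - al *: x - be *: y) t.
        by rewrite lformDr lformNr lformZr sy lformDr lformNr lformZr sx; ring.
      rewrite nmulr_rgt0; last by rewrite subr_lt0.
      have -> : g (t - al *: x - be *: y) t = g t t -
          ((g t x - g x y * g t y) ^+ 2 / (1 - g x y ^+ 2) + g t y ^+ 2).
        rewrite !lformE (lformC x t) (lformC y t) /al /be; field.
        by rewrite gt_eqF.
      rewrite subr_lt0; apply: lt_le_trans tt _.
      by rewrite addr_ge0 ?sqr_ge0 // divr_ge0 ?sqr_ge0 // ltW.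
    have {}cg : 1 < g x y by rewrite lt_neqAle eq_sym c1.
    have rxy : (\rank (x + y)%MS < \rank W)%N.
      apply: leq_trans rW; apply: leq_ltn_trans (mxrank_adds_leqif _ _) _.
      by apply: (@leq_add _ _ 1 1); exact: rank_leq_row.
    have [s s0 [sW sxy]] := orth_vector_exists rxy.
    have sx : g s x = 0 by rewrite sxy // addsmxSl.
    have sy : g s y = 0 by rewrite sxy // addsmxSr.
    exists s; split=> //; rewrite mulr_gt0 ?subr_gt0 // ltNge; apply: contra s0 => ss.
    apply/eqP; apply: (@timelike_orth R n (x - y)) => //.
      by rewrite !lformE xx yy (lformC y x); lra.
    by rewrite lformC !lformE sx sy subrr.
  have c1p : 0 < 1 + g x y by lra.
  have s0 : g s s != 0 by apply: contraTneq ss => ->; rewrite mulr0 ltxx.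
  pose la := Num.sqrt ((g x y - 1) / ((1 + g x y) * g s s)).
  have la2 : la ^+ 2 * g s s = (g x y - 1) / (1 + g x y).
    rewrite sqr_sqrtr; first by field; rewrite s0 gt_eqF.
    have -> : (g x y - 1) / ((1 + g x y) * g s s) =
        ((g x y - 1) * g s s) / ((1 + g x y) * g s s ^+ 2).
      by field; rewrite s0 gt_eqF.
    apply: divr_ge0; first exact: ltW.
    by apply: mulr_ge0; [exact: ltW|exact: sqr_ge0].
  pose w := (1 + g x y)^-1 *: (x + y) + la *: s.
  have wW : (w <= W)%MS by rewrite addmx_sub ?scalemx_sub // addmx_sub.
  have xw : g x w = 1.
    by rewrite /w !lformE xx (lformC x s) sx; field; rewrite gt_eqF.
  have wy : g w y = 1.
    by rewrite /w !lformE yy sy; field; rewrite gt_eqF.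
  have ww : g w w = 1.
    have -> : g w w = (1 + g x y)^-1 * (g x w + g w y) + la ^+ 2 * g s s.
      rewrite /w !lformE (lformC x s) (lformC y s) (lformC y x) sx sy; ring.
    by rewrite xw wy la2; field; rewrite gt_eqF.
  have -> : refl x *m refl y = (refl x *m refl w) * (refl w *m refl y).
    by rewrite -mulmxE !mulmxA -[_ *m refl w *m refl w]mulmxA refl_refl
      ?ww ?oner_eq0 // mulmx1.
  by apply: expprodM; exact: par.
move=> uW vW uu vv.
have norm x : 0 < g x x -> exists2 a, a != 0 & g (a *: x) (a *: x) = 1.
  move=> xx; exists (Num.sqrt (g x x))^-1.
    by rewrite invr_eq0 gt_eqF // sqrtr_gt0.
  rewrite !lformE mulrA -expr2 exprVn sqr_sqrtr ?mulVf //; first by rewrite gt_eqF.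
  exact: ltW.
have [a a0 aa] := norm u uu; have [b b0 bb] := norm v vv.
rewrite -(refl_scale u a0) -(refl_scale v b0).
case: (lerP 0 (g (a *: u) (b *: v))) => c0; first by apply: unit; rewrite ?scalemx_sub.
rewrite -(@refl_scale (-1) (b *: v)) ?oppr_eq0 ?oner_eq0 // scaleN1r.
apply: unit; rewrite ?eqmx_opp ?scalemx_sub ?lformNr ?lformNl ?opprK //.
by rewrite oppr_ge0 ltW.
Qed.

Lemma prod_refl_expprod W t (k : set M) s : (t <= W)%MS -> g t t < 0 ->
  (3 <= \rank W)%N ->
  (forall x y, (x <= W)%MS -> (y <= W)%MS -> k (wedge x y)) ->
  (forall w, w \in s -> (w <= W)%MS /\ 0 < g w w) -> ~~ odd (size s) ->
  expprod k (\prod_(w <- s) refl w).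
Proof.
move=> tW tt rW kW; have [m] := ubnP (size s).
elim: m s => // m IHm [|u [|v s]] //= sm sW ev; first by rewrite big_nil; exact: expprod1.
rewrite !big_cons mulrA; apply: expprodM.
  have [uW uu] := sW u (mem_head _ _).
  have [vW vv] : (v <= W)%MS /\ 0 < g v v by apply: sW; rewrite !inE eqxx orbT.
  by rewrite -mulmxE; apply: (refl_refl_expprod tW).
apply: IHm; [by rewrite ltnW|move=> w ws|by rewrite negbK in ev].
by apply: sW; rewrite !inE ws !orbT.
Qed.

Lemma det_prod_refl s : (forall w, w \in s -> 0 < g w w) ->
  \det (\prod_(w <- s) refl w) = (-1) ^+ size s.
Proof.
elim: s => [|w s IHs] sp; first by rewrite big_nil det1.
rewrite big_cons -mulmxE det_mulmx det_refl ?gt_eqF ?sp ?mem_head //.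
by rewrite IHs ?exprS // => v vs; apply: sp; rewrite inE vs orbT.
Qed.

(* The Cartan-Dieudonne argument: if u = x A - x, then A refl u fixes x and     *)
(* what A fixes, which lowers the rank of A - 1.                                *)
Lemma isometry_prod_refl S A : (forall x, (x <= S)%MS -> x != 0 -> 0 < g x x) ->
  lisometry A -> (A - 1%:M <= S)%MS ->
  exists s, (forall w, w \in s -> (w <= S)%MS /\ 0 < g w w) /\
    A = \prod_(w <- s) refl w.
Proof.
move=> Spos; have [m] := ubnP (\rank (A - 1%:M)).
elim: m A => // m IHm A rA iA AS.
case: (eqVneq (A - 1%:M) 0) => [A1|].
  by exists [::]; split=> //; rewrite big_nil; apply/eqP; rewrite -subr_eq0 A1.
move=> /rowV0Pn[u /submxP[x ux] u0].
have uE : u = x *m A - x by rewrite ux mulmxBr mulmx1.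
have uS : (u <= S)%MS by rewrite ux; apply: submx_trans AS; exact: submxMl.
have uu := Spos u uS u0.
have un0 : g u u != 0 by rewrite gt_eqF.
pose B := A *m refl u.
have xB : x *m B = x by rewrite mulmxA uE refl_swap // -?uE // iA.
have iB : lisometry B by apply: lisometryM => //; exact: refl_isometry.
have fixB y : y *m A = y -> y *m B = y.
  move=> yA; rewrite mulmxA yA refl_orth // uE lformDr lformNr -{1}yA iA.
  by rewrite subrr.
have BS : (B - 1%:M <= S)%MS.
  apply/row_subP => i; rewrite rowE mulmxBr mulmx1 mulmxA mul_refl addrAC.
  rewrite addmx_sub // ?eqmx_opp ?scalemx_sub //.
  by rewrite -[X in _ - X]mulmx1 -mulmxBr; apply: submx_trans AS; exact: submxMl.
have rB : (\rank (B - 1%:M)%R < \rank (A - 1%:M)%R)%N.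
  have kk : (kermx (A - 1%:M)%R < kermx (B - 1%:M)%R)%MS.
    rewrite /ltmx; apply/andP; split.
      apply/row_subP => i; apply/sub_kermxP; rewrite mulmxBr mulmx1.
      have /sub_kermxP := row_sub i (kermx (A - 1%:M)).
      rewrite mulmxBr mulmx1 => /eqP; rewrite subr_eq0 => /eqP rA1.
      by rewrite fixB // subrr.
    apply/negP => kBA; have : (x <= kermx (B - 1%:M)%R)%MS.
      by apply/sub_kermxP; rewrite mulmxBr mulmx1 xB subrr.
    move=> /submx_trans/(_ kBA)/sub_kermxP; rewrite -ux => u00.
    by rewrite u00 eqxx in u0.
  have := rank_ltmx kk; rewrite !mxrank_ker => lt; rewrite ltnNge; apply/negP.
  by move=> /(leq_sub2l n.+2); rewrite leqNgt lt.
have [s [sS Bs]] := IHm B (leq_trans rB rA) iB BS.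
exists (rcons s u); split.
  by move=> w; rewrite mem_rcons inE => /orP[/eqP ->|/sS].
by rewrite -cats1 big_cat big_seq1 /= -Bs -mulmxE -mulmxA refl_refl // mulmx1.
Qed.

End ReflectionProducts.

(** * The group SO(W) and its identity component *)

Section SpecialOrthogonal.
Variables (R : realType) (n : nat) (W : 'M[R]_n.+2).
Local Notation V := 'rV[R]_n.+2.
Local Notation M := 'M[R]_n.+2.
Local Notation g := (@lform R n).
Implicit Types (t u v w x y z : V) (A B X Y S : M) (a b c : R) (k : set M).

Lemma SO1 : SO W (1 : M).
Proof. by split; [exact: SOV1|rewrite !mulmx1]. Qed.

Lemma SOM A B : SO W A -> SO W B -> SO W (A * B).
Proof.
move=> [sA [WA PA]] [sB [WB PB]]; split; first exact: SOV_mul.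
rewrite -mulmxE !mulmxA PA PB; split=> //.
by apply: submx_trans WB; exact: submxMr.
Qed.

Lemma SO_perp_fix A x : SO W A -> (x <= perp W)%MS -> x *m A = x.
Proof. by move=> [_ [_ PA]] /submxP[D ->]; rewrite -mulmxA PA. Qed.

Lemma refl_refl_SO u v : (u <= W)%MS -> (v <= W)%MS -> g u u != 0 ->
  g v v != 0 -> SO W (refl u *m refl v).
Proof.
move=> uW vW uu vv; split; first exact: SOV_refl_refl.
have stab w : (w <= W)%MS -> stablemx W (refl w).
  move=> wW; apply/row_subP => i; rewrite row_mul mul_refl.
  by rewrite addmx_sub ?row_sub // eqmx_opp scalemx_sub.
have fix_ w : (w <= W)%MS -> perp W *m refl w = perp W.
  move=> wW; apply/row_matrixP => i; rewrite row_mul refl_orth //.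
  by have /perpP := row_sub i (perp W); apply.
rewrite !mulmxA !fix_ //; split=> //.
by apply: submx_trans (stab v vW); apply: submxMr; exact: stab.
Qed.

(** The converse use of [refl_refl_parabolic]: u1 is u normalised, and z1 is scaled so that the two
    reflections compose to the given null rotation. *)
Lemma parabolic_SO z u : (z <= W)%MS -> (u <= W)%MS -> g z z = 0 ->
  g u z = 0 -> 0 < g u u -> SO W (expmx (wedge z u)).
Proof.
move=> zW uW zz uz uu; pose r := Num.sqrt (g u u).
have r0 : r != 0 by rewrite gt_eqF // sqrtr_gt0.
have rr : r ^+ 2 = g u u by rewrite sqr_sqrtr // ltW.
pose u1 := r^-1 *: u; pose z1 := - (r / 2%:R) *: z.
have u1u1 : g u1 u1 = 1 by rewrite /u1 !lformE -rr; field.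
have v1v1 : g (u1 + z1) (u1 + z1) = 1.
  by rewrite lformDl !lformDr u1u1 /z1 /u1 !lformE zz (lformC z u) uz; ring.
have u1v1 : g u1 (u1 + z1) = 1 by rewrite lformDr u1u1 /z1 /u1 !lformE uz; ring.
have -> : wedge z u = wedge (u1 + z1 - u1) (- 2%:R *: u1).
  rewrite [u1 + z1]addrC addrK /z1 /u1 wedgeZl !wedgeZr !scalerA.
  by rewrite -[LHS]scale1r; congr (_ *: _); field.
have u1W : (u1 <= W)%MS by exact: scalemx_sub.
rewrite -refl_refl_parabolic //; apply: refl_refl_SO; rewrite ?u1u1 ?v1v1 ?oner_eq0 //.
by rewrite addmx_sub // scalemx_sub.
Qed.

(** Multiplying all exponents by r, for r from 0 to 1, gives a path in SO(W) from 1 to the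
    product. *)
Lemma expprod_SO0 k : (forall X (r : R), k X -> SO W (expmx (r *: X))) ->
  expprod k `<=` SO0 W.
Proof.
move=> kSO A [s [sk ->]]; pose f (r : R) : M := \prod_(X <- s) expmx (r *: X).
have -> : \prod_(X <- s) expmx X = f 1 by apply: eq_bigr => X _; rewrite scale1r.
have f_cont : continuous f.
  rewrite /f; elim: s {sk f} => [|X s IHs].
    by under eq_fun do rewrite big_nil; exact: cst_continuous.
  have -> : (fun r : R => \prod_(Y <- X :: s) expmx (r *: Y)) =
      (fun r => expmx (r *: X) *m \prod_(Y <- s) expmx (r *: Y)).
    by apply/funext => r; rewrite big_cons.
  move=> r; apply: (@cvg_mulmx R _ _ _ _ _ _ (fun r : R => expmx (r *: X))
    (fun r => \prod_(Y <- s) expmx (r *: Y))); [exact: continuous_expmx|exact: IHs].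
have f_SO r : SO W (f r).
  rewrite /f big_seq; apply: (big_ind (SO W)) => [||X Xs]; first exact: SO1.
    exact: SOM.
  by apply: kSO; exact: sk.
apply: (@connected_component_max _ _ (range f)).
- by exists 0 => //; rewrite /f big1 // => X _; rewrite scale0r expmx0.
- by move=> _ [r _ <-].
- apply: connected_continuous_connected.
    by apply/connected_intervalP => x y _ _ z _.
  exact: continuous_subspaceT.
- by exists 1.
Qed.

Lemma parabolic_SO0 z u : (z <= W)%MS -> (u <= W)%MS -> g z z = 0 ->
  g u z = 0 -> 0 < g u u -> SO0 W (expmx (wedge z u)).
Proof.
move=> zW uW zz uz uu.
apply: (@expprod_SO0 [set X | exists r, X = r *: wedge z u]).
  move=> _ r [r' ->]; rewrite scalerA; case: (eqVneq (r * r') 0) => [->|r0].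
    by rewrite scale0r expmx0; exact: SO1.
  rewrite -wedgeZr; apply: parabolic_SO; rewrite ?scalemx_sub ?lformE ?uz ?mulr0 //.
  by rewrite mulrA -expr2 mulr_gt0 // lt_neqAle sqr_ge0 eq_sym sqrf_eq0 r0.
by apply: expprod_exp; exists 1; rewrite scale1r.
Qed.

Hypothesis Wd : (W :&: perp W)%MS = 0.
Variable t : V.
Hypothesis tW : (t <= W)%MS.
Hypothesis tt : g t t < 0.

Lemma SO_image A : SO W A -> (A - 1%:M <= W)%MS.
Proof.
move=> sA; have [_ [WA _]] := sA; apply/row_subP => i; rewrite rowE.
move: (delta_mx 0 i) => u; rewrite mulmxBr mulmx1.
have := SO_perp_fix sA (proj_perp_compl Wd u); rewrite mulmxBl => e.
have -> : u *m A - u = u *m perp_proj W *m A - u *m perp_proj W.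
  by move/rowP: e => e; apply/rowP => j; have := e j; rewrite !mxE; lra.
rewrite addmx_sub ?eqmx_opp ?perp_proj_sub //.
by apply: submx_trans WA; apply: submxMr; exact: perp_proj_sub.
Qed.

Lemma SO_time_neq0 A : SO W A -> g (t *m A) t != 0.
Proof.
move=> [[iA _] _]; apply/eqP => tA.
have t0 : t *m A = 0.
  by apply: (timelike_orth tt); rewrite ?iA ?(ltW tt) // lformC.
by have := tt; rewrite -(iA t t) t0 lform0l ltxx.
Qed.

(** As t A and t lie in the same cone, the reflection in t A - t brings t A back to t. What remains
    fixes t and acts on the Euclidean space of vectors of W orthogonal to t, where it is a product
    of reflections. Determinant 1 makes the total number of reflections even. *)
Lemma SO_expprod k A : (3 <= \rank W)%N ->
  (forall x y, (x <= W)%MS -> (y <= W)%MS -> k (wedge x y)) ->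
  SO W A -> g (t *m A) t < 0 -> expprod k A.
Proof.
move=> rW kW sA tAt; have [[iA dA] _] := sA.
have AW := SO_image sA.
have refl_image B w : (w <= W)%MS -> (B - 1%:M <= W)%MS ->
    (B *m refl w - 1%:M <= W)%MS.
  move=> wW BW; apply/row_subP => i; rewrite rowE mulmxBr mulmx1 mulmxA mul_refl.
  rewrite addrAC addmx_sub // ?eqmx_opp ?scalemx_sub //.
  by rewrite -[X in _ - X]mulmx1 -mulmxBr; apply: submx_trans BW; exact: submxMl.
have main B : lisometry B -> (B - 1%:M <= W)%MS -> t *m B = t ->
    exists s, (forall w, w \in s -> (w <= W)%MS /\ 0 < g w w) /\
      B = \prod_(w <- s) refl w.
  move=> iB BW tB; have [||s [sS ->]] := @isometry_prod_refl R n (W :&: perp t)%MS B _ iB.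
  - move=> x; rewrite sub_capmx => /andP[xW /perpP xt] x0.
    rewrite ltNge; apply: contra x0 => xx; apply/eqP.
    by apply: (timelike_orth tt) => //; rewrite lformC xt.
  - rewrite sub_capmx BW; apply/row_subP => i; apply/perpP => v.
    move=> /submxP[c ->]; rewrite rowE mulmxBr mulmx1.
    rewrite [c]mx11_scalar mul_scalar_mx lformZr lformDl lformNl.
    by rewrite -{1}tB iB subrr mulr0.
  - exists s; split=> // w /sS[]; rewrite sub_capmx => /andP[]; by [].
have tA_t : g (t *m A) (t *m A) = g t t by exact: iA.
have [s [sW As]] : exists s, (forall w, w \in s -> (w <= W)%MS /\ 0 < g w w) /\
    A = \prod_(w <- s) refl w.
  case: (timelike_sub tA_t _ (ltW tAt)) => [|e|w0]; first by rewrite tA_t.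
    exact: main.
  pose w := t *m A - t.
  have wW : (w <= W)%MS.
    by rewrite /w -[X in _ - X]mulmx1 -mulmxBr; apply: submx_trans AW; exact: submxMl.
  have wn0 : g w w != 0 by rewrite gt_eqF.
  have [||| s [sW Bs]] := main (A *m refl w).
  - by apply: lisometryM => //; exact: refl_isometry.
  - exact: refl_image.
  - by rewrite mulmxA refl_swap.
  - exists (rcons s w); split.
      by move=> x; rewrite mem_rcons inE => /orP[/eqP ->|/sW].
    by rewrite -cats1 big_cat big_seq1 /= -Bs -mulmxE -mulmxA refl_refl // mulmx1.
rewrite As; apply: (prod_refl_expprod tW) => //.
have := dA; rewrite As det_prod_refl => [|w /sW[]//].
rewrite -signr_odd; case: odd => //= /eqP.
by rewrite expr1 eq_sym -subr_eq0 opprK -mulr2n pnatr_eq0.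
Qed.

(** The continuous function B |-> g(t B, t) has no zero on SO(W), so it keeps on the identity
    component the negative sign that it has at 1. *)
Lemma SO0_expprod k : (3 <= \rank W)%N ->
  (forall x y, (x <= W)%MS -> (y <= W)%MS -> k (wedge x y)) ->
  SO0 W `<=` expprod k.
Proof.
move=> rW kW A sA; have SO_A : SO W A by exact: connected_component_sub sA.
apply: SO_expprod => //; rewrite ltNge; apply/negP => ge0.
pose f B : R := g (t *m B) t.
have f_cont : continuous f.
  have -> : f = fun B => (t *m (B *m (lgram R n *m t^T))) 0 0.
    by apply/funext => B; rewrite /f lform_gram -!mulmxA.
  move=> B.
  have h : (fun B : M => t *m (B *m (lgram R n *m t^T))) @ B -->
      t *m (B *m (lgram R n *m t^T)).
    apply: (@cvg_mulmxl R M (nbhs B) (nbhs_filter B)).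
    apply: (@cvg_mulmxr R M (nbhs B) (nbhs_filter B)).
    exact: cvg_id.
  exact: (cvg_comp _ _ h (@coord_continuous R 1 1 0 0 _)).
have := @connected_continuous_connected _ _ (SO0 W) f
  (@component_connected _ _ _) (continuous_subspaceT f_cont).
move=> /connected_intervalP/(_ (f 1) (f A)) itv.
have [|||B sB fB] := itv _ _ 0.
- by exists 1 => //; apply: connected_component_refl; exact: SO1.
- by exists A.
- by rewrite /f mulmx1 (ltW tt).
- have := SO_time_neq0 (connected_component_sub sB).
  by rewrite -/(f B) fB eqxx.
Qed.

End SpecialOrthogonal.

(** * Lie algebras, conjugation and invariant subspaces *)

Section LieBridge.
Variables (R : realType) (n : nat).
Local Notation V := 'rV[R]_n.+2.
Local Notation M := 'M[R]_n.+2.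
Local Notation g := (@lform R n).
Implicit Types (t u v w x y z : V) (A B X Y Z S W U : M) (a b c : R).
Implicit Types (G k : set M).

Lemma trmx_expmx X : (expmx X)^T = expmx X^T.
Proof.
apply/esym/expmx_unique.
have -> : @expsum R M X^T = fun m => (@expsum R M X m)^T.
  apply/funext => m; rewrite /expsum linear_sum /=; apply: eq_bigr => i _.
  rewrite linearZ /=; congr (_ *: _).
  elim: {+}i => [|j IHj]; first by rewrite !expr0 trmx1.
  by rewrite exprSr exprS -!mulmxE trmx_mul IHj.
by apply: cvg_trmx; exact: cvg_expmx.
Qed.

Lemma gadj_expmx X : gadj (expmx X) = expmx (gadj X).
Proof.
have JE : gadj X * lgram R n = lgram R n * X^T.
  by rewrite gadj.unlock -!mulmxE -mulmxA gram_gram mulmx1.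
transitivity (lgram R n *m expmx X^T *m lgram R n).
  by rewrite -trmx_expmx gadj.unlock.
by rewrite [X in X *m _](esym (expmx_intertwine JE)) -mulmxA gram_gram mulmx1.
Qed.

Lemma expmx_SOV X : skew X -> SOV (expmx X).
Proof.
have iso Y : skew Y -> lisometry (expmx Y).
  move=> /skewP sY; apply/lisometryP; rewrite gadj_expmx sY.
  by rewrite -{1}[Y]opprK; exact: expmxNl.
move=> sX; split; first exact: iso.
(* The determinant is 1 because the exponential of X is the square of an isometry, the exponential
   of X/2. *)
have sX2 : skew (2%:R^-1 *: X) by exact: skewZ.
have -> : X = 2%:R^-1 *: X + 2%:R^-1 *: X.
  by rewrite -scalerDl -[LHS]scale1r; congr (_ *: _); field.
rewrite expmxD // -mulmxE det_mulmx.
by case: (lisometry_det (iso _ sX2)) => ->; rewrite ?mulrNN mulr1.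
Qed.

Lemma isometry_expmx_skew X : (forall r : R, lisometry (expmx (r *: X))) -> skew X.
Proof.
move=> iX; apply/skewP.
have gE r : gadj (expmx (r *: X)) = expmx (r *: - X).
  have := (lisometryP _).1 (iX r); rewrite scalerN => e.
  rewrite -[LHS]mul1mx -[1%:M](expmxNl (r *: X)) -mulmxE -mulmxA e.
  by rewrite mulmx1.
have cN := @cvg_expmx_diff R n.+1 (- X).
have cX : (fun m => gadj (m.+1%:R *: (expmx ((m.+1%:R : R)^-1 *: X) - 1))) @ \oo -->
    gadj X.
  rewrite gadj.unlock; apply: cvg_mulmxr; apply: cvg_mulmxl; apply: cvg_trmx.
  exact: cvg_expmx_diff.
apply: (cvg_unique (@norm_hausdorff _ _) cX).
suff -> : (fun m => gadj (m.+1%:R *: (expmx ((m.+1%:R : R)^-1 *: X) - 1))) =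
    (fun m => m.+1%:R *: (expmx ((m.+1%:R : R)^-1 *: - X) - 1)) by [].
apply/funext => m; rewrite -gE gadj.unlock linearZ linearB /= trmx1.
by rewrite -scalemxAr -scalemxAl mulmxBr mulmxBl mulmx1 gram_gram.
Qed.

Lemma mul_expmx_eq0 (m : nat) (Q : 'M[R]_(m, n.+2)) X :
  Q *m X = 0 -> Q *m expmx X = Q.
Proof.
have h Z : Z *m X = 0 -> Z *m expmx X = Z.
  move=> ZX; have : 0 * Z = Z * X by rewrite mul0r -mulmxE ZX.
  by move/expmx_intertwine; rewrite expmx0 mul1r.
move=> QX; apply/row_matrixP => i; rewrite row_mul.
have rX : row i Q *m X = 0 by rewrite -row_mul QX linear0.
(* [expmx_intertwine] is about square matrices: the row is padded to a square matrix, from which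
   [e0] extracts it again. *)
have /h : (e0 R n)^T *m row i Q *m X = 0 by rewrite -mulmxA rX mulmx0.
move=> /(congr1 (mulmx (e0 R n))); rewrite !mulmxA.
have -> : e0 R n *m (e0 R n)^T = 1%:M.
  by rewrite trmx_delta mul_delta_mx; apply/matrixP => i' j; rewrite !mxE !ord1.
by rewrite !mul1mx.
Qed.

Lemma stable_expmx U X : stablemx U X -> stablemx U (expmx X).
Proof.
move=> /submxP[D UX]; have : D * U = U * X by [].
by move/expmx_intertwine; rewrite -!mulmxE => <-; exact: submxMl.
Qed.

Lemma SO_expmx W X : skew X -> stablemx W X -> perp W *m X = 0 -> SO W (expmx X).
Proof.
by move=> sX WX PX; split; [exact: expmx_SOV|split; [exact: stable_expmx|exact: mul_expmx_eq0]].
Qed.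

Lemma expmx_conj A X : A \is a GRing.unit ->
  expmx (A * X * A^-1) = A * expmx X * A^-1.
Proof.
move=> uA; have e : (A * X * A^-1) * A = A * X by rewrite mulrVK.
by apply: (mulIr uA); rewrite (expmx_intertwine e) mulrVK.
Qed.

Lemma Lie_of_sub G k : k `<=` G -> Lie_of k `<=` Lie_of G.
Proof. by move=> kG X kX r; exact: kG. Qed.

Lemma Lie_of_skew G X : G `<=` @SOV R n -> Lie_of G X -> skew X.
Proof. by move=> GV hX; apply: isometry_expmx_skew => r; case: (GV _ (hX r)). Qed.

Lemma Lie_of_exp G X : Lie_of G X -> G (expmx X).
Proof. by move=> /(_ 1); rewrite scale1r. Qed.

Lemma Lie_of_stable G U X : invariant_subspace G U -> Lie_of G X -> stablemx U X.
Proof.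
move=> GU hX; rewrite submxE; apply/eqP.
by apply: expmx_tangent_eq0 => r; rewrite mulmx_coker; apply/eqP; rewrite -submxE; apply: GU.
Qed.

Lemma Lie_of_fix G (m : nat) (Q : 'M[R]_(m, n.+2)) X :
  (forall A, G A -> Q *m A = Q) -> Lie_of G X -> Q *m X = 0.
Proof.
move=> GQ hX; rewrite -[LHS]mulmx1; apply: expmx_tangent_eq0 => r.
by rewrite !mulmx1 GQ.
Qed.

Lemma expprod_stable k U A : (forall X, k X -> stablemx U X) -> expprod k A ->
  stablemx U A.
Proof.
move=> kU; move: A; apply: expprod_ind => [|X A kX UA] /=; first by rewrite mulmx1.
rewrite -mulmxE mulmxA; apply: submx_trans UA; apply: submxMr.
by apply: stable_expmx; exact: kU.
Qed.

Lemma expprod_fix k (m : nat) (Q : 'M[R]_(m, n.+2)) A :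
  (forall X, k X -> Q *m X = 0) -> expprod k A -> Q *m A = Q.
Proof.
move=> kQ; move: A; apply: expprod_ind => [|X A kX QA] /=; first by rewrite mulmx1.
by rewrite -mulmxE mulmxA mul_expmx_eq0 // kQ.
Qed.

Lemma expprod_sub G k : subgroup G -> k `<=` Lie_of G -> expprod k `<=` G.
Proof.
move=> [_ G1 GM _] kG; apply: expprod_ind => // X A kX GA.
by apply: GM => //; apply: Lie_of_exp; exact: kG.
Qed.

Lemma connected_expprod G : connected_Lie_subgroup G -> G = expprod (Lie_of G).
Proof.
move=> [sG _ Gexp]; apply/seteqP; split; last exact: expprod_sub.
by move=> A /Gexp[s [sh ->]]; exists s.
Qed.

(* Being contained in G, the group generated by the annihilator has a Lie       *)
(* algebra no larger than the annihilator.                                      *)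
Lemma annihilator_connected G (m : nat) (Q : 'M[R]_(m, n.+2)) :
  connected_Lie_subgroup G ->
  connected_Lie_subgroup (expprod [set X | Lie_of G X /\ Q *m X = 0]) /\
  expprod [set X | Lie_of G X /\ Q *m X = 0] `<=` G.
Proof.
move=> [sG [h00 hD' hZ' hB'] _]; set k := [set X | _]; set K := expprod k.
have KG : K `<=` G by apply: expprod_sub => // X [].
have LK : Lie_of K = k.
  apply/seteqP; split=> X.
    move=> KX; split; first exact: Lie_of_sub KX.
    apply: Lie_of_fix KX => A; apply: expprod_fix => Y; by case.
  move=> [hX QX] r; apply: expprod_exp; split; first exact: hZ'.
  by rewrite -scalemxAr QX scaler0.
split=> //; split.
- apply: subgroup_expprod => X [hX QX]; split; last by rewrite mulmxN QX oppr0.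
  by rewrite -scaleN1r; exact: hZ'.
- rewrite LK; split.
  + by split=> //; rewrite mulmx0.
  + by move=> X Y [hX QX] [hY QY]; split; [exact: hD'|rewrite mulmxDr QX QY addr0].
  + by move=> a X [hX QX]; split; [exact: hZ'|rewrite -scalemxAr QX scaler0].
  + move=> X Y [hX QX] [hY QY]; split; first exact: hB'.
    by rewrite -!mulmxE mulmxBr !mulmxA QX QY !mul0mx subrr.
- by move=> A [s [sk ->]]; exists s; rewrite LK.
Qed.

Lemma conj_setK A G : A \is a GRing.unit -> conj_set A^-1 (conj_set A G) = G.
Proof.
move=> uA; apply/seteqP; split=> B.
  move=> [_ [C GC <-] <-]; rewrite invrK.
  by rewrite -!mulrA mulVr // mulr1 mulKr.
move=> GB; exists (A * B * A^-1); first by exists B.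
by rewrite invrK -!mulrA mulVr // mulr1 mulKr.
Qed.

Lemma conj_connected A G : A \is a GRing.unit -> connected_Lie_subgroup G ->
  connected_Lie_subgroup (conj_set A G).
Proof.
move=> uA [[Gu G1 GM GV] [h00 hD' hZ' hB'] Gexp].
have LieE : Lie_of (conj_set A G) = conj_set A (Lie_of G).
  apply/seteqP; split=> X.
    move=> hX; exists (A^-1 * X * A); last first.
      by rewrite -!mulrA mulrV // mulr1 mulVKr.
    move=> r; have [B GB] := hX r.
    have -> : r *: X = A * (r *: (A^-1 * X * A)) * A^-1.
      by rewrite -scalerAr -scalerAl -!mulrA mulrV // mulr1 mulVKr.
    by rewrite expmx_conj // => /(mulIr (_ : A^-1 \is a GRing.unit)); rewrite unitrV =>
      /(_ uA)/(mulrI uA) <-.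
  move=> [Y hY <-] r; exists (expmx (r *: Y)); first exact: hY.
  by rewrite -expmx_conj // -scalerAr -scalerAl.
split.
- split.
  + move=> _ [B GB <-] /=; have uB : B \is a GRing.unit by exact: Gu.
    by rewrite !unitrMl ?unitrV.
  + by exists 1 => //; rewrite mulr1 mulrV.
  + move=> _ _ [B GB <-] [C GC <-]; exists (B * C); first exact: GM.
    by rewrite !mulrA mulrVK.
  + move=> _ [B GB <-]; exists B^-1; first exact: GV.
    have uB : B \is a GRing.unit by exact: Gu.
    have uAB : A * B \is a GRing.unit by rewrite unitrMl.
    have uA' : A^-1 \is a GRing.unit by rewrite unitrV.
    by rewrite (invrM uAB uA') invrK (invrM uA uB) mulrA.
- rewrite LieE; split.
  + by exists 0 => //; rewrite mulr0 mul0r.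
  + move=> _ _ [X hX <-] [Y hY <-]; exists (X + Y); first exact: hD'.
    by rewrite mulrDr mulrDl.
  + move=> a _ [X hX <-]; exists (a *: X); first exact: hZ'.
    by rewrite -scalerAr -scalerAl.
  + move=> _ _ [X hX <-] [Y hY <-]; exists (X * Y - Y * X); first exact: hB'.
    by rewrite mulrBr mulrBl !mulrA !mulrVK.
- move=> _ [B /Gexp[s [sh ->]] <-]; rewrite LieE.
  exists [seq A * X * A^-1 | X <- s]; split.
    by move=> _ /mapP[X /sh hX ->]; exists X.
  rewrite big_map; elim: s sh => [|X s IHs] sh; first by rewrite !big_nil mulr1 mulrV.
  rewrite !big_cons -IHs => [|Y Ys]; last by apply: sh; rewrite inE Ys orbT.
  by rewrite expmx_conj // !mulrA mulrVK.
Qed.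

Lemma conj_SOV A G : SOV A -> G `<=` @SOV R n -> conj_set A G `<=` @SOV R n.
Proof.
move=> sA GV _ [B /GV sB <-]; apply: SOV_mul; first exact: SOV_mul.
exact: SOV_inv.
Qed.

Lemma invariant_conj A G U : A \is a GRing.unit -> invariant_subspace G U ->
  invariant_subspace (conj_set A G) (U *m A^-1).
Proof.
move=> uA GU _ [B GB <-]; rewrite -!mulmxE !mulmxA mulmxKV //.
by apply: submxMr; exact: GU.
Qed.

Lemma totally_reducible_conj A G : A \is a GRing.unit ->
  totally_reducible (conj_set A G) -> totally_reducible G.
Proof.
move=> uA TR U GU; have [U' [GU' sU cU]] := TR _ (invariant_conj uA GU).
have uV : A^-1 \is a GRing.unit by rewrite unitrV.
exists (U' *m A); split.
- by have := invariant_conj uV GU'; rewrite conj_setK // invrK.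
- have -> : U = U *m A^-1 *m A by rewrite mulmxKV.
  apply: eqmx_trans (eqmx_sym (addsmxMr _ _ _)) _.
  apply: eqmx_trans (eqmxMr A sU) _; rewrite mul1mx.
  by apply/eqmxP; rewrite submx1 sub1mx row_full_unit.
- apply/eqP; rewrite -submx0; apply/row_subP => i.
  have := row_sub i (U :&: U' *m A)%MS; rewrite sub_capmx => /andP[].
  move: (row i _) => x xU /submxP[D xD].
  have : (x *m A^-1 <= U *m A^-1 :&: U')%MS.
    by rewrite sub_capmx submxMr //= xD mulmxA mulmxK // submxMl.
  rewrite cU submx0 => /eqP xA; rewrite -[x](mulmxKV uA) [invmx A]/(A^-1) xA.
  by rewrite mul0mx sub0mx.
Qed.


(** This property for isotropic x, and the next one, are preserved by conjugation in SO(V); they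
    separate the three types. *)
Definition line_invariant G x := forall A, G A -> exists c, x *m A = c *: x.

Definition fixes_timelike G := exists2 t : V, g t t < 0 & forall A, G A -> t *m A = t.

Lemma line_invariant_conj A G x : A \is a GRing.unit -> line_invariant G x ->
  line_invariant (conj_set A G) (x *m A^-1).
Proof.
move=> uA Gx _ [B GB <-]; have [c xc] := Gx B GB; exists c.
by rewrite -!mulmxE !mulmxA mulmxKV // xc scalemxAl.
Qed.

Lemma fixes_timelike_conj A G : SOV A -> fixes_timelike G ->
  fixes_timelike (conj_set A G).
Proof.
move=> sA [t tt Gt]; have uA := SOV_unit sA.
have [iA _] := SOV_inv sA; exists (t *m A^-1); first by rewrite iA.
by move=> _ [B GB <-]; rewrite -!mulmxE !mulmxA mulmxKV // Gt.
Qed.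

(** If g pairs U perfectly with an invariant U2, the orthogonal of U2 is an invariant complement of
    U. The choice of U2 is U itself when U is nondegenerate, its image under the Gram matrix in type
    I, and in type III, when U has a radical line, the result of exchanging p and q in U. *)
Lemma complement_pairing G U U2 : G `<=` @SOV R n -> invariant_subspace G U2 ->
  \rank U = \rank U2 -> (U :&: perp U2)%MS = 0 ->
  exists U', [/\ invariant_subspace G U', (U + U' :=: 1%:M)%MS & (U :&: U')%MS = 0].
Proof.
move=> GV GU2 rU dU; exists (perp U2); split=> //.
  by move=> A GA; apply: perp_stable_isometry; [case: (GV A GA)|exact: GU2].
apply/eqmxP; rewrite submx1 sub1mx /row_full (mxrank_disjoint_sum dU).
by rewrite rank_perp rU subnKC ?rank_leq_col /=.
Qed.

(** The radical of U is totally isotropic, hence at most a line, and G preserves it. *)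
Lemma radical_line_invariant G U x : G `<=` @SOV R n -> invariant_subspace G U ->
  (x <= U :&: perp U)%MS -> x != 0 -> g x x = 0 /\ line_invariant G x.
Proof.
rewrite sub_capmx => GV GU /andP[xU xU'] x0.
have iso y : (y <= U)%MS -> (y <= perp U)%MS -> g y y = 0.
  by move=> yU /perpP; apply.
split=> [|A GA]; first exact: iso.
have xAU : (x *m A <= U)%MS.
  by apply: submx_trans (GU A GA); apply: submxMr.
have xAU' : (x *m A <= perp U)%MS.
  apply: submx_trans (perp_stable_isometry _ (GU A GA)); first exact: submxMr.
  by case: (GV A GA).
apply: (isotropic_orth x0); [exact: iso| |exact: iso].
by have /perpP := xU'; apply.
Qed.

Lemma totally_reducible_no_line G : G `<=` @SOV R n ->
  (forall x, x != 0 -> g x x = 0 -> ~ line_invariant G x) -> totally_reducible G.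
Proof.
move=> GV noline U GU; apply: (complement_pairing GV GU) => //.
apply/eqP; apply: contrapT => /negP/rowV0Pn[x xU x0].
have [xx Gx] := radical_line_invariant GV GU xU x0.
exact: noline x0 xx Gx.
Qed.

Lemma perp_e0_fixed A : SO (perp (e0 R n)) A -> e0 R n *m A = e0 R n.
Proof. by move=> sA; apply: SO_perp_fix sA _; rewrite perp_perp. Qed.

Lemma typeI_fixes_timelike G : typeI G -> fixes_timelike G.
Proof.
move=> [_ GI]; exists (e0 R n); first by rewrite lform_e0_e0 oppr_lt0 ltr01.
by move=> A /GI; exact: perp_e0_fixed.
Qed.

(** The elements of G fix [e0], so they commute with the Gram matrix J and U J is invariant. A
    vector x of U orthogonal to U J satisfies g(x, x J) = 0, which is its Euclidean norm. *)
Lemma typeI_totally_reducible G : typeI G -> totally_reducible G.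
Proof.
move=> [_ GI] U GU; pose J := lgram R n.
have GV : G `<=` @SOV R n by move=> A /GI[].
have JJ : J *m J = 1%:M by exact: gram_gram.
have [uJ _] := mulmx1_unit JJ.
have JA A : G A -> J *m A = A *m J.
  move=> GA; have eA := perp_e0_fixed (GI _ GA); have [iA _] := GV _ GA.
  have Ae : A *m (e0 R n)^T = (e0 R n)^T.
    apply: mulmx_row_ext => u; rewrite mulmxA.
    have h v : v *m (e0 R n)^T = (- g v (e0 R n))%:M.
      rewrite [LHS]mx11_scalar lform_e0 opprK; congr (_%:M).
      rewrite mxE (bigD1 ord0) //= big1 => [|i i0]; last first.
        by rewrite !mxE (negbTE i0) andbF mulr0.
      by rewrite !mxE !eqxx addr0 mulr1.
    by rewrite !h -{1}eA iA.
  by rewrite /J gramE mulmxBl mulmxBr mul1mx mulmx1 -scalemxAl -scalemxAr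
    -mulmxA eA mulmxA Ae.
apply: (complement_pairing (U2 := U *m J) GV).
- move=> A GA; rewrite -mulmxA JA // mulmxA; apply: submxMr; exact: GU.
- by rewrite mxrankMfree // row_free_unit.
- apply/eqP; apply: contrapT => /negP/rowV0Pn[x].
  rewrite sub_capmx => /andP[xU /perpP xJ] x0.
  have := xJ (x *m J) (submxMr J xU).
  rewrite lform_gram trmx_mul trmx_gram !mulmxA -(mulmxA x) JJ mulmx1.
  rewrite mxE => /eqP; rewrite psumr_eq0 => [/allP x00|i _]; last first.
    by rewrite mxE -expr2 sqr_ge0.
  move/eqP: x0; apply; apply/rowP => i; rewrite mxE.
  have := x00 i (mem_index_enum _); rewrite mxE -expr2 sqrf_eq0 => /eqP xi.
  by rewrite -[RHS]xi; congr (x _ _); exact: ord1.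
Qed.

End LieBridge.

(** * Invariant lines and fixed vectors in types II and III *)

Section StandardTypes.
Variables (R : realType) (n : nat) (p q : 'rV[R]_n.+2).
Local Notation V := 'rV[R]_n.+2.
Local Notation M := 'M[R]_n.+2.
Local Notation g := (@lform R n).
Local Notation E := (perp (p + q)%MS).
Implicit Types (t u v w x y z : V) (A B X Y Z S W U H : M) (a b c : R).
Implicit Types (G K T : set M).
Hypothesis pp : g p p = 0.
Hypothesis qq : g q q = 0.
Hypothesis pq : g p q = 1.

Lemma lform_qp : g q p = 1. Proof. by rewrite lformC. Qed.

Lemma pq_neq0 : p != 0 /\ q != 0.
Proof.
by split; apply/eqP => x0; have := pq; rewrite x0 ?lform0l ?lform0r => /esym/eqP;
  rewrite oner_eq0.
Qed.

Lemma pq_timelike : g (p - q) (p - q) < 0.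
Proof. by rewrite !lformE lform_qp pp qq pq; lra. Qed.

Lemma sub_EP u : (u <= E)%MS <-> g u p = 0 /\ g u q = 0.
Proof.
split=> [/perpP uE|[up uq]].
  by rewrite !uE // ?addsmxSl ?addsmxSr.
apply/perpP => v /sub_addsmxP[[a b] ->] /=.
rewrite [a]mx11_scalar [b]mx11_scalar !mul_scalar_mx !lformE up uq.
by rewrite !mulr0 addr0.
Qed.

Lemma causal_perp v : g v v <= 0 -> g v p = 0 -> g v q = 0 -> v = 0.
Proof.
move=> vv vp vq; apply: (timelike_orth pq_timelike) => //.
by rewrite lformC !lformE vp vq subrr.
Qed.

Lemma subset_perpE H : (H <= E)%MS -> (3 <= \rank (p + H + q)%MS)%N ->
  exists2 u : V, (u <= H)%MS & u != 0.
Proof.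
move=> HE r3; have /rowV0Pn[u uH u0] : H != 0; last by exists u.
apply: contraTneq r3 => ->; rewrite -ltnNge ltnS.
apply: leq_trans (mxrank_adds_leqif _ _) _.
apply: (@leq_add _ _ 1 1); last exact: rank_leq_row.
by rewrite addsmx0 rank_leq_row.
Qed.

(** Take u nonzero in H. The null rotations along [wedge z u], for z = p and z = q, preserve the
    line of v only if g(v,z) = 0: pairing with z forces the factor to be 1, and pairing with u then
    gives g(v,z) g(u,u) = 0. A causal vector orthogonal to p and q is 0. *)
Lemma SO0_no_causal_line H v : (H <= E)%MS -> (3 <= \rank (p + H + q)%MS)%N ->
  v != 0 -> g v v <= 0 -> ~ line_invariant (SO0 (p + H + q)%MS) v.
Proof.
move=> HE r3 v0 vv inv; have [u uH u0] := subset_perpE HE r3.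
have /sub_EP[up uq] : (u <= E)%MS by exact: submx_trans HE.
have uu : 0 < g u u.
  by rewrite ltNge; apply: contra u0 => uu; apply/eqP; exact: causal_perp.
have uW : (u <= p + H + q)%MS.
  by apply: submx_trans (addsmxSl _ _); apply: submx_trans (addsmxSr _ _).
have pW : (p <= p + H + q)%MS by rewrite -addsmxA addsmxSl.
have qW : (q <= p + H + q)%MS by exact: addsmxSr.
have main z : (z <= p + H + q)%MS -> g z z = 0 -> g u z = 0 -> g v z = 0.
  move=> zW zz uz; have [c] := inv _ (parabolic_SO0 zW uW zz uz uu).
  rewrite mul_expmx_wedge // => vc.
  case: (eqVneq (g v z) 0) => // vz; exfalso.
  have := congr1 (fun x => g x z) vc; rewrite !lformE uz zz => c1.
  have {}c1 : c = 1 by apply: (mulIf vz); rewrite mul1r; lra.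
  have := congr1 (fun x => g x u) vc; rewrite c1 !lformE (lformC z u) uz.
  rewrite !mulr0 !subr0 => vzu.
  have /eqP : g v z * g u u = 0 by lra.
  by rewrite mulf_eq0 (negbTE vz) gt_eqF.
by move/eqP: v0; apply; apply: causal_perp => //; exact: main.
Qed.

Lemma typeII_SO0_sub G : typeII p q G -> exists H, [/\ (H <= E)%MS,
  (3 <= \rank (p + H + q)%MS)%N & SO0 (p + H + q)%MS `<=` G].
Proof.
move=> [H [K [HE r3 [[_ K1 _ _] _ _] _ ->]]]; exists H; split=> // A sA.
by exists A, 1; rewrite mulr1.
Qed.

Lemma typeII_no_causal_line G v : typeII p q G -> v != 0 -> g v v <= 0 ->
  ~ line_invariant G v.
Proof.
move=> /typeII_SO0_sub[H [HE r3 HG]] v0 vv inv.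
by apply: (SO0_no_causal_line HE r3 v0 vv) => A /HG; exact: inv.
Qed.

(** An isometry preserving the plane of p and q permutes its two isotropic lines, and elements of a
    one-parameter group are squares, so each line is preserved with a positive factor. If all
    factors were 1, T would be contained in SO(E). *)
Lemma typeIII_lines G : typeIII p q G -> [/\ line_invariant G p,
  line_invariant G q & exists A l, [/\ G A, 0 < l, l != 1 & p *m A = l *: p]].
Proof.
move=> [T [K [[cK KE] [[phi [_ phi0 phiD TE]] TSO] TE' _ GE]]].
have [[_ K1 _ _] _ _] := cK.
have [p0 q0] := pq_neq0.
have KSO : forall B, K B -> p *m B = p /\ q *m B = q.
  move=> B /KE sB; split; apply: (SO_perp_fix sB); rewrite perp_perp.
    exact: addsmxSl.
  exact: addsmxSr.
have plane u : (u <= p + q)%MS -> exists a b, u = a *: p + b *: q.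
  move=> /sub_addsmxP[[a b] ->] /=; exists (a 0 0), (b 0 0).
  by rewrite [a in LHS]mx11_scalar [b in LHS]mx11_scalar !mul_scalar_mx.
have isoplane u : (u <= p + q)%MS -> g u u = 0 ->
    (exists c, u = c *: p) \/ (exists c, u = c *: q).
  move=> /plane[a [b ->]]; rewrite !lformE pp qq pq lform_qp => ab.
  have : a * b = 0 by lra.
  move=> /eqP; rewrite mulf_eq0 => /orP[]/eqP ->.
    by right; exists b; rewrite scale0r add0r.
  by left; exists a; rewrite scale0r addr0.
have phi_pq r : (p *m phi r <= p + q)%MS /\ (q *m phi r <= p + q)%MS /\
    lisometry (phi r).
  have : T (phi r) by rewrite TE; exists r.
  move=> /TSO[B [C [sB sC ->]]]; have [[iC _] _] := sC.
  have CC x : (x <= p + q)%MS -> x *m C = x.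
    by move=> xpq; apply: (SO_perp_fix sC); rewrite perp_perp.
  have [[iB _] [pqB _]] := sB.
  have pB : (p *m B <= p + q)%MS.
    by apply: submx_trans pqB; apply: submxMr; exact: addsmxSl.
  have qB : (q *m B <= p + q)%MS.
    by apply: submx_trans pqB; apply: submxMr; exact: addsmxSr.
  by rewrite -mulmxE !mulmxA !CC //; split=> //; split=> //; exact: lisometryM.
have lam r : exists l, [/\ 0 < l, p *m phi r = l *: p & q *m phi r = l^-1 *: q].
  (* Squaring undoes an exchange of the two lines and makes the factors positive. *)
  have rr : phi r = phi (r / 2%:R) *m phi (r / 2%:R).
    by rewrite mulmxE -phiD; congr phi; field.
  have [pP [qP iP]] := phi_pq (r / 2%:R); move: (phi _) pP qP iP rr => P pP qP iP ->.
  have Ppp : g (p *m P) (p *m P) = 0 by rewrite iP.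
  have Pqq : g (q *m P) (q *m P) = 0 by rewrite iP.
  have Ppq : g (p *m P) (q *m P) = 1 by rewrite iP.
  case: (isoplane _ pP Ppp) => -[a pa]; case: (isoplane _ qP Pqq) => -[b qb];
    move: Ppq; rewrite pa qb !lformE ?pp ?qq ?pq ?lform_qp ?mulr0 ?mulr1 => ab;
    try by have /eqP := ab; rewrite eq_sym oner_eq0.
  - have a0 : a != 0.
      by apply: contra_eq_neq ab => ->; rewrite mul0r eq_sym oner_eq0.
    exists (a ^+ 2); split; first by rewrite lt_neqAle sqr_ge0 eq_sym sqrf_eq0 a0.
      by rewrite mulmxA pa -scalemxAl pa scalerA expr2.
    rewrite mulmxA qb -scalemxAl qb scalerA; congr (_ *: _).
    have -> : b = a^-1 by apply: (mulfI a0); rewrite ab mulfV.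
    by rewrite expr2 invfM.
  - exists 1; split=> //; rewrite mulmxA ?pa ?qb -scalemxAl ?pa ?qb scalerA.
      by rewrite ab.
    by rewrite mulrC ab invr1.
have TG A : T A -> G A by move=> TA; rewrite GE; exists A, 1; rewrite mulr1.
split.
- rewrite GE => _ [B [C [TB KC ->]]]; move: TB; rewrite TE => -[r _ <-].
  have [l [_ pl _]] := lam r; exists l.
  by rewrite -mulmxE mulmxA pl -scalemxAl (KSO C KC).1.
- rewrite GE => _ [B [C [TB KC ->]]]; move: TB; rewrite TE => -[r _ <-].
  have [l [_ _ ql]] := lam r; exists l^-1.
  by rewrite -mulmxE mulmxA ql -scalemxAl (KSO C KC).2.
- apply: contrapT => no; apply: TE' => A TA; have GA := TG A TA.
  move: (TA); rewrite TE => -[r _ Ar].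
  have [l [l0 pl ql]] := lam r; rewrite Ar in pl ql.
  have l1 : l = 1.
    by apply: contrapT => /eqP l1; apply: no; exists A, l.
  have sA : SOV A.
    by have [B [C [[sB _] [sC _] ->]]] := TSO _ TA; exact: SOV_mul.
  have [iA _] := sA.
  rewrite l1 invr1 !scale1r in pl ql.
  have pqA : (p + q)%MS *m A = (p + q)%MS.
    apply/row_matrixP => i; rewrite row_mul.
    have [a [b ->]] := plane _ (row_sub i (p + q)%MS).
    by rewrite mulmxDl -!scalemxAl pl ql.
  split=> //; split.
    by apply: perp_stable_isometry => //; rewrite pqA.
  apply/row_matrixP => i; rewrite row_mul.
  have : (row i (perp E) <= p + q)%MS by rewrite -(perp_perp (p + q)%MS) row_sub.
  by move=> /plane[a [b ->]]; rewrite mulmxDl -!scalemxAl pl ql.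
Qed.

Lemma boost_not_timelike G A l : G A -> lisometry A -> l != 1 -> p *m A = l *: p ->
  line_invariant G q -> ~ fixes_timelike G.
Proof.
move=> GA iA l1 pA Gq [t tt Gt]; have [m qA] := Gq A GA.
have lm : l * m = 1 by have := iA p q; rewrite pA qA !lformE pq mulr1.
have l0 : l != 0.
  by apply: contra_eq_neq lm => ->; rewrite mul0r eq_sym oner_eq0.
have m1 : m != 1.
  by apply: contra_neq l1 => m1; rewrite -lm m1 mulr1.
have tp : g t p = 0.
  have := iA t p; rewrite (Gt A GA) pA lformZr => /eqP.
  rewrite -subr_eq0 -{2}[g t p]mul1r -mulrBl mulf_eq0 subr_eq0 (negbTE l1).
  by move=> /eqP.
have tq : g t q = 0.
  have := iA t q; rewrite (Gt A GA) qA lformZr => /eqP.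
  rewrite -subr_eq0 -{2}[g t q]mul1r -mulrBl mulf_eq0 subr_eq0 (negbTE m1).
  by move=> /eqP.
by have := tt; rewrite (causal_perp (ltW tt) tp tq) lform0l ltxx.
Qed.

End StandardTypes.

(** * Total reducibility of type III *)

Section TypeIIIReducible.
Variables (R : realType) (n : nat).
Local Notation V := 'rV[R]_n.+2.
Local Notation M := 'M[R]_n.+2.
Local Notation g := (@lform R n).
Implicit Types (p q t u v w x y z : V) (A B X Y Z S W U H : M) (a b c : R).
Implicit Types (G K T : set M).

Lemma line_invariant_stable G p U : p != 0 -> line_invariant G p ->
  invariant_subspace G U -> invariant_subspace G (U + p)%MS.
Proof.
move=> p0 Gp GU A GA; rewrite addsmxMr addsmx_sub; apply/andP; split.
  by apply: submx_trans (addsmxSl _ _); exact: GU.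
by have [c ->] := Gp A GA; rewrite scalemx_sub // addsmxSr.
Qed.

(** Here U is the sum of U :&: E and the line of p. Replacing p by q gives an invariant subspace of
    the same rank, since the reflection in p - q exchanges p and q and fixes E, and g pairs it
    perfectly with U. *)
Lemma complement_isotropic p q G U : g p p = 0 -> g q q = 0 -> g p q = 1 ->
  G `<=` @SOV R n -> line_invariant G p -> line_invariant G q ->
  invariant_subspace G U -> (p <= U)%MS -> (p <= perp U)%MS ->
  exists U', [/\ invariant_subspace G U', (U + U' :=: 1%:M)%MS & (U :&: U')%MS = 0].
Proof.
move=> pp qq pq GV Gp Gq GU pU pU'; have [p0 q0] := pq_neq0 pq.
have qp := lform_qp pq.
pose E := perp (p + q)%MS.
have GE : invariant_subspace G E.
  move=> A GA; apply: perp_stable_isometry; first by case: (GV A GA).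
  rewrite addsmxMr addsmxS //.
    by have [c ->] := Gp A GA; exact: scalemx_sub.
  by have [c ->] := Gq A GA; exact: scalemx_sub.
have GUE : invariant_subspace G (U :&: E)%MS.
  move=> A GA; rewrite sub_capmx; apply/andP; split.
    by apply: submx_trans (GU A GA); apply: submxMr; exact: capmxSl.
  by apply: submx_trans (GE A GA); apply: submxMr; exact: capmxSr.
have Up x : (x <= U)%MS -> g x p = 0.
  by move=> xU; have /perpP := pU'; rewrite lformC; apply.
have UE : (U :=: (U :&: E) + p)%MS.
  apply/eqmxP; apply/andP; split; last by rewrite addsmx_sub capmxSl.
  apply/row_subP => i; have := row_sub i U; move: (row i U) => x xU.
  rewrite -[x](subrK (g x q *: p)); apply: addmx_sub_adds; last exact: scalemx_sub.
  rewrite sub_capmx; apply/andP; split.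
    by rewrite addmx_sub // eqmx_opp scalemx_sub.
  by apply/sub_EP => //; rewrite !lformE pp pq Up //; split; ring.
pose th := refl (p - q).
have wn0 : g (p - q) (p - q) != 0 by rewrite lt_eqF // pq_timelike.
have pth : p *m th = q by apply: refl_swap => //; rewrite pp qq.
have rU : \rank U = \rank ((U :&: E) + q)%MS.
  have uth : th \in unitmx by apply: lisometry_unit; exact: refl_isometry.
  rewrite -(mxrankMfree U (_ : row_free th)); last by rewrite row_free_unit.
  rewrite (eqmxMr th UE) addsmxMr pth.
  suff -> : (U :&: E)%MS *m th = (U :&: E)%MS by [].
  apply/row_matrixP => i; rewrite row_mul refl_orth //.
  have /sub_EP[xp xq] : (row i (U :&: E)%MS <= E)%MS.
    by apply: submx_trans (row_sub _ _) _; exact: capmxSr.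
  by rewrite !lformE xp xq subrr.
apply: (complement_pairing GV _ rU); first exact: line_invariant_stable.
apply/eqP; apply: contrapT => /negP/rowV0Pn[x].
rewrite sub_capmx => /andP[xU /perpP xU2] x0.
have xp := Up x xU.
have xq : g x q = 0 by apply: xU2; exact: addsmxSr.
have xE : (x <= E)%MS by apply/sub_EP.
have xx : g x x = 0.
  by apply: xU2; apply: submx_trans (addsmxSl _ _); rewrite sub_capmx xU.
move/eqP: x0; apply; apply: (causal_perp pp qq pq) => //.
by rewrite xx.
Qed.

(** An isotropic x on neither line pairs nontrivially with both p and q; then its eigenvalue c
    satisfies l c = 1 and c = l, and l > 0 gives l = 1. *)
Lemma boost_isotropic_lines p q A l x : g p p = 0 -> g q q = 0 -> g p q = 1 ->
  lisometry A -> 0 < l -> l != 1 -> p *m A = l *: p -> q *m A = l^-1 *: q ->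
  x != 0 -> g x x = 0 -> (exists c, x *m A = c *: x) ->
  (exists2 c, c != 0 & x = c *: p) \/ (exists2 c, c != 0 & x = c *: q).
Proof.
move=> pp qq pq iA l0 l1 pA qA x0 xx [c xA].
have [p0 q0] := pq_neq0 pq; have lne : l != 0 by rewrite gt_eqF.
have ortho y : y != 0 -> g y y = 0 -> g y x = 0 -> exists2 c, c != 0 & x = c *: y.
  move=> y0 yy yx; have [d xd] := isotropic_orth y0 yy yx xx.
  by exists d => //; apply: contra_neq x0 => d0; rewrite xd d0 scale0r.
case: (eqVneq (g p x) 0) => [px|px]; first by left; exact: ortho.
case: (eqVneq (g q x) 0) => [qx|qx]; first by right; exact: ortho.
have lc : l * c = 1.
  by apply: (mulIf px); have := iA p x; rewrite pA xA !lformE mul1r mulrCA mulrA.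
have cl : l^-1 * c = 1.
  by apply: (mulIf qx); have := iA q x; rewrite qA xA !lformE mul1r mulrCA mulrA.
have c_l : c = l by rewrite -[c](mulKf lne) mulrCA cl mulr1.
exfalso; move/eqP: l1; apply; rewrite c_l in lc.
by apply/eqP; have := sqr_ge0 (l - 1); nra.
Qed.

Lemma typeIII_totally_reducible p q G : g p p = 0 -> g q q = 0 -> g p q = 1 ->
  G `<=` @SOV R n -> typeIII p q G -> totally_reducible G.
Proof.
move=> pp qq pq GV G3 U GU.
have [Gp Gq [A [l [GA l0 l1 pA]]]] := typeIII_lines pp qq pq G3.
have [iA _] := GV A GA; have lne : l != 0 by rewrite gt_eqF.
have qA : q *m A = l^-1 *: q.
  have [m qm] := Gq A GA; rewrite qm; congr (_ *: _).
  have := iA p q; rewrite pA qm !lformE pq mulr1 => lm.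
  by apply: (mulfI lne); rewrite mulrC lm mulfV.
case: (eqVneq (U :&: perp U)%MS 0) => [|/rowV0Pn[x xU x0]].
  exact: complement_pairing.
have [xx Gx] := radical_line_invariant GV GU xU x0.
move: xU; rewrite sub_capmx => /andP[xU xU'].
have [] := boost_isotropic_lines pp qq pq iA l0 l1 pA qA x0 xx (Gx A GA).
  move=> [c c0 xc].
  have px : p = c^-1 *: x by rewrite xc scalerA mulVf // scale1r.
  by apply: (complement_isotropic pp qq pq) => //; rewrite px scalemx_sub.
move=> [c c0 xc].
have qx : q = c^-1 *: x by rewrite xc scalerA mulVf // scale1r.
by apply: (complement_isotropic qq pp (lform_qp pq)) => //; rewrite qx scalemx_sub.
Qed.

End TypeIIIReducible.

(** * Classification *)

Section Constructions.
Variables (R : realType) (n : nat).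
Local Notation V := 'rV[R]_n.+2.
Local Notation M := 'M[R]_n.+2.
Local Notation g := (@lform R n).
Implicit Types (p q t u v w x y z : V) (A B X Y Z S W U H : M) (a b c : R).
Implicit Types (G K T : set M).

Lemma SO_perp_of_fix (m : nat) (Q : 'M[R]_(m, n.+2)) A : SOV A -> Q *m A = Q ->
  SO (perp Q) A.
Proof.
move=> sA QA; have [iA _] := sA; split=> //; split.
  apply/row_subP => i; apply/perpP => v vQ; rewrite row_mul.
  have vA : v *m A = v by have /submxP[D ->] := vQ; rewrite -mulmxA QA.
  by rewrite -vA iA; have /perpP -> := row_sub i (perp Q).
have /submxP[D ->] : (perp (perp Q) <= Q)%MS by rewrite perp_perp.
by rewrite -mulmxA QA.
Qed.

Lemma typeI_of_fixed G : connected_Lie_subgroup G -> G `<=` @SOV R n ->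
  fixes_timelike G -> up_to_conjugation (@typeI R n) G.
Proof.
move=> cG GV [t tt Gt]; have [C [sC [c c0 tC]]] := SOV_timelike_e0 tt.
have uC := SOV_unit sC; have sCV := SOV_inv sC.
exists (invmx C) => //; split; first by apply: conj_connected => //; exact: SOV_unit.
move=> _ [B GB <-]; apply: SO_perp_of_fix.
  by apply: (conj_SOV sCV GV); exists B.
have -> : delta_mx 0 ord0 = c^-1 *: (t *m C).
  by rewrite tC scalerA mulVf // scale1r.
have -> : (invmx C)^-1 = C by exact: (@invrK _ C).
by rewrite -scalemxAl -!mulmxE !mulmxA mulmxK // Gt.
Qed.

(** The annihilator k of p in h also kills q, so the trace form is definite on it. Choose X0 in h
    with p X0 = p and orthogonal to k. For Z in k the bracket L = [X0, Z] lies in k, and tr(L L) =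
    tr(X0 [Z, L]) = 0, so L = 0. Thus h is the sum of k and the line of X0, which commute, and T and
    K are their exponentials. *)
Lemma typeIII_of_lines p q G : g p p = 0 -> g q q = 0 -> g p q = 1 ->
  connected_Lie_subgroup G -> G `<=` @SOV R n ->
  line_invariant G p -> line_invariant G q ->
  (exists2 X, Lie_of G X & p *m X != 0) -> typeIII p q G.
Proof.
move=> pp qq pq cG GV Gp Gq [X1 hX1 pX1].
have [sG Lsub _] := cG; have [h00 hD' hZ' hB'] := Lsub.
have hs X : Lie_of G X -> skew X by exact: Lie_of_skew.
have [p0 q0] := pq_neq0 pq; have qp' := lform_qp pq.
have lin x X : line_invariant G x -> x != 0 -> Lie_of G X -> exists c, x *m X = c *: x.
  move=> Gx x0 hX; have : stablemx <<x>>%MS X.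
    apply: Lie_of_stable hX => A GA; have [c xc] := Gx A GA.
    have xx : (<<x>> :=: x)%MS by exact: genmxE.
    have : (x *m A <= <<x>>)%MS by rewrite xx xc scalemx_sub.
    by apply: submx_trans; apply: submxMr; rewrite xx.
  move=> sX; have : (x *m X <= x)%MS.
    by rewrite -(genmxE x); apply: submx_trans sX; apply: submxMr; rewrite genmxE.
  by move=> /submxP[D ->]; exists (D 0 0); rewrite [D in LHS]mx11_scalar mul_scalar_mx.
have pE X : Lie_of G X -> p *m X = g (p *m X) q *: p.
  by move=> hX; have [c pc] := lin p X Gp p0 hX; rewrite pc lformZl pq mulr1.
have qE X : Lie_of G X -> q *m X = - g (p *m X) q *: q.
  move=> hX; have [c qc] := lin q X Gq q0 hX; rewrite qc; congr (_ *: _).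
  by rewrite (hs X hX) qc opprK lformZr pq mulr1.
pose k := [set X | Lie_of G X /\ p *m X = 0].
pose K := expprod k.
have [cK KG] := annihilator_connected p cG; rewrite -/k -/K in cK KG.
have kq X : k X -> q *m X = 0.
  by move=> [hX pX]; rewrite qE // pX lform0l oppr0 scale0r.
have ktr X : k X -> X != 0 -> 0 < - \tr (X *m X).
  move=> kX X0; have [hX pX] := kX; have tX : (p - q) *m X = 0.
    by rewrite mulmxBl pX kq // subrr.
  have [le0 eq0] := skew_timelike_trace (hs X hX) (pq_timelike pp qq pq) tX.
  by rewrite oppr_gt0 lt_neqAle le0 eq0 X0.
have [d [f [kf fo fspan]]] : exists d (f : 'I_d -> M), [/\ forall i, k (f i),
    forall i j, - \tr (f i *m f j) = (i == j)%:R
    & forall X, k X -> X = \sum_i (- \tr (X *m f i)) *: f i].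
  apply: (@orthonormal_basis _ _ k (fun X Y => - \tr (X *m Y))) => //.
  - by split=> //; rewrite mulmx0.
  - move=> a X Y [hX pX] [hY pY]; split; first by apply: hD' => //; exact: hZ'.
    by rewrite mulmxDr -scalemxAr pX pY scaler0 addr0.
  - by move=> a X Y Z; rewrite mulmxDl -scalemxAl mxtraceD mxtraceZ; ring.
  - by move=> X Y; rewrite mxtrace_mulC.
pose X2 := (g (p *m X1) q)^-1 *: X1.
have c1 : g (p *m X1) q != 0.
  by apply: contra_neq pX1 => c0; rewrite pE // c0 scale0r.
have hX2 : Lie_of G X2 by exact: hZ'.
have pX2 : p *m X2 = p by rewrite -scalemxAr {2}(pE X1) // scalerA mulVf // scale1r.
(* The orthogonal projection of X2 to k, to be subtracted. *)
pose X3 := \sum_i (- \tr (X2 *m f i)) *: f i.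
have kX3 : k X3.
  split; last by rewrite mulmx_sumr big1 // => i _; rewrite -scalemxAr (kf i).2 scaler0.
  apply: (big_ind (Lie_of G)) => // i _; apply: hZ'; exact: (kf i).1.
pose X0 := X2 - X3.
have hX0 : Lie_of G X0.
  by apply: hD' => //; rewrite -scaleN1r; apply: hZ'; exact: kX3.1.
have pX0 : p *m X0 = p by rewrite mulmxBr pX2 kX3.2 subr0.
have orth Z : k Z -> \tr (X0 *m Z) = 0.
  move=> kZ; rewrite (fspan Z kZ) mulmx_sumr linear_sum /= big1 // => i _.
  rewrite -scalemxAr mxtraceZ mulmxBl.
  have -> : \tr (X2 *m f i - X3 *m f i) = \tr (X2 *m f i) - \tr (X3 *m f i).
    exact: linearB.
  suff -> : \tr (X3 *m f i) = \tr (X2 *m f i) by rewrite subrr mulr0.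
  rewrite mulmx_suml linear_sum /= (bigD1 i) //= big1 => [|j ji].
    have := fo i i; rewrite eqxx mulr1n => fii.
    by rewrite -scalemxAl mxtraceZ addr0 mulNr -mulrN fii mulr1.
  rewrite -scalemxAl mxtraceZ; have := fo j i; rewrite (negbTE ji) mulr0n => fji.
  by rewrite mulNr -mulrN fji mulr0.
have comm Z : k Z -> X0 *m Z = Z *m X0.
  move=> kZ; have [hZZ pZ] := kZ.
  pose L := X0 *m Z - Z *m X0.
  have kL : k L.
    by split; [exact: hB'|rewrite mulmxBr !mulmxA pX0 pZ mul0mx subrr].
  apply/eqP; rewrite -subr_eq0; apply: contrapT => /negP L0.
  have := ktr L kL L0; have : k (Z *m L - L *m Z).
    by split; [apply: hB' => //; exact: kL.1|rewrite mulmxBr !mulmxA pZ kL.2 !mul0mx subrr].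
  move=> /orth; rewrite mulmxBr.
  have -> : \tr (X0 *m (Z *m L) - X0 *m (L *m Z)) =
      \tr (X0 *m (Z *m L)) - \tr (X0 *m (L *m Z)) by exact: linearB.
  have -> : \tr (X0 *m (L *m Z)) = \tr (Z *m X0 *m L).
    by rewrite mulmxA mxtrace_mulC mulmxA.
  move=> e; rewrite {1}/L mulmxBl.
  have -> : \tr (X0 *m Z *m L - Z *m X0 *m L) =
      \tr (X0 *m Z *m L) - \tr (Z *m X0 *m L) by exact: linearB.
  by rewrite -(mulmxA X0) e oppr0 ltxx.
pose T := range (fun r : R => expmx (r *: X0)).
(* X0 is the sum of the boost generator D and of Z0, which kills p and q and commutes with D; this
   places T in SO(1,1) x SO(E). *)
pose D := wedge q p.
have sD : skew D by exact: wedge_skew.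
have pD : p *m D = p by rewrite mul_wedge pq pp scale1r scale0r subr0.
have qD : q *m D = - q by rewrite mul_wedge qq qp' scale0r scale1r sub0r.
pose Z0 := X0 - D.
have sZ0 : skew Z0 by apply: skewD; [exact: hs|exact: skewN].
have pZ0 : p *m Z0 = 0 by rewrite mulmxBr pX0 pD subrr.
have qZ0 : q *m Z0 = 0.
  by rewrite mulmxBr qE // pX0 pq scaleN1r qD opprK addNr.
have DZ0 : D *m Z0 = Z0 *m D.
  apply/eqP; rewrite -subr_eq0; apply/eqP.
  by rewrite !mulmxE wedge_lie // pZ0 qZ0 wedge0l wedge0r addr0.
have pq_lines B b c : p *m B = b *: p -> q *m B = c *: q -> stablemx (p + q)%MS B.
  by move=> pB qB; rewrite addsmxMr pB qB addsmxS // scalemx_sub.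
have pq_fix B : p *m B = 0 -> q *m B = 0 -> (p + q)%MS *m B = 0.
  move=> pB qB; apply/eqP; rewrite -submx0 addsmxMr pB qB addsmx0.
  exact: sub0mx.
exists T, K; split.
- split=> // A KA; apply: SO_perp_of_fix; first exact: GV (KG A KA).
  apply: expprod_fix KA => X kX; apply: pq_fix; [exact: kX.2|exact: kq].
- split.
    exists (fun r : R => expmx (r *: X0)); split=> //.
    + exact: continuous_expmx.
    + by rewrite scale0r expmx0.
    + move=> r r'; rewrite scalerDl expmxD //.
      by rewrite /GRing.comm -!scalerAl -!scalerAr !scalerA mulrC.
  move=> _ [r _ <-]; exists (expmx (r *: D)), (expmx (r *: Z0)); split.
  + apply: SO_expmx; first exact: skewZ.
      apply: (pq_lines _ r (- r)); rewrite -scalemxAr ?pD // qD.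
      by rewrite scalerN scaleNr.
    apply/row_matrixP => i; rewrite row_mul [RHS]linear0 /= -scalemxAr mul_wedge.
    have /sub_EP[-> ->] := row_sub i (perp (p + q)%MS).
    by rewrite !scale0r subrr scaler0.
  + apply: SO_perp_of_fix; first by apply: expmx_SOV; exact: skewZ.
    apply: mul_expmx_eq0; rewrite -scalemxAr.
    by rewrite pq_fix // scaler0.
  + rewrite -expmxD; last first.
      by rewrite /GRing.comm -!scalerAl -!scalerAr -!mulmxE DZ0.
    by rewrite -scalerDr addrC subrK.
- move=> TE; have pT r : p *m expmx (r *: X0) = p.
    apply: SO_perp_fix; first by apply: TE; exists r.
    by rewrite perp_perp addsmxSl.
  have : p *m X0 *m 1%:M = 0.
    by apply: expmx_tangent_eq0 => r; rewrite !mulmx1 pT.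
  by rewrite mulmx1 pX0 => p00; rewrite p00 eqxx in p0.
- move=> _ B [r _ <-]; move: B; apply: expprod_ind => [|X B kX cB] /=.
    by rewrite mulr1 mul1r.
  have XX0 : (r *: X0) * X = X * (r *: X0).
    by rewrite -scalerAl -scalerAr -!mulmxE comm.
  have := expmx_intertwine (esym (expmx_intertwine XX0)).
  by move=> ee; rewrite mulrA -ee -!mulrA cB.
- apply/seteqP; split; last first.
    move=> _ [B [C [[r _ <-] KC ->]]]; have [_ _ GM _] := sG.
    by apply: GM; [exact: hX0|exact: KG].
  rewrite {1}(connected_expprod cG); apply: expprod_ind => [|X A hX [B [C [[r _ <-] KC ->]]]].
    by exists 1, 1; split; [exists 0 => //; rewrite scale0r expmx0|exact: expprod1|rewrite mulr1].
  pose c := g (p *m X) q; pose Z := X - c *: X0.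
  have kZ : k Z.
    split; first by apply: hD' => //; rewrite -scaleN1r; apply: (hZ' _ _ (hZ' _ _ _)).
    by rewrite mulmxBr -scalemxAr pX0 pE // subrr.
  have ZX0 b : Z * (b *: X0) = (b *: X0) * Z.
    by rewrite -scalerAl -scalerAr -!mulmxE comm.
  exists (expmx ((c + r) *: X0)), (expmx Z * C); split; first by exists (c + r).
    by apply: expprodM => //; exact: expprod_exp.
  have -> : X = c *: X0 + Z by rewrite addrC subrK.
  rewrite expmxD; last by rewrite /GRing.comm ZX0.
  rewrite (scalerDl X0 c r) [expmx (c *: X0 + r *: X0)]expmxD; last first.
    by rewrite /GRing.comm -!scalerAl -!scalerAr !scalerA mulrC.
  have := expmx_intertwine (esym (expmx_intertwine (esym (ZX0 r)))) => ee.
  by rewrite -!mulrA; congr (_ * _); rewrite !mulrA ee.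
Qed.

End Constructions.

(** * Construction of type II and minimal causal subspaces *)

Section TypeII.
Variables (R : realType) (n : nat).
Local Notation V := 'rV[R]_n.+2.
Local Notation M := 'M[R]_n.+2.
Local Notation g := (@lform R n).
Implicit Types (p q t u v w x y z : V) (A B C X Y Z S W U H : M) (a b c : R).
Implicit Types (G K T : set M).

(** A skew operator is half the sum of the wedges of dual basis vectors with their images; the signs
    make the coordinate basis dual to itself. Since Y = P Y, the first factors can be projected into
    W. *)
Lemma skew_wedge_sum W Y : (W :&: perp W)%MS = 0 -> skew Y ->
  perp_proj W *m Y = Y ->
  Y = 2%:R^-1 *: \sum_j ((if j == ord0 then -1 else 1) *:
    wedge (delta_mx 0 j *m perp_proj W) (delta_mx 0 j *m Y)).
Proof.
move=> Wd sY PY; pose P := perp_proj W.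
pose eps (j : 'I_n.+2) : R := if j == ord0 then -1 else 1.
have decomp u B : \sum_j (eps j * g u (delta_mx 0 j)) *: (delta_mx 0 j *m B) = u *m B.
  rewrite [in RHS](row_sum_delta u) mulmx_suml; apply: eq_bigr => j _.
  rewrite -scalemxAl lform_delta /eps; congr (_ *: _).
  by case: ifP => _; ring.
apply: mulmx_row_ext => u; rewrite -scalemxAr mulmx_sumr.
have -> : \sum_j u *m (eps j *: wedge (delta_mx 0 j *m P) (delta_mx 0 j *m Y)) =
    u *m P *m Y + u *m Y *m P.
  rewrite -(decomp (u *m P) Y) -(decomp (u *m Y) P) -big_split /=; apply: eq_bigr => j _.
  rewrite -scalemxAr mul_wedge scalerBr !scalerA -lform_proj //.
  by rewrite sY mulrN scaleNr.
have PYP : u *m Y *m P = u *m Y.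
  apply/eqP; rewrite -subr_eq0; apply/eqP/lform_eq0 => v.
  rewrite lformDl lformNl lform_proj // !sY -mulmxA PY; ring.
rewrite PYP -mulmxA PY; move: (u *m Y) => z.
by apply/rowP => j; rewrite !mxE; field.
Qed.

(** Each X in h is P X, in so(W), plus a remainder that kills W. The two parts annihilate each
    other, so they commute and the exponentials factor accordingly; the first parts generate
    SO0(W). *)
Lemma typeII_of_wedges p q G H : g p p = 0 -> g q q = 0 -> g p q = 1 ->
  connected_Lie_subgroup G -> G `<=` @SOV R n ->
  let W := (p + H + q)%MS in
  (H <= perp (p + q)%MS)%MS -> (3 <= \rank W)%N -> (W :&: perp W)%MS = 0 ->
  (forall X, Lie_of G X -> stablemx W X) ->
  (forall x y, (x <= W)%MS -> (y <= W)%MS -> Lie_of G (wedge x y)) ->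
  typeII p q G.
Proof.
move=> pp qq pq cG GV W HE rW Wd WX Gw.
have [sG Lsub _] := cG; have [h00 hD' hZ' hB'] := Lsub.
have hs X : Lie_of G X -> skew X by exact: Lie_of_skew.
pose P := perp_proj W.
pose so := [set Y | skew Y /\ P *m Y = Y].
have soG : so `<=` Lie_of G.
  move=> Y [sY PY]; rewrite (skew_wedge_sum Wd sY PY); apply: (hZ').
  apply: (big_ind (Lie_of G)) => // j _; apply: hZ'; apply: Gw.
    exact: perp_proj_sub.
  have -> : (delta_mx 0 j : V) *m Y = delta_mx 0 j *m Y *m P.
    apply/eqP; rewrite -subr_eq0; apply/eqP/lform_eq0 => v.
    rewrite lformDl lformNl lform_proj // !sY -mulmxA PY; ring.
  exact: perp_proj_sub.
have wedge_so x y : (x <= W)%MS -> (y <= W)%MS -> so (wedge x y).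
  move=> xW yW; split; first exact: wedge_skew.
  apply: mulmx_row_ext => u; rewrite mulmxA !mul_wedge !lform_proj //.
  by rewrite !perp_proj_id.
have pW : (p <= W)%MS by rewrite /W -addsmxA addsmxSl.
have qW : (q <= W)%MS by exact: addsmxSr.
have tW : (p - q <= W)%MS by rewrite addmx_sub // eqmx_opp.
have so_perp Y : so Y -> perp W *m Y = 0.
  by move=> [_ <-]; rewrite mulmxA perp_proj_0 // mul0mx.
have so_proj Y : so Y -> Y *m P = Y.
  move=> [sY PY]; rewrite -{2}PY /P (proj_comm Wd sY) //.
  by apply: WX; apply: soG.
have SOE : SO0 W = expprod so.
  apply/seteqP; split.
    exact: (SO0_expprod Wd tW (pq_timelike pp qq pq) rW wedge_so).
  apply: expprod_SO0 => Y r soY; have [sY PY] := soY; apply: SO_expmx.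
  - exact: skewZ.
  - by rewrite -(so_proj Y soY) -scalemxAr mulmxA; apply: scalemx_sub; exact: perp_proj_sub.
  - by rewrite -scalemxAr so_perp // scaler0.
pose k := [set X | Lie_of G X /\ W *m X = 0].
have [cK KG] := annihilator_connected W cG.
exists H, (expprod k); split=> //.
  move=> A KA; apply: SO_perp_of_fix; first exact: GV (KG A KA).
  by apply: expprod_fix KA => X [].
rewrite -/W SOE; apply/seteqP; split; last first.
  move=> _ [B [C [soB KC ->]]]; have [_ _ GM _] := sG.
  by apply: GM; [exact: expprod_sub soB|exact: KG].
rewrite {1}(connected_expprod cG).
apply: expprod_ind => [|X A hX [B [C [soB KC ->]]]].
  by exists 1, 1; split; [exact: expprod1|exact: expprod1|rewrite mulr1].
have sX := hs X hX; have sWX := WX X hX.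
pose Y := P *m X; pose Z := X - Y.
have soY : so Y.
  by split; [exact: proj_skew|rewrite mulmxA proj_idem].
have kZ : k Z.
  split; first by apply: hD' => //; rewrite -scaleN1r; apply: hZ'; exact: soG.
  by rewrite mulmxBr mulmxA perp_proj_id // subrr.
have ZP Y' : so Y' -> Z * Y' = Y' * Z.
  move=> soY'; have [sY' PY'] := soY'; rewrite -!mulmxE.
  have PZ : P *m Z = 0 by rewrite mulmxBr mulmxA proj_idem // subrr.
  have ZP0 : Z *m P = 0.
    have sZ : skew Z by exact: hs kZ.1.
    by rewrite -(proj_comm Wd sZ) //; apply: WX; exact: kZ.1.
  by rewrite -{1}PY' mulmxA ZP0 mul0mx -(so_proj Y' soY') -mulmxA PZ mulmx0.
have ZB : expmx Z * B = B * expmx Z.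
  move: B soB; apply: expprod_ind => [|Y' B soY' ZB] /=; first by rewrite mulr1 mul1r.
  have := expmx_intertwine (esym (expmx_intertwine (ZP Y' soY'))) => ee.
  by rewrite mulrA -ee -!mulrA ZB.
exists (expmx Y * B), (expmx Z * C); split.
- by apply: expprodM => //; exact: expprod_exp.
- by apply: expprodM => //; exact: expprod_exp.
- have -> : X = Y + Z by rewrite addrC subrK.
  rewrite expmxD; last by rewrite /GRing.comm -ZP.
  by rewrite -!mulrA; congr (_ * _); rewrite !mulrA ZB.
Qed.

(** The whole space qualifies, so a minimal rank exists. Causal vectors are used instead of timelike
    ones so that a subspace which does not qualify is positive definite. *)
Lemma minimal_invariant_lorentzian (h : set M) :
  exists W, [/\ forall X, h X -> stablemx W X,
    exists v, [/\ (v <= W)%MS, v != 0 & g v v <= 0]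
  & forall S, (forall X, h X -> stablemx S X) ->
     (exists v, [/\ (v <= S)%MS, v != 0 & g v v <= 0]) ->
     (\rank W <= \rank S)%N].
Proof.
pose Q r := `[< exists W, [/\ forall X, h X -> stablemx W X,
    exists v, [/\ (v <= W)%MS, v != 0 & g v v <= 0] & \rank W = r] >].
have ex : exists r, Q r.
  exists n.+2; apply/asboolP; exists 1%:M; split; last exact: mxrank1.
    by move=> X _; exact: submx1.
  exists (e0 R n); split; first exact: submx1.
    by apply/eqP => e00; have := lform_e0_e0 R n; rewrite e00 lform0l => /esym/eqP;
      rewrite oppr_eq0 oner_eq0.
  by rewrite lform_e0_e0 lerN10.
case: (ex_minnP ex) => r /asboolP[W [WX Wv rW]] rmin.
exists W; split=> // S SX Sv; rewrite rW; apply: rmin; apply/asboolP.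
by exists S.
Qed.

End TypeII.

(** * From total reducibility to the three types *)

Section Classification.
Variables (R : realType) (n : nat).
Local Notation V := 'rV[R]_n.+2.
Local Notation M := 'M[R]_n.+2.
Local Notation g := (@lform R n).
Implicit Types (p q t u v w x y z : V) (A B C X Y Z S W U H : M) (a b c : R).
Implicit Types (G K T : set M).

Lemma totally_reducible_types p q G : g p p = 0 -> g q q = 0 -> g p q = 1 ->
  connected_Lie_subgroup G -> G `<=` @SOV R n -> totally_reducible G ->
  [\/ up_to_conjugation (@typeI R n) G, up_to_conjugation (typeII p q) G
    | up_to_conjugation (typeIII p q) G].
Proof.
move=> pp qq pq cG GV TR.
have [sG Lsub _] := cG; have [h00 hD' hZ' hB'] := Lsub.
pose h := Lie_of G.
have GE : G = expprod h by exact: connected_expprod.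
have hs X : h X -> skew X by exact: Lie_of_skew.
have inv_of U : (forall X, h X -> stablemx U X) -> invariant_subspace G U.
  by move=> UX A; rewrite GE; exact: expprod_stable.
case: (pselect (fixes_timelike G)) => [fixG|nofix]; first by constructor 1; exact: typeI_of_fixed.
have nofixX t : g t t < 0 -> ~ (forall X, h X -> t *m X = 0).
  move=> tt tX; apply: nofix; exists t => // A.
  by rewrite GE; apply: expprod_fix => X; exact: tX.
have genline (x : V) X : (exists c, x *m X = c *: x) -> stablemx <<x>>%MS X.
  move=> [c xc]; have xx : (<<x>> :=: x)%MS by exact: genmxE.
  have : (x *m X <= <<x>>)%MS by rewrite xx xc scalemx_sub.
  by apply: submx_trans; apply: submxMr; rewrite xx.
have line_of_sub (x y : V) : (y <= x)%MS -> exists c, y = c *: x.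
  by move=> /submxP[D ->]; exists (D 0 0); rewrite [D in LHS]mx11_scalar mul_scalar_mx.
have lineG x : (forall X, h X -> exists c, x *m X = c *: x) -> line_invariant G x.
  move=> xX A GA; have := inv_of <<x>>%MS (fun X hX => genline x X (xX X hX)) A GA.
  have xx : (<<x>> :=: x)%MS by exact: genmxE.
  move=> sA; apply: line_of_sub; rewrite -xx; apply: submx_trans sA.
  by apply: submxMr; rewrite xx.
have conjE B A : SOV B -> conj_set (invmx B) G A -> exists2 C, G C & A = invmx B *m C *m B.
  by move=> sB [C GC <-]; exists C => //; rewrite (_ : (invmx B)^-1 = B) //; exact: (@invrK _ B).
have conj_line B x : SOV B -> line_invariant G x ->
    line_invariant (conj_set (invmx B) G) (x *m B).
  move=> sB Gx A /(conjE B A sB)[C GC ->]; have [c xc] := Gx C GC; exists c.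
  by rewrite !mulmxA mulmxK ?SOV_unit // xc scalemxAl.
have uV B : SOV B -> invmx B \is a GRing.unit by move=> /SOV_inv/SOV_unit.
case: (pselect (exists2 x, x != 0 /\ g x x = 0 &
    forall X, h X -> exists c, x *m X = c *: x)) => [[x [x0 xx] xX]|noline].
  constructor 3; pose U := perp x.
  have GU : invariant_subspace G U.
    apply: inv_of => X hX; apply: (@perp_stable_skew _ _ _ X x (hs X hX)).
    by have [c ->] := xX X hX; exact: scalemx_sub.
  have [U' [GU' sU cU]] := TR U GU.
  (* A complement of the hyperplane orthogonal to x is a line, and it is not orthogonal to x. *)
  have rU' : (\rank U' <= 1)%N.
    have := mxrank_disjoint_sum cU; rewrite sU mxrank1 rank_perp => rs.
    have : (n.+2 - \rank x + \rank U' <= n.+2 - \rank x + \rank x)%N.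
      by rewrite -rs subnK // rank_leq_col.
    by rewrite leq_add2l => /leq_trans; apply; exact: rank_leq_row.
  have [w wU' xw] : exists2 w : V, (w <= U')%MS & g x w != 0.
    apply: contrapT => no; move/eqP: x0; apply; apply: lform_eq0 => v.
    have : (v <= U + U')%MS by rewrite sU submx1.
    move=> /sub_addsmxP[[a b] ->] /=; rewrite lformDr lformC.
    have /perpP -> // : (a *m U <= perp x)%MS by exact: submxMl.
    rewrite add0r; apply: contrapT => /eqP xb; apply: no; exists (b *m U') => //.
    exact: submxMl.
  have w0 : w != 0 by apply: contra_neq xw => ->; rewrite lform0r.
  have U'w : (U' <= w)%MS.
    rewrite -(geq_leqif (mxrank_leqif_sup wU')).
    by apply: leq_trans rU' _; rewrite rank_rV w0.
  have wX X : h X -> exists c, w *m X = c *: w.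
    move=> hX; apply: line_of_sub; apply: submx_trans U'w.
    by apply: submx_trans (Lie_of_stable GU' hX); apply: submxMr.
  have [z [zX zx xz zz]] : exists z : V, [/\ forall X, h X -> exists c, z *m X = c *: z,
      z != 0, g x z = 1 & g z z = 0].
    pose w1 := (g x w)^-1 *: w.
    have xw1 : g x w1 = 1 by rewrite lformZr mulVf.
    have w1X X : h X -> exists c, w1 *m X = c *: w1.
      by move=> /wX[c wc]; exists c; rewrite -scalemxAl wc !scalerA mulrC.
    move: w1 xw1 w1X => w1 xw1 w1X.
    (* Correcting w1 by x makes z isotropic. It remains an eigenvector: z X is a combination of x
       and z, and pairing it with z leaves just the coefficient of x, which is 0 by skewness. *)
    pose z := w1 - (g w1 w1 / 2%:R) *: x.
    have xz : g x z = 1 by rewrite /z !lformE xw1 xx; ring.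
    have zz : g z z = 0 by rewrite /z !lformE (lformC w1 x) xw1 xx; field.
    exists z; split=> //; last first.
      by apply/eqP => z0; have := xz; rewrite z0 lform0r => /esym/eqP; rewrite oner_eq0.
    move=> X hX; have [c wc] := w1X X hX; have [d xd] := xX X hX.
    have zE : z *m X = (c * g w1 w1 / 2%:R - d * g w1 w1 / 2%:R) *: x + c *: z.
      rewrite /z mulmxBl -scalemxAl wc xd; apply/rowP => j; rewrite !mxE; ring.
    exists c; rewrite zE.
    have := skew_diag z (hs X hX); rewrite zE lformDl !lformZl xz zz mulr1 mulr0 addr0.
    by move=> ->; rewrite scale0r add0r.
  have [B sB pair] := SOV_witt_pair pp qq pq xx zz xz.
  have iB := SOV_unit sB.
  exists (invmx B); first exact: SOV_inv.
  have cG' : connected_Lie_subgroup (conj_set (invmx B) G).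
    by apply: conj_connected => //; exact: uV.
  have GV' := conj_SOV (SOV_inv sB) GV.
  have Gx := conj_line B x sB (lineG x xX).
  have Gz := conj_line B z sB (lineG z zX).
  have [Gp Gq] : line_invariant (conj_set (invmx B) G) p /\
      line_invariant (conj_set (invmx B) G) q.
    by case: pair => -[e1 e2]; rewrite e1 e2 in Gx Gz.
  (* If the Lie algebra of the conjugated group killed p, that group would fix p, hence q, hence the
     timelike p - q. *)
  apply: typeIII_of_lines => //; apply: contrapT => no.
  have pX X : Lie_of (conj_set (invmx B) G) X -> p *m X = 0.
    by move=> hX; apply: contrapT => /eqP pX; apply: no; exists X.
  have [p0 q0] := pq_neq0 pq.
  have pA A : conj_set (invmx B) G A -> p *m A = p.
    by rewrite (connected_expprod cG'); apply: expprod_fix.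
  have qA A : conj_set (invmx B) G A -> q *m A = q.
    move=> GA; have [c qc] := Gq A GA; have [iA _] := GV' A GA.
    have := iA p q; rewrite (pA A GA) qc lformZr pq mulr1 => ->.
    by rewrite scale1r.
  have fixG' : fixes_timelike (conj_set (invmx B) G).
    exists (p - q); first exact: pq_timelike.
    by move=> A GA; rewrite mulmxBl pA // qA.
  apply: nofix; have := fixes_timelike_conj (SOV_inv (SOV_inv sB)) fixG'.
  by rewrite [invmx (invmx B)]/((invmx B)^-1) conj_setK //; exact: uV.
constructor 2.
have [W [WX [v [vW v0 vv]] Wmin]] := minimal_invariant_lorentzian h.
have nondeg U : (forall X, h X -> stablemx U X) -> (U :&: perp U)%MS = 0.
  move=> UX; apply/eqP; apply: contrapT => /negP/rowV0Pn[x xU x0].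
  have [xx Gx] := radical_line_invariant GV (inv_of U UX) xU x0.
  apply: noline; exists x => // X hX.
  apply: line_of_sub; rewrite -(genmxE x) -(genmxE (x *m X)).
  have GX : invariant_subspace G <<x>>%MS by move=> A GA; apply: genline; exact: Gx.
  have xx' : (<<x>> :=: x)%MS by exact: genmxE.
  rewrite !genmxE -xx'; apply: submx_trans (Lie_of_stable GX hX).
  by apply: submxMr; rewrite xx'.
have Wd := nondeg W WX.
have [t tW tt] : exists2 t : V, (t <= W)%MS & g t t < 0.
  case: (ltrP (g v v) 0) => [|vge]; first by exists v.
  have {}vv : g v v = 0 by apply/le_anti; rewrite vv vge.
  have [z [zW zz vz]] := witt_partner Wd v0 vW vv.
  exists (v - z); first by rewrite addmx_sub // eqmx_opp.
  by rewrite !lformE (lformC z v) vv zz vz; lra.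
(* If S has a causal vector, minimality gives S = W. Otherwise S is positive definite and the
   component of t orthogonal to S is timelike, so by minimality W is orthogonal to S, and S = 0. *)
have irr S : (S <= W)%MS -> (forall X, h X -> stablemx S X) -> S = 0 \/ (W <= S)%MS.
  move=> SW SX; case: (pselect (exists v, [/\ (v <= S)%MS, v != 0 & g v v <= 0])) => [Sv|Spos].
    by right; rewrite -(geq_leqif (mxrank_leqif_sup SW)); exact: Wmin.
  left; have Sd := nondeg S SX.
  pose S' := (W :&: perp S)%MS.
  have S'X X : h X -> stablemx S' X.
    move=> hX; rewrite sub_capmx; apply/andP; split.
      by apply: submx_trans (WX X hX); apply: submxMr; exact: capmxSl.
    apply: submx_trans (perp_stable_skew (hs X hX) (SX X hX)).
    by apply: submxMr; exact: capmxSr.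
  pose t' := t - t *m perp_proj S.
  have t'S : (t' <= perp S)%MS by exact: proj_perp_compl.
  have t'W : (t' <= W)%MS.
    by rewrite addmx_sub // eqmx_opp; apply: submx_trans SW; exact: perp_proj_sub.
  have t't' : g t' t' <= g t t.
    have orth : g (t *m perp_proj S) t' = 0.
      by have /perpP/(_ _ (perp_proj_sub S t)) := t'S; rewrite lformC.
    have pos : 0 <= g (t *m perp_proj S) (t *m perp_proj S).
      case: (lerP 0 (g (t *m perp_proj S) (t *m perp_proj S))) => // neg.
      exfalso; apply: Spos; exists (t *m perp_proj S); split.
      - exact: perp_proj_sub.
      - by apply: contraTneq neg => ->; rewrite lform0l ltxx.
      - exact: ltW.
    have tE : t = t *m perp_proj S + t' by rewrite addrC subrK.
    have -> : g t t = g (t *m perp_proj S) (t *m perp_proj S) + g t' t'.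
      rewrite [in LHS]tE; move: (t *m _) t' orth {pos t'S t'W tE} => a b ab.
      by rewrite lformDl !lformDr ab (lformC b) ab; ring.
    by rewrite ler_wpDl.
  have t'0 : g t' t' < 0 by exact: le_lt_trans tt.
  have WS' : (W <= S')%MS.
    rewrite -(geq_leqif (mxrank_leqif_sup (capmxSl W (perp S)))); apply: Wmin => //.
    exists t'; split; last exact: ltW.
      by rewrite sub_capmx t'W.
    by apply: contraTneq t'0 => ->; rewrite lform0l ltxx.
  apply/eqP; rewrite -submx0 -Sd sub_capmx submx_refl.
  by apply: submx_trans SW _; apply: submx_trans WS' _; exact: capmxSr.
(* In dimension 1 skew operators kill t, which G would then fix; in dimension 2 they preserve the
   isotropic lines of W. Both cases are excluded. *)
have rW : (3 <= \rank W)%N.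
  rewrite ltnNge; apply/negP => r2.
  have t0 : t != 0 by apply: contraTneq tt => ->; rewrite lform0l ltxx.
  case: (leqP (\rank W) 1) => r1.
    have Wt : (W <= t)%MS.
      rewrite -(geq_leqif (mxrank_leqif_sup tW)).
      by apply: leq_trans r1 _; rewrite rank_rV t0.
    apply: (nofixX t tt) => X hX.
    have [c tc] : exists c, t *m X = c *: t.
      apply: line_of_sub; apply: submx_trans Wt.
      by apply: submx_trans (WX X hX); exact: submxMr.
    have := skew_diag t (hs X hX); rewrite tc lformZl => /eqP.
    by rewrite mulf_eq0 (lt_eqF tt) orbF => /eqP ->; rewrite scale0r.
  have rt : (\rank t < \rank W)%N.
    by apply: leq_ltn_trans r1; exact: rank_leq_row.
  have [s s0 [sW st]] := orth_vector_exists rt.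
  have {}st : g s t = 0 by apply: st.
  have ss : 0 < g s s.
    rewrite ltNge; apply: contra s0 => ss; apply/eqP.
    by apply: (timelike_orth tt) => //; rewrite lformC.
  have [x [x0 xW xx]] : exists x : V, [/\ x != 0, (x <= W)%MS & g x x = 0].
    pose a := Num.sqrt (g s s / - g t t).
    have aa : a ^+ 2 * g t t = - g s s.
      rewrite sqr_sqrtr; first by field; rewrite lt_eqF.
      by apply: divr_ge0; [exact: ltW|rewrite oppr_ge0 ltW].
    exists (s + a *: t); split.
    - apply/eqP => sat; have := congr1 (g s) sat; rewrite !lformE st mulr0 addr0 => ss0.
      by rewrite ss0 ltxx in ss.
    - by rewrite addmx_sub // scalemx_sub.
    - by rewrite !lformE (lformC t s) st mulrA -expr2 aa; ring.
  have [z [zW zz xz]] := witt_partner Wd x0 xW xx.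
  have z0 : z != 0.
    by apply/eqP => z0; have := xz; rewrite z0 lform0r => /esym/eqP; rewrite oner_eq0.
  have Wxz : (W <= x + z)%MS.
    have xzW : (x + z <= W)%MS by rewrite addsmx_sub xW.
    rewrite -(geq_leqif (mxrank_leqif_sup xzW)); apply: leq_trans r2 _.
    rewrite mxrank_disjoint_sum; first by rewrite !rank_rV x0 z0.
    apply/eqP; rewrite -submx0; apply/row_subP => i.
    have := row_sub i (x :&: z)%MS; rewrite sub_capmx => /andP[].
    move: (row i _) => y /line_of_sub[c ->] /line_of_sub[d cd].
    have := congr1 (g x) cd; rewrite !lformZr xx xz mulr0 mulr1 => d0.
    by rewrite cd -d0 scale0r sub0mx.
  apply: noline; exists x => // X hX.
  have : (x *m X <= W)%MS by apply: submx_trans (WX X hX); exact: submxMr.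
  move=> /submx_trans/(_ Wxz)/sub_addsmxP[[a b] /=].
  rewrite [a]mx11_scalar [b]mx11_scalar !mul_scalar_mx => xX.
  exists (a 0 0); rewrite xX.
  have := skew_diag x (hs X hX); rewrite xX !lformE (lformC z x) xx xz mulr0 add0r mulr1.
  by move=> ->; rewrite scale0r addr0.
have wedgeG := irreducible_wedge Lsub hs WX Wd irr rW tW tt.
have [x [x0 xW xx]] : exists x : V, [/\ x != 0, (x <= W)%MS & g x x = 0].
  have [X [p' [q' [a [[_ pW _] [[pp' _ pq'] _]]]]]] :=
    witt_eigen_pair_exists Lsub hs WX Wd irr rW tW tt.
  by exists p'; split=> //; have [] := pq_neq0 pq'.
have [z [zW zz xz]] := witt_partner Wd x0 xW xx.
have [B sB pair] := SOV_witt_pair pp qq pq xx zz xz.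
have iB := SOV_unit sB.
exists (invmx B); first exact: SOV_inv.
have cG' : connected_Lie_subgroup (conj_set (invmx B) G).
  by apply: conj_connected => //; exact: uV.
have GV' := conj_SOV (SOV_inv sB) GV.
(* The Witt pair found in W has been moved to p and q, so the image of W contains both and splits
   off its part in E. *)
pose H := (W *m B :&: perp (p + q)%MS)%MS.
have [pW qW] : (p <= W *m B)%MS /\ (q <= W *m B)%MS.
  by case: pair => -[<- <-]; rewrite !submxMr.
have WE : (p + H + q :=: W *m B)%MS.
  apply/eqmxP; apply/andP; split; first by rewrite !addsmx_sub pW qW capmxSl.
  apply/row_subP => i; have := row_sub i (W *m B); move: (row i _) => u uW.
  have -> : u = g u q *: p + (u - g u q *: p - g u p *: q) + g u p *: q.
    by apply/rowP => j; rewrite !mxE; ring.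
  rewrite !addmx_sub_adds ?scalemx_sub //.
  rewrite sub_capmx; apply/andP; split; first by rewrite !addmx_sub ?eqmx_opp ?scalemx_sub.
  by apply/sub_EP; rewrite !lformE pp qq pq (lform_qp pq); split; ring.
have W'd : ((p + H + q) :&: perp (p + H + q)%MS)%MS = 0.
  apply/eqP; apply: contrapT => /negP/rowV0Pn[u].
  rewrite sub_capmx => /andP[+ /perpP uW']; rewrite WE => /submxP[D uD] u0.
  move/eqP: u0; apply; rewrite uD mulmxA.
  have -> : D *m W = 0; last by rewrite mul0mx.
  apply/eqP; rewrite -submx0 -Wd sub_capmx submxMl; apply/perpP => w wW.
  have [iB' _] := sB.
  by rewrite -iB' -mulmxA -uD uW' // WE; exact: submxMr.
apply: (@typeII_of_wedges _ _ p q _ H) => //.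
- exact: capmxSr.
- by rewrite WE mxrankMfree // row_free_unit.
- move=> X hX; apply: Lie_of_stable hX => A /(conjE B A sB)[C GC ->].
  have WC := inv_of W WX C GC; rewrite WE (eqmxMr _ WE).
  by rewrite !mulmxA mulmxK //; apply: submxMr.
- move=> x' y'; rewrite !WE => /submxP[D1 ->] /submxP[D2 ->].
  rewrite !mulmxA; have [iB' _] := sB.
  have -> : wedge (D1 *m W *m B) (D2 *m W *m B) =
      invmx B *m wedge (D1 *m W) (D2 *m W) *m B.
    by rewrite -(mulmxA (invmx B)) wedge_conj // mulmxA mulVmx // mul1mx.
  have hw : h (wedge (D1 *m W) (D2 *m W)) by apply: wedgeG; exact: submxMl.
  move=> r; exists (expmx (r *: wedge (D1 *m W) (D2 *m W))); first exact: hw.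
  rewrite -expmx_conj; last exact: uV.
  rewrite (_ : (invmx B)^-1 = B); last exact: (@invrK _ B).
  by rewrite -scalerAr -scalerAl.
Qed.

End Classification.

(** * The types exclude each other *)

Section Exclusivity.
Variables (R : realType) (n : nat).
Local Notation V := 'rV[R]_n.+2.
Local Notation M := 'M[R]_n.+2.
Local Notation g := (@lform R n).

Lemma isotropic_line_conj A (G : set M) (x : V) : SOV A -> x != 0 -> g x x = 0 ->
  line_invariant G x ->
  exists y, [/\ y != 0, g y y = 0 & line_invariant (conj_set A G) y].
Proof.
move=> sA x0 xx Gx; have uA := SOV_unit sA; have [iA _] := SOV_inv sA.
exists (x *m A^-1); split; last exact: line_invariant_conj.
  by apply: contra_neq x0 => xA; rewrite -[x](mulmxKV uA) xA mul0mx.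
by rewrite iA.
Qed.

Lemma conj_setVK A (G : set M) : SOV A -> conj_set (invmx A) (conj_set A G) = G.
Proof. by move=> /SOV_unit uA; exact: conj_setK. Qed.

Lemma up_to_conjugation_timelike (P : set M -> Prop) G :
  (forall K, P K -> fixes_timelike K) -> up_to_conjugation P G -> fixes_timelike G.
Proof.
move=> PK [A sA /PK]; rewrite -{2}(conj_setVK G sA).
exact/fixes_timelike_conj/SOV_inv.
Qed.

Lemma up_to_conjugation_isotropic (P : set M -> Prop) G :
  (forall K, P K -> exists x, [/\ x != 0, g x x = 0 & line_invariant K x]) ->
  up_to_conjugation P G -> exists x, [/\ x != 0, g x x = 0 & line_invariant G x].
Proof.
move=> PK [A sA /PK[x [x0 xx Gx]]]; rewrite -(conj_setVK G sA).
exact: (isotropic_line_conj (SOV_inv sA) x0 xx Gx).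
Qed.

End Exclusivity.

Theorem corollary2p5 (R : realType) (n : nat)
    (p : 'rV[R]_n.+2) (e : 'M[R]_(n, n.+2)) (q : 'rV[R]_n.+2)
    (hW : witt_basis p e q)
    (G : set 'M[R]_n.+2)
    (hG : connected_Lie_subgroup G) (hGV : G `<=` @SOV R n) :
  let I := up_to_conjugation (@typeI R n) G in
  let II := up_to_conjugation (typeII p q) G in
  let III := up_to_conjugation (typeIII p q) G in
  (totally_reducible G <-> [\/ I, II | III])
  /\ [/\ ~ (I /\ II), ~ (I /\ III) & ~ (II /\ III)].
Proof.
have [pp qq pq _ _] := hW; have [p0 q0] := pq_neq0 pq.
have noline K x : typeII p q K -> x != 0 -> lform x x = 0 -> ~ line_invariant K x.
  by move=> K2 x0 xx; apply: (typeII_no_causal_line pp qq pq K2) => //; rewrite xx.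
have timelikeI : up_to_conjugation (@typeI R n) G -> fixes_timelike G.
  by apply: up_to_conjugation_timelike => K; exact: typeI_fixes_timelike.
split; [split; first exact: totally_reducible_types|].
  case=> -[A sA GA]; apply: (totally_reducible_conj (SOV_unit sA)).
  - exact: typeI_totally_reducible.
  - apply: totally_reducible_no_line; first exact: conj_SOV.
    by move=> x; exact: noline.
  - by apply: (typeIII_totally_reducible pp qq pq) => //; exact: conj_SOV.
split=> -[].
- move=> /timelikeI fixG [A sA G2].
  have [t tt Gt] := fixes_timelike_conj sA fixG.
  (* A fixed timelike vector spans an invariant causal line, with factor 1. *)
  apply: (typeII_no_causal_line pp qq pq G2 _ (ltW tt)).
    by apply: contraTneq tt => ->; rewrite lform0l ltxx.
  by move=> B GB; exists 1; rewrite Gt // scale1r.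
- move=> /timelikeI fixG [A sA G3].
  have [_ Gq [B [l [GB _ l1 pB]]]] := typeIII_lines pp qq pq G3.
  have [iB _] := conj_SOV sA hGV GB.
  apply: (boost_not_timelike pp qq pq GB iB l1 pB Gq).
  exact: fixes_timelike_conj.
- move=> [A sA G2] G3.
  have [x [x0 xx Gx]] :
      exists x, [/\ x != 0, lform x x = 0 & line_invariant G x].
    apply: up_to_conjugation_isotropic G3 => K K3; exists p; split=> //.
    by have [] := typeIII_lines pp qq pq K3.
  have [y [y0 yy Gy]] := isotropic_line_conj sA x0 xx Gx.
  exact: noline G2 y0 yy Gy.
Qed.
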